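(* The following natural isomorphisms hold: $$\mathbb{V}^{\mathsf R}\circ\mathcal{Q}\simeq\mathcal{Q}\circ\mathbb{V}^{\mathsf R},\qquad \mathsf{Clop}\circ\mathbb{V}^{\mathsf R}\simeq\mathbb{K}^{\mathsf S}\circ\mathsf{Clop},\qquad \mathbb{I}\circ\mathbb{K}^{\mathsf S}\simeq\mathbb{J}^{\mathsf P}\circ\mathbb{I},$$ $$\mathcal{O}\circ\mathcal{Q}\simeq\mathbb{I}\circ\mathsf{Clop},\qquad \mathcal{O}\circ\mathbb{V}^{\mathsf R}\simeq\mathbb{J}^{\mathsf P}\circ\mathcal{O}.$$ That is, the diagram formed by the functors $\mathcal{Q}\colon\mathsf{StoneE}^{\mathsf R}\to\mathsf{KHaus}^{\mathsf R}$, $\mathsf{Clop}\colon\mathsf{StoneE}^{\mathsf R}\to\mathsf{SubS5}^{\mathsf S}$, the contravariant functors $\mathbb{I}\colon\mathsf{SubS5}^{\mathsf S}\to\mathsf{KRFrm}^{\mathsf P}$ and $\mathcal{O}\colon\mathsf{KHaus}^{\mathsf R}\to\mathsf{KRFrm}^{\mathsf P}$, and the endofunctors $\mathbb{V}^{\mathsf R}$ on $\mathsf{KHaus}^{\mathsf R}$ and on $\mathsf{StoneE}^{\mathsf R}$, $\mathbb{K}^{\mathsf S}$ on $\mathsf{SubS5}^{\mathsf S}$, and $\mathbb{J}^{\mathsf P}$ on $\mathsf{KRFrm}^{\mathsf P}$ commutes up to natural isomorphism.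
   Context: Relations $R\colon X\to Y$ are subsets of $X\times Y$; $x\,(T\circ R)\,z$ iff $\exists y$ with $x\,R\,y$ and $y\,T\,z$; $R^\dagger$ is the converse relation. $\mathsf{KHaus}^{\mathsf R}$ is the category of compact Hausdorff spaces and closed relations (identity relations, relation composition). An $\mathsf{S5}$-subordination space is a pair $(X,E)$ with $X$ a Stone space and $E$ a closed equivalence relation on $X$. $\mathsf{StoneE}^{\mathsf R}$ has these as objects; morphisms $(X_1,E_1)\to(X_2,E_2)$ are closed relations $R\subseteq X_1\times X_2$ with $R\circ E_1=R=E_2\circ R$; composition is relation composition and the identity on $(X,E)$ is $E$. A subordination $S\colon A\to B$ between boolean algebras is a relation $S\subseteq A\times B$ such that (S1) $0\,S\,0$, $1\,S\,1$; (S2) $a\,S\,c$, $b\,S\,c$ imply $(a\vee b)\,S\,c$; (S3) $a\,S\,c$, $a\,S\,d$ imply $a\,S\,(c\wedge d)$; (S4) $a\le b\,S\,c\le d$ implies $a\,S\,d$. An $\mathsf{S5}$-subordination algebra $(B,S)$ is a boolean algebra $B$ with a subordination $S\colon B\to B$ such that (S5) $a\,S\,b$ implies $a\le b$; (S6) $a\,S\,b$ implies $\neg b\,S\,\neg a$; (S7) $a\,S\,b$ implies there is $c$ with $a\,S\,c$ and $c\,S\,b$. $\mathsf{SubS5}^{\mathsf S}$ has these as objects; morphisms $(B_1,S_1)\to(B_2,S_2)$ are subordinations $T\colon B_1\to B_2$ with $T\circ S_1=T=S_2\circ T$; composition is relation composition and the identity on $(B,S)$ is $S$. A de Vries algebra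 is an $\mathsf{S5}$-subordination algebra $(B,S)$ with $B$ complete and such that (S8) $b\ne0$ implies there is $a\neq0$ with $a\,S\,b$. $\mathsf{DeV}^{\mathsf S}$ is the full subcategory of $\mathsf{SubS5}^{\mathsf S}$ of de Vries algebras, with inclusion functor $\Delta\colon\mathsf{DeV}^{\mathsf S}\to\mathsf{SubS5}^{\mathsf S}$. $\mathsf{KRFrm}^{\mathsf P}$ is the category of compact regular frames and preframe homomorphisms (maps preserving finite meets and directed joins). $\mathcal{Q}$ sends $(X,E)$ to $X/E$ and $R\colon(X_1,E_1)\to(X_2,E_2)$ to $\pi_2\circ R\circ\pi_1^\dagger$ with $\pi_i\colon X_i\to X_i/E_i$ the projections. $\mathsf{Clop}$ sends $(X,E)$ to $(\mathsf{Clop}(X),S_E)$ and $R$ to $S_R$, where $\mathsf{Clop}(X)$ is the boolean algebra of clopens and $U\,S_R\,V$ iff $R[U]\subseteq V$. The contravariant functor $\mathcal{O}$ sends $X$ to its frame of opens and a closed relation $R\colon X\to Y$ to $\Box_R\colon\mathcal{O}(Y)\to\mathcal{O}(X)$, $\Box_RU=X\setminus R^{-1}[Y\setminus U]$. The contravariant functor $\mathbb{I}$ sends $(B,S)$ to the frame $\mathcal{SI}(B,S)$, ordered by inclusion, of S-ideals of $(B,S)$ (ideals $I$ of $B$ such that for each $a\in I$ there is $b\in I$ with $a\,S\,b$), and $T\colon(B_1,S_1)\to(B_2,S_2)$ to the map $\mathcal{SI}(B_2,S_2)\to\mathcal{SI}(B_1,S_1)$, $J\mapsto T^{-1}[J]$.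 In a frame $L$, $a^*=\bigvee\{x\mid a\wedge x=0\}$, and $a\prec b$ iff $a^*\vee b=1$. The contravariant functor $\mathfrak{B}\colon\mathsf{KRFrm}^{\mathsf P}\to\mathsf{DeV}^{\mathsf S}$ sends $L$ to $(\mathfrak{B}L,\prec)$, with $\mathfrak{B}L=\{a\in L\mid a=a^{**}\}$ and $\prec$ restricted from $L$, and sends a preframe homomorphism $h\colon L\to M$ to the compatible subordination $\mathfrak{B}(h)\colon\mathfrak{B}M\to\mathfrak{B}L$ with $a\,\mathfrak{B}(h)\,b$ iff $a\prec h(b)$ in $M$. $\mathbb{I}$ and $\Delta\circ\mathfrak{B}$ form a dual equivalence. $\mathbb{V}^{\mathsf R}$ on $\mathsf{KHaus}^{\mathsf R}$: $\mathbb{V}^{\mathsf R}(X)$ is the set of closed subsets of $X$ with the topology generated by the sets $\{F\mid F\subseteq U\}$ and $\{F\mid F\cap U\neq\varnothing\}$, $U$ open; $F\,\mathbb{V}^{\mathsf R}(R)\,G$ iff $G\subseteq R[F]$ and $F\subseteq R^{-1}[G]$. On $\mathsf{StoneE}^{\mathsf R}$: $\mathbb{V}^{\mathsf R}(X,E)=(\mathbb{V}^{\mathsf R}(X),\mathbb{V}^{\mathsf R}(E))$, and $R\mapsto\mathbb{V}^{\mathsf R}(R)$. For a boolean algebra $B$, $\mathbb{K}(B)$ is the quotient of the free boolean algebra over the symbols $\{\Box_a,\Diamond_a\mid a\in B\}$ by $\Box_1=1$, $\Diamond_0=0$, $\Box_{a\wedge b}=\Box_a\wedge\Box_b$, $\Diamond_{a\vee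 b}=\Diamond_a\vee\Diamond_b$, $\Box_{a\vee b}\le\Box_a\vee\Diamond_b$, $\Box_a\wedge\Diamond_b\le\Diamond_{a\wedge b}$. An element is in disjunctive normal form if written as a finite join $\bigvee_{i=1}^n(\Box_{a_i}\wedge\Diamond_{b_{i1}}\wedge\cdots\wedge\Diamond_{b_{in_i}})$ with $0\neq b_{ij}\le a_i$; in conjunctive normal form if written as a finite meet $\bigwedge_{j=1}^m(\Diamond_{c_j}\vee\Box_{d_{j1}}\vee\cdots\vee\Box_{d_{jm_j}})$ with $c_j\le d_{jk}\ne1$ (empty joins/meets allowed). For a subordination $S\colon A\to B$: $x\,\mathcal{S}_\Box\,y$ iff $x\in\mathbb{K}(A)$, $y\in\mathbb{K}(B)$ can be written in disjunctive, resp. conjunctive, normal form so that for all $i,j$ there is $k$ with $a_i\,S\,d_{jk}$; $x\,\mathcal{S}_\Diamond\,y$ iff they can be so written that for all $i,j$ there is $l$ with $b_{il}\,S\,c_j$; $\mathbb{K}^{\mathsf S}(S)$ is the least subordination $\mathbb{K}(A)\to\mathbb{K}(B)$ containing $\mathcal{S}_\Box\cup\mathcal{S}_\Diamond$. The endofunctor $\mathbb{K}^{\mathsf S}$ on $\mathsf{SubS5}^{\mathsf S}$ sends $(B,S)$ to $(\mathbb{K}(B),\mathbb{K}^{\mathsf S}(S))$ and $T$ to $\mathbb{K}^{\mathsf S}(T)$. Finally $\mathbb{J}^{\mathsf P}=\mathbb{I}\circ\mathbb{K}^{\mathsf S}\circ\Delta\circ\mathfrak{B}\colon\mathsf{KRFrm}^{\mathsf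 P}\to\mathsf{KRFrm}^{\mathsf P}$. *)

(* Defs.v *)
From HB Require Import structures.
From mathcomp Require Import all_boot all_order generic_quotient.
From mathcomp Require Import all_classical.
From mathcomp Require Import topology.

Set Implicit Arguments.
Unset Strict Implicit.
Unset Printing Implicit Defensive.

Import Order.TTheory.

Local Open Scope quotient_scope.
Local Open Scope classical_set_scope.
Local Open Scope relation_scope.

(** The objects and morphisms of a category are carved out by [is_ob] and
    [is_mor] from ambient structures (e.g. the compact Hausdorff spaces among
    all topological spaces, the closed relations among all relations).
    A [functor] is the pair of assignments, given on the ambient structures;
    [is_category] and [is_functor] are the laws, which include that the
    assignments send objects to objects and morphisms to morphisms. *)
Record category := Category {
  ob : Type;
  is_ob : ob -> Prop;
  mor : ob -> ob -> Type;
  is_mor : forall X Y, mor X Y -> Prop;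
  idm : forall X, mor X X;
  comp : forall X Y Z, mor Y Z -> mor X Y -> mor X Z }.

Arguments is_ob : clear implicits.
Arguments is_mor {c X Y} : rename.
Arguments idm {c} X : rename.
Arguments comp {c X Y Z} : rename.

Record is_category (C : category) : Prop := IsCategory {
  idm_mor : forall X, is_ob C X -> is_mor (idm X);
  comp_mor : forall (X Y Z : ob C) (g : mor Y Z) (f : mor X Y),
    is_ob C X -> is_ob C Y -> is_ob C Z ->
    is_mor g -> is_mor f -> is_mor (comp g f);
  comp_idl : forall (X Y : ob C) (f : mor X Y),
    is_ob C X -> is_ob C Y -> is_mor f -> comp (idm Y) f = f;
  comp_idr : forall (X Y : ob C) (f : mor X Y),
    is_ob C X -> is_ob C Y -> is_mor f -> comp f (idm X) = f;
  comp_assoc : forall (W X Y Z : ob C)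
      (h : mor Y Z) (g : mor X Y) (f : mor W X),
    is_ob C W -> is_ob C X -> is_ob C Y -> is_ob C Z ->
    is_mor h -> is_mor g -> is_mor f ->
    comp h (comp g f) = comp (comp h g) f }.

Definition op (C : category) : category := {|
  ob := ob C;
  is_ob := is_ob C;
  mor := fun X Y => @mor C Y X;
  is_mor := fun X Y => @is_mor C Y X;
  idm := @idm C;
  comp := fun X Y Z g f => comp (f : @mor C Y X) (g : @mor C Z Y) |}.

Definition full_subcategory (C : category) (P : ob C -> Prop) : category := {|
  ob := ob C;
  is_ob := fun X => is_ob C X /\ P X;
  mor := @mor C;
  is_mor := @is_mor C;
  idm := @idm C;
  comp := @comp C |}.

Record functor (C D : category) := Functor {
  fob :> ob C -> ob D;
  fmor : forall X Y, @mor C X Y -> @mor D (fob X) (fob Y) }.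

Arguments fmor {C D} f0 {X Y} : rename.

Record is_functor (C D : category) (F : functor C D) : Prop := IsFunctor {
  fob_ob : forall X, is_ob C X -> is_ob D (F X);
  fmor_mor : forall (X Y : ob C) (f : mor X Y),
    is_ob C X -> is_ob C Y -> is_mor f -> is_mor (fmor F f);
  fmor_id : forall X, is_ob C X -> fmor F (idm X) = idm (F X);
  fmor_comp : forall (X Y Z : ob C) (g : mor Y Z) (f : mor X Y),
    is_ob C X -> is_ob C Y -> is_ob C Z -> is_mor g -> is_mor f ->
    fmor F (comp g f) = comp (fmor F g) (fmor F f) }.

Definition functor_comp (C D E : category) (G : functor D E) (F : functor C D) :
  functor C E := {|
  fob := fun X => G (F X);
  fmor := fun X Y f => fmor G (fmor F f) |}.

Definition op_functor (C D : category) (F : functor C D) :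
  functor (op C) (op D) :=
  @Functor (op C) (op D) (fob F) (fun X Y f => fmor F (f : @mor C Y X)).

Definition full_inclusion (C : category) (P : ob C -> Prop) :
  functor (full_subcategory P) C :=
  @Functor (full_subcategory P) C id (fun X Y f => f).

Definition is_iso (C : category) (X Y : ob C) (f : mor X Y) :=
  is_mor f /\ exists g : mor Y X,
    [/\ is_mor g, comp g f = idm X & comp f g = idm Y].

Definition nat_iso (C D : category) (F G : functor C D) :=
  exists alpha : forall X, is_ob C X -> @mor D (F X) (G X),
    (forall X hX, is_iso (alpha X hX)) /\
    (forall (X Y : ob C) (hX : is_ob C X) (hY : is_ob C Y) (f : mor X Y),
      is_mor f -> comp (alpha Y hY) (fmor F f) = comp (fmor G f) (alpha X hX)).

Declare Scope functor_scope.
Delimit Scope functor_scope with functor.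
Notation "G ∘ F" := (functor_comp G F)
  (at level 40, left associativity) : functor_scope.
Notation "F ≃ G" := (nat_iso F%functor G%functor)
  (at level 70, no associativity) : type_scope.

(** A relation from X to Y is a [set (X * Y)]; the library's [T \; R] is
    "R, then T" and [R^-1] is the converse. *)

Definition rel_id (X : Type) : set (X * X) := [set xy | xy.1 = xy.2].

Definition graph (X Y : Type) (f : X -> Y) : set (X * Y) :=
  [set xy | f xy.1 = xy.2].

Definition rel_image (X Y : Type) (R : set (X * Y)) (A : set X) : set Y :=
  [set y | exists2 x, A x & R (x, y)].

Definition set_elt (T : Type) (A : set T) (x : T) (Ax : A x) : set_type A :=
  exist _ x (mem_set Ax).

Definition KHausR : category := {|
  ob := topologicalType;
  is_ob := fun X => compact [set: X] /\ hausdorff_space X;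
  mor := fun X Y => set (X * Y);
  is_mor := fun X Y R => closed R;
  idm := rel_id;
  comp := fun X Y Z T R => T \; R |}.

Record eqspace := EqSpace {
  eqsp_sort :> topologicalType;
  eqsp_rel : set (eqsp_sort * eqsp_sort);
  eqsp_refl : forall x, eqsp_rel (x, x);
  eqsp_sym : forall x y, eqsp_rel (x, y) -> eqsp_rel (y, x);
  eqsp_trans : forall x y z,
    eqsp_rel (x, y) -> eqsp_rel (y, z) -> eqsp_rel (x, z) }.

Arguments eqsp_rel : clear implicits.

Definition stone_space (X : topologicalType) :=
  [/\ compact [set: X], hausdorff_space X & basis (@clopen X)].

Definition StoneER : category := {|
  ob := eqspace;
  is_ob := fun X => stone_space X /\ closed (eqsp_rel X);
  mor := fun X Y => set (X * Y);
  is_mor := fun X Y R =>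
    [/\ closed R, R \; eqsp_rel X = R & eqsp_rel Y \; R = R];
  idm := eqsp_rel;
  comp := fun X Y Z T R => T \; R |}.

Definition subordination d d' (A : ctbDistrLatticeType d)
    (B : ctbDistrLatticeType d') (S : set (A * B)) :=
  [/\ S (\bot, \bot)%O /\ S (\top, \top)%O,
      forall a b c, S (a, c) -> S (b, c) -> S (a `|` b, c)%O,
      forall a c d, S (a, c) -> S (a, d) -> S (a, c `&` d)%O &
      forall a b c d, (a <= b)%O -> S (b, c) -> (c <= d)%O -> S (a, d)].

Record subalg := SubAlg {
  subalg_disp : Order.disp_t;
  subalg_sort :> ctbDistrLatticeType subalg_disp;
  subalg_rel : set (subalg_sort * subalg_sort);
  subalg_subordination : subordination subalg_rel }.

Arguments subalg_rel : clear implicits.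

Definition S5_subordination d (B : ctbDistrLatticeType d) (S : set (B * B)) :=
  [/\ forall a b, S (a, b) -> (a <= b)%O,
      forall a b, S (a, b) -> S (~` b, ~` a)%O &
      forall a b, S (a, b) -> exists c, S (a, c) /\ S (c, b)].

Definition SubS5S : category := {|
  ob := subalg;
  is_ob := fun B => S5_subordination (subalg_rel B);
  mor := fun A B => set (A * B);
  is_mor := fun A B T =>
    [/\ subordination T, T \; subalg_rel A = T &
        subalg_rel B \; T = T];
  idm := subalg_rel;
  comp := fun A B C T R => T \; R |}.

Definition de_Vries (B : subalg) :=
  (forall A : set B, supremums A !=set0) /\
  (forall b : B, b <> \bot%O -> exists a : B, a <> \bot%O /\ subalg_rel B (a, b)).

(** Objects of [DeVS] are S5-subordination algebras satisfying [de_Vries]. *)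
Definition DeVS : category := @full_subcategory SubS5S de_Vries.

HB.mixin Record TBLattice_isFrame d T of Order.TBLattice d T := {
  frame_complete : forall A : set T, supremums A !=set0;
  frame_distr : forall (a : T) (A : set T) (s : T),
    supremums A s -> supremums [set (a `&` x)%O | x in A] (a `&` s)%O }.

#[short(type="frameType")]
HB.structure Definition Frame d :=
  { T of Order.TBLattice d T & TBLattice_isFrame d T }.

Section FrameNotions.
Context {d : Order.disp_t} {L : frameType d}.
Implicit Types (a b : L) (A : set L).

Definition fsup A : L := supremum \bot%O A.

Definition pcompl a : L := fsup [set x | (a `&` x)%O = \bot%O].

Definition well_inside a b := (pcompl a `|` b)%O = \top%O.

Definition directed A := A !=set0 /\
  forall x y, A x -> A y -> exists z, [/\ A z, (x <= z)%O & (y <= z)%O].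

End FrameNotions.

Definition compact_frame d (L : frameType d) :=
  forall A : set L, fsup A = \top%O ->
    exists s : seq L, (forall x, x \in s -> A x) /\
      (\join_(x <- s) x)%O = \top%O.

Definition regular_frame d (L : frameType d) :=
  forall a : L, a = fsup [set b | well_inside b a].

Definition preframe_hom d d' (L : frameType d) (M : frameType d')
    (h : L -> M) :=
  [/\ h \top%O = \top%O,
      forall a b, h (a `&` b)%O = (h a `&` h b)%O &
      forall A, directed A -> h (fsup A) = fsup [set h x | x in A]].

Record frame := PackFrame {
  frame_disp : Order.disp_t;
  frame_sort :> frameType frame_disp }.

Definition KRFrmP : category := {|
  ob := frame;
  is_ob := fun L => compact_frame L /\ regular_frame L;
  mor := fun L M => L -> M;
  is_mor := fun L M h => preframe_hom h;
  idm := fun L => id;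
  comp := fun L M N g f => g \o f |}.

Section QuotientSpace.
Variable X : eqspace.

Let E : rel X := fun x y => `[< eqsp_rel X (x, y) >].

Lemma eqsp_equiv : equiv_class_of E.
Proof.
split=> [x|x y|y x z].
- exact/asboolP/eqsp_refl.
- by apply/asboolP/asboolP; exact: eqsp_sym.
- by move=> /asboolP xy /asboolP yz; apply/asboolP; exact: eqsp_trans xy yz.
Qed.

Definition eqsp_equiv_rel : equiv_rel X := EquivRelPack eqsp_equiv.

Definition qspace : topologicalType :=
  quotient_topology {eq_quot eqsp_equiv_rel}.

Definition qproj (x : X) : qspace := \pi_{eq_quot eqsp_equiv_rel} x.

End QuotientSpace.

Definition Qfun : functor StoneER KHausR := @Functor StoneER KHausR qspace
  (fun X Y (R : set (X * Y)) =>
    graph (@qproj Y) \; (R \; (graph (@qproj X))^-1)).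

Definition closeds (X : topologicalType) := set_type (@closed X).

HB.instance Definition _ (X : topologicalType) := Choice.on (closeds X).

(** Subbasic open sets: [(U, true)] stands for the closed sets contained in U,
    and [(U, false)] for those that meet U. *)
HB.instance Definition _ (X : topologicalType) :=
  @isSubBaseTopological.Build (closeds X) (set X * bool)%type
    [set Ub | open Ub.1]
    (fun Ub => if Ub.2 then [set F | \val F `<=` Ub.1]
               else [set F | \val F `&` Ub.1 !=set0]).

Definition vietoris_rel (X Y : topologicalType) (R : set (X * Y)) :
    set (closeds X * closeds Y) :=
  [set FG | \val FG.2 `<=` rel_image R (\val FG.1) /\
            \val FG.1 `<=` rel_image R^-1 (\val FG.2)].

Definition VKHaus : functor KHausR KHausR :=
  @Functor KHausR KHausR closeds vietoris_rel.

Section VietorisEq.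
Variable X : eqspace.
Let E := vietoris_rel (eqsp_rel X).

Lemma vietoris_refl F : E (F, F).
Proof. by split=> x Fx; exists x => //; exact: eqsp_refl. Qed.

Lemma vietoris_sym F G : E (F, G) -> E (G, F).
Proof.
by move=> [GF FG]; split=> [x /FG[y Gy xy]|x /GF[y Fy xy]]; exists y => //;
  exact: eqsp_sym.
Qed.

Lemma vietoris_trans F G H : E (F, G) -> E (G, H) -> E (F, H).
Proof.
move=> [GF FG] [HG GH]; split=> [z /HG[y /GF[x Fx xy] yz]|x /FG[y /GH[z Hz yz] xy]].
  by exists x => //; exact: eqsp_trans xy yz.
by exists z => //; exact: eqsp_trans xy yz.
Qed.

Definition vietoris_eqspace : eqspace :=
  EqSpace vietoris_refl vietoris_sym vietoris_trans.

End VietorisEq.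

Definition VStoneE : functor StoneER StoneER :=
  @Functor StoneER StoneER vietoris_eqspace
    (fun X Y (R : set (X * Y)) => vietoris_rel R).

Definition clopens (X : topologicalType) := set_type (@clopen X).

Section ClopenAlgebra.
Variable X : topologicalType.

Let P : {pred set X} := fun U => U \in (@clopen X : set (set X)).

Lemma clopens_meet : {in P &, forall U V, (U `&` V)%O \in P}.
Proof.
by move=> U V /set_mem cU /set_mem cV; apply/mem_set; exact: clopenI.
Qed.

Lemma clopens_join : {in P &, forall U V, (U `|` V)%O \in P}.
Proof.
by move=> U V /set_mem cU /set_mem cV; apply/mem_set; exact: clopenU.
Qed.

Lemma clopens_bot : \bot%O \in P.
Proof. by apply/mem_set; exact: clopen0. Qed.

Lemma clopens_top : \top%O \in P.
Proof. by apply/mem_set; exact: clopenT. Qed.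

HB.instance Definition _ := SubChoice.on (clopens X).

HB.instance Definition _ := Order.SubChoice_isTBSubLattice.Build
  _ _ _ set_display (clopens X) clopens_meet clopens_join clopens_bot clopens_top.

Lemma clopens_valI (U V : clopens X) : \val (U `&` V)%O = \val U `&` \val V.
Proof. by []. Qed.

Lemma clopens_valU (U V : clopens X) : \val (U `|` V)%O = \val U `|` \val V.
Proof. by []. Qed.

Lemma clopens_leP (U V : clopens X) : reflect (\val U `<=` \val V) (U <= V)%O.
Proof. exact: subsetPset. Qed.

Lemma clopens_val0 : \val (\bot%O : clopens X) = set0.
Proof. by []. Qed.

Lemma clopens_val1 : \val (\top%O : clopens X) = setT.
Proof. by []. Qed.


Definition clopens_compl (U : clopens X) : clopens X :=
  set_elt (clopenC (\val U) (set_valP U)).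

Lemma clopens_meetUl :
  left_distributive (@Order.meet _ (clopens X)) (@Order.join _ (clopens X)).
Proof.
by move=> U V W; apply: val_inj; rewrite !(clopens_valI, clopens_valU) setIUl.
Qed.

HB.instance Definition _ := Order.Lattice_Meet_isDistrLattice.Build
  _ (clopens X) clopens_meetUl.

Lemma clopens_joinxC (U : clopens X) : (U `|` clopens_compl U = \top)%O.
Proof. apply: val_inj; rewrite clopens_valU clopens_val1. exact: setUCr. Qed.

Lemma clopens_meetxC (U : clopens X) : (U `&` clopens_compl U = \bot)%O.
Proof. apply: val_inj; rewrite clopens_valI clopens_val0. exact: setICr. Qed.

HB.instance Definition _ := Order.TBDistrLattice_hasComplement.Build
  _ (clopens X) clopens_joinxC clopens_meetxC.

End ClopenAlgebra.

Section ClopSubordination.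
Variables (X Y : topologicalType) (R : set (X * Y)).

Definition clop_rel : set (clopens X * clopens Y) :=
  [set UV | rel_image R (\val UV.1) `<=` \val UV.2].

Lemma clop_rel_subordination : subordination clop_rel.
Proof.
split.
- by split=> y // [x []].
- by move=> U V W UW VW y [x [Ux|Vx] xy]; [apply: UW | apply: VW]; exists x.
- by move=> U V W UV UW y Uy; split; [exact: UV | exact: UW].
- move=> U V W Z /clopens_leP UV VW /clopens_leP WZ.
  by move=> y [x /UV Vx xy]; apply: WZ; apply: VW; exists x.
Qed.

End ClopSubordination.

Definition clop_subalg (X : eqspace) : subalg :=
  SubAlg (@clop_rel_subordination X X (eqsp_rel X)).

Definition Clopfun : functor StoneER SubS5S :=
  @Functor StoneER SubS5S clop_subalg
    (fun X Y (R : set (X * Y)) => clop_rel R).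

Definition opens (X : topologicalType) := set_type (@open X).

Section OpenFrame.
Variable X : topologicalType.

Let P : {pred set X} := fun U => U \in (@open X : set (set X)).

Lemma opens_meet : {in P &, forall U V, (U `&` V)%O \in P}.
Proof. by move=> U V /set_mem oU /set_mem oV; apply/mem_set; exact: openI. Qed.

Lemma opens_join : {in P &, forall U V, (U `|` V)%O \in P}.
Proof. by move=> U V /set_mem oU /set_mem oV; apply/mem_set; exact: openU. Qed.

Lemma opens_bot : \bot%O \in P.
Proof. by apply/mem_set; exact: open0. Qed.

Lemma opens_top : \top%O \in P.
Proof. by apply/mem_set; exact: openT. Qed.

HB.instance Definition _ := SubChoice.on (opens X).

HB.instance Definition _ := Order.SubChoice_isTBSubLattice.Build
  _ _ _ set_display (opens X) opens_meet opens_join opens_bot opens_top.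

Lemma opens_valI (U V : opens X) : \val (U `&` V)%O = \val U `&` \val V.
Proof. by []. Qed.

Lemma opens_valU (U V : opens X) : \val (U `|` V)%O = \val U `|` \val V.
Proof. by []. Qed.

Lemma opens_leP (U V : opens X) : reflect (\val U `<=` \val V) (U <= V)%O.
Proof. exact: subsetPset. Qed.

Lemma opens_val0 : \val (\bot%O : opens X) = set0.
Proof. by []. Qed.

Lemma opens_val1 : \val (\top%O : opens X) = setT.
Proof. by []. Qed.

Lemma opens_union_open (A : set (opens X)) : open (\bigcup_(U in A) \val U).
Proof. by apply: bigcup_open => U _; exact: (set_valP U). Qed.

Definition opens_union (A : set (opens X)) : opens X :=
  set_elt (opens_union_open A).

Lemma opens_unionP A : supremums A (opens_union A).
Proof.
split=> [U AU|V ub]; apply/opens_leP.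
  by move=> x Ux; exists U.
by move=> x [U /ub /opens_leP]; apply.
Qed.

Lemma opens_complete (A : set (opens X)) : supremums A !=set0.
Proof. by exists (opens_union A); exact: opens_unionP. Qed.

Lemma opens_distr (U : opens X) (A : set (opens X)) (S : opens X) :
  supremums A S ->
  supremums [set (U `&` V)%O | V in A] (U `&` S)%O.
Proof.
move=> /(is_subset1_supremums (opens_unionP A)) <-.
rewrite (_ : (U `&` _)%O = opens_union [set (U `&` V)%O | V in A]).
  exact: opens_unionP.
apply: val_inj; rewrite opens_valI /=; apply/seteqP; split.
  move=> x [Ux [V AV Vx]]; exists (U `&` V)%O; first by exists V.
  by rewrite opens_valI.
move=> x [_ [V AV <-]]; rewrite opens_valI => -[Ux Vx].
by split=> //; exists V.
Qed.

HB.instance Definition _ := TBLattice_isFrame.Build _ (opens X)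
  opens_complete opens_distr.

End OpenFrame.

(** [box R U] is the set X \ R^-1[Y \ U]; the default value of [insubd] is
    irrelevant as this set is open when R is a closed relation between compact
    Hausdorff spaces. *)
Definition box (X Y : topologicalType) (R : set (X * Y)) (U : opens Y) :
    opens X :=
  insubd (\bot%O : opens X) (~` rel_image R^-1 (~` \val U)).

Definition Ofun : functor (op KHausR) KRFrmP :=
  @Functor (op KHausR) KRFrmP (fun X => PackFrame (opens X : frameType _))
    (fun Y X (R : set (X * Y)) => box R).

Definition S_ideal (B : subalg) (I : set B) :=
  [/\ I \bot%O,
      forall a b, I a -> I b -> I (a `|` b)%O,
      forall a b, (a <= b)%O -> I b -> I a &
      forall a, I a -> exists b, I b /\ subalg_rel B (a, b)].

Definition S_ideals (B : subalg) := set_type (@S_ideal B).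

Section IdealFrame.
Variable B : subalg.
Implicit Types (a b c : B) (I J K : S_ideals B) (A : set (S_ideals B)).

HB.instance Definition _ := SubChoice.on (S_ideals B).

HB.instance Definition _ :=
  Order.SubChoice_isSubPOrder.Build _ _ _ set_display (S_ideals B).

Lemma S_ideals_leP I J : reflect (\val I `<=` \val J) (I <= J)%O.
Proof. exact: subsetPset. Qed.

Definition ideal_union A : set B :=
  [set a | exists2 s : seq B,
    (forall x, x \in s -> exists2 I, A I & \val I x) &
    (a <= \join_(x <- s) x)%O].

Lemma ideal_unionP A : S_ideal (ideal_union A).
Proof.
have [[S00 _] Sjoin _ Sle] := @subalg_subordination B.
split.
- by exists [::] => //; rewrite big_nil.
- move=> a b [s sA le_as] [t tA le_bt]; exists (s ++ t).
    by move=> x; rewrite mem_cat => /orP[/sA|/tA].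
  by rewrite big_cat; exact: leU2.
- by move=> a b ab [s sA le_bs]; exists s => //; exact: le_trans le_bs.
- move=> a [s sA le_as].
  suff [t tA st] : exists2 t : seq B,
      (forall x, x \in t -> exists2 I, A I & \val I x) &
      subalg_rel B (\join_(x <- s) x, \join_(x <- t) x)%O.
    exists (\join_(x <- t) x)%O; split; first by exists t.
    exact: Sle le_as st _.
  elim: s sA {le_as} => [|x s IHs] sA.
    by exists [::] => //; rewrite !big_nil.
  have [|t tA st] := IHs.
    by move=> y ys; apply: sA; rewrite inE ys orbT.
  have [I AI Ix] : exists2 I, A I & \val I x by apply: sA; rewrite inE eqxx.
  have [_ _ _ /(_ x Ix)[y [Iy xy]]] := set_valP I.
  exists (y :: t).
    by move=> z; rewrite inE => /predU1P[->|/tA //]; exists I.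
  rewrite !big_cons; apply: Sjoin.
    by apply: Sle xy _ => //; exact: leUl.
  by apply: Sle st _ => //; exact: leUr.
Qed.

Definition ideal_sup A : S_ideals B := set_elt (ideal_unionP A).

Lemma ideal_supP A : supremums A (ideal_sup A).
Proof.
split=> [I AI|J ub]; apply/S_ideals_leP => a.
  move=> Ia; exists [:: a]; last by rewrite big_seq1.
  by move=> x; rewrite inE => /eqP ->; exists I.
have [J0 Jjoin Jle _] := set_valP J.
move=> [s sA le_as]; apply: Jle le_as _.
elim: s sA => [|x s IHs] sA; first by rewrite big_nil.
rewrite big_cons; apply: Jjoin.
  have [I /ub/S_ideals_leP IJ Ix] : exists2 I, A I & \val I x.
    by apply: sA; rewrite inE eqxx.
  exact: IJ.
by apply: IHs => y ys; apply: sA; rewrite inE ys orbT.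
Qed.

Lemma ideal_setI I J : S_ideal (\val I `&` \val J).
Proof.
have [_ _ Smeet Sle] := @subalg_subordination B.
have [I0 Ijoin Ile Iround] := set_valP I.
have [J0 Jjoin Jle Jround] := set_valP J.
split=> //.
- by move=> a b [Ia Ja] [Ib Jb]; split; [exact: Ijoin | exact: Jjoin].
- by move=> a b ab [Ib Jb]; split; [exact: Ile ab _ | exact: Jle ab _].
- move=> a [/Iround[b [Ib ab]] /Jround[c [Jc ac]]].
  exists (b `&` c)%O; split; last exact: Smeet.
  by split; [exact: Ile (leIl _ _) _ | exact: Jle (leIr _ _) _].
Qed.

Definition ideal_meet I J : S_ideals B :=
  set_elt (ideal_setI I J).

Definition ideal_join I J : S_ideals B := ideal_sup [set I; J].

Lemma ideal_meetP I J K :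
  (I <= ideal_meet J K)%O = (I <= J)%O && (I <= K)%O.
Proof.
apply/S_ideals_leP/andP => [IJK|[/S_ideals_leP IJ /S_ideals_leP IK]].
  by split; apply/S_ideals_leP => a /IJK[].
by move=> a Ia; split; [exact: IJ | exact: IK].
Qed.

Lemma ideal_joinP I J K :
  (ideal_join I J <= K)%O = (I <= K)%O && (J <= K)%O.
Proof.
have [ub least] := ideal_supP [set I; J].
apply/idP/andP => [le|[IK JK]].
  by split; apply: le_trans le; apply: ub; [left | right].
by apply: least => _ [->|->].
Qed.

HB.instance Definition _ := Order.POrder_MeetJoin_isLattice.Build
  _ (S_ideals B) ideal_meetP ideal_joinP.

Lemma ideal_bot_le I : (ideal_sup set0 <= I)%O.
Proof. by have [_ least] := ideal_supP set0; exact: least. Qed.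

Lemma ideal_le_top I : (I <= ideal_sup setT)%O.
Proof. by have [ub _] := ideal_supP setT; exact: ub. Qed.

HB.instance Definition _ :=
  Order.hasBottom.Build _ (S_ideals B) ideal_bot_le.
HB.instance Definition _ :=
  Order.hasTop.Build _ (S_ideals B) ideal_le_top.

Lemma ideal_complete A : supremums A !=set0.
Proof. by exists (ideal_sup A); exact: ideal_supP. Qed.

Lemma ideal_distr I A K :
  supremums A K -> supremums [set (I `&` J)%O | J in A] (I `&` K)%O.
Proof.
move=> /(is_subset1_supremums (ideal_supP A)) <-.
suff -> : (I `&` ideal_sup A = ideal_sup [set I `&` J | J in A])%O.
  exact: ideal_supP.
apply/eqP; rewrite eq_le; apply/andP; split; last first.
  have [_ least] := ideal_supP [set (I `&` J)%O | J in A].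
  apply: least => _ [J AJ <-]; apply: leI2 => //.
  by have [ub _] := ideal_supP A; exact: ub.
apply/S_ideals_leP => a [Ia [s sA le_as]].
have [_ _ Ile _] := set_valP I.
exists [seq (a `&` x)%O | x <- s].
  move=> _ /mapP[x /sA[J AJ Jx] ->]; exists (I `&` J)%O; first by exists J.
  have [_ _ Jle _] := set_valP J.
  by split; [exact: Ile (leIl _ _) _ | exact: Jle (leIr _ _) _].
by rewrite big_map -(big_endo _ (meetUr a) (meetx0 a)) lexI lexx.
Qed.

HB.instance Definition _ := TBLattice_isFrame.Build _ (S_ideals B)
  ideal_complete ideal_distr.

End IdealFrame.

(** [ideal_preimage T J] is T^-1[J]; the default value of [insubd] is irrelevant
    as this set is an S-ideal when T is a compatible subordination. *)
Definition ideal_preimage (A B : subalg) (T : set (A * B)) (J : S_ideals B) :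
    S_ideals A :=
  insubd (\bot%O : S_ideals A) (rel_image T^-1 (\val J)).

Definition Ifun : functor (op SubS5S) KRFrmP :=
  @Functor (op SubS5S) KRFrmP
    (fun B => PackFrame (S_ideals B : frameType _))
    (fun B A (T : set (A * B)) => ideal_preimage T).

Section FrameTheory.
Context {d : Order.disp_t} {L : frameType d}.
Implicit Types (a b c x y z : L) (A : set L).

Lemma fsupP A : supremums A (fsup A).
Proof.
rewrite /fsup /supremum; case: ifPn => [/eqP ->|_].
  by split=> [x //|x _]; exact: le0x.
by case: xgetP => // nosup; have [s /nosup] := frame_complete A.
Qed.

Lemma frame_meetUr a b c : (a `&` (b `|` c) = (a `&` b) `|` (a `&` c))%O.
Proof.
have sup_pair x y : supremums [set x; y] (x `|` y)%O.
  split=> [_ [->|->]|z ub]; [exact: leUl | exact: leUr |].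
  by rewrite leUx; apply/andP; split; apply: ub; [left | right].
have := frame_distr a _ _ (sup_pair b c); rewrite image_setU !image_set1 => Hs.
exact: is_subset1_supremums Hs (sup_pair _ _).
Qed.

Lemma frame_joinIl a b c : ((a `&` b) `|` c = (a `|` c) `&` (b `|` c))%O.
Proof.
apply/esym; rewrite frame_meetUr (meet_r (leUr c a)) [((a `|` c) `&` b)%O]meetC.
by rewrite frame_meetUr -joinA (join_r (leIr c b)) meetC.
Qed.

Lemma le_pcompl a x : (x <= pcompl a)%O = ((a `&` x)%O == \bot%O).
Proof.
have [ub least] := fsupP [set x | (a `&` x)%O = \bot%O].
apply/idP/eqP => [le_x|ax]; last exact: ub.
apply/eqP; rewrite -lex0; apply: le_trans (leI2 (lexx a) le_x) _.
have [_] := frame_distr a _ _ (fsupP [set x | (a `&` x)%O = \bot%O]).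
by apply=> _ [y -> <-].
Qed.

Lemma pcompl_meet a : (a `&` pcompl a = \bot)%O.
Proof. by apply/eqP; rewrite -le_pcompl. Qed.

Lemma le_pcomplC a b : (a <= pcompl b)%O = (b <= pcompl a)%O.
Proof. by rewrite !le_pcompl meetC. Qed.

Lemma le_pcompl2 a : (a <= pcompl (pcompl a))%O.
Proof. by rewrite le_pcomplC. Qed.

Lemma pcompl_le a b : (a <= b)%O -> (pcompl b <= pcompl a)%O.
Proof. by move=> ab; rewrite le_pcomplC; apply: le_trans (le_pcompl2 b). Qed.

Lemma pcompl3 a : pcompl (pcompl (pcompl a)) = pcompl a.
Proof.
by apply/eqP; rewrite eq_le le_pcompl2 andbT; apply: pcompl_le (le_pcompl2 a).
Qed.

Lemma pcompl_join a b : pcompl (a `|` b)%O = (pcompl a `&` pcompl b)%O.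
Proof.
apply/eqP; rewrite eq_le lexI !pcompl_le ?leUl ?leUr //=.
by rewrite le_pcomplC leUx !(le_pcomplC _ (_ `&` _)%O) leIl leIr.
Qed.

Lemma pcompl0 : pcompl (\bot%O : L) = \top%O.
Proof. by apply/eqP; rewrite eq_le lex1 le_pcompl meet0x eqxx. Qed.

Lemma pcompl1 : pcompl (\top%O : L) = \bot%O.
Proof. by rewrite -[LHS]meet1x pcompl_meet. Qed.

End FrameTheory.

Definition regulars d (L : frameType d) :=
  set_type [set a : L | a = pcompl (pcompl a)].

Section RegularAlgebra.
Context {d : Order.disp_t} {L : frameType d}.
Implicit Types a b c : regulars L.

HB.instance Definition _ := SubChoice.on (regulars L).

HB.instance Definition _ :=
  Order.SubChoice_isSubPOrder.Build _ _ _ d (regulars L).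

Lemma regulars_leE a b : (a <= b)%O = (\val a <= \val b)%O.
Proof. by rewrite Order.le_val. Qed.

Lemma regularK a : pcompl (pcompl (\val a)) = \val a.
Proof. exact/esym/(set_valP a). Qed.

Definition regularize (x : L) : regulars L :=
  @set_elt _ [set a : L | a = pcompl (pcompl a)] (pcompl (pcompl x))
    (esym (pcompl3 (pcompl x))).

Lemma le_regularize x a : (regularize x <= a)%O = (x <= \val a)%O.
Proof.
rewrite regulars_leE /=; apply/idP/idP; first exact/le_trans/le_pcompl2.
by move=> xa; rewrite -(regularK a) !pcompl_le.
Qed.

Lemma regular_meetE a b :
  pcompl (pcompl (\val a `&` \val b)%O) = (\val a `&` \val b)%O.
Proof.
apply/eqP; rewrite eq_le le_pcompl2 andbT lexI.
by rewrite -[in leRHS](regularK a) -[X in _ && (_ <= X)%O](regularK b)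
  !pcompl_le ?leIl ?leIr.
Qed.

Definition regular_meet a b := regularize (\val a `&` \val b)%O.
Definition regular_join a b := regularize (\val a `|` \val b)%O.

Lemma regular_meetP a b c :
  (a <= regular_meet b c)%O = (a <= b)%O && (a <= c)%O.
Proof. by rewrite !regulars_leE /= regular_meetE lexI. Qed.

Lemma regular_joinP a b c :
  (regular_join a b <= c)%O = (a <= c)%O && (b <= c)%O.
Proof. by rewrite le_regularize leUx -!regulars_leE. Qed.

HB.instance Definition _ := Order.POrder_MeetJoin_isLattice.Build
  _ (regulars L) regular_meetP regular_joinP.

Lemma regulars_valI a b : \val (a `&` b)%O = (\val a `&` \val b)%O.
Proof. exact: regular_meetE. Qed.

Lemma regulars_valU a b :
  \val (a `|` b)%O = pcompl (pcompl (\val a `|` \val b)%O).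
Proof. by []. Qed.

Lemma regular_meetUl :
  left_distributive (@Order.meet _ (regulars L)) (@Order.join _ (regulars L)).
Proof.
move=> a b c; apply/eqP; rewrite eq_le; apply/andP; split; last first.
  by rewrite leUx; apply/andP; split; apply: leI2; rewrite ?leUl ?leUr.
set w := ((a `&` c) `|` (b `&` c))%O.
rewrite regulars_leE regulars_valI regulars_valU.
rewrite -(regularK w) le_pcompl [X in (_ `&` X)%O]meetC meetA -le_pcompl -[leRHS]pcompl3.
do 2!apply: pcompl_le; rewrite leUx.
have le0 (x : regulars L) : (x `&` c <= w)%O ->
    (\val x <= pcompl (pcompl (\val w) `&` \val c))%O.
  rewrite regulars_leE regulars_valI => xw.
  rewrite le_pcompl -meetA [X in (_ `&` X)%O]meetC -lex0.
  by rewrite -(pcompl_meet (\val w)) meetC leI2.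
by apply/andP; split; apply: le0; [exact: leUl | exact: leUr].
Qed.

HB.instance Definition _ := Order.Lattice_Meet_isDistrLattice.Build
  _ (regulars L) regular_meetUl.

Lemma regular_bot_le a : (regularize \bot%O <= a)%O.
Proof. by rewrite le_regularize le0x. Qed.

Lemma regular_le_top a : (a <= regularize \top%O)%O.
Proof. by rewrite regulars_leE; apply: le_trans (le_pcompl2 _); exact: lex1. Qed.

HB.instance Definition _ :=
  Order.hasBottom.Build _ (regulars L) regular_bot_le.
HB.instance Definition _ :=
  Order.hasTop.Build _ (regulars L) regular_le_top.

Lemma regulars_val0 : \val (\bot%O : regulars L) = \bot%O.
Proof. by rewrite /= pcompl0 pcompl1. Qed.

Lemma regulars_val1 : \val (\top%O : regulars L) = \top%O.
Proof. by rewrite /= pcompl1 pcompl0. Qed.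

Definition regular_compl a : regulars L :=
  @set_elt _ [set a : L | a = pcompl (pcompl a)] (pcompl (\val a))
    (esym (pcompl3 (\val a))).

Lemma regular_joinxC a : (a `|` regular_compl a = \top)%O.
Proof.
apply: val_inj; rewrite regulars_valU regulars_val1 /=.
by rewrite pcompl_join pcompl_meet pcompl0.
Qed.

Lemma regular_meetxC a : (a `&` regular_compl a = \bot)%O.
Proof.
by apply: val_inj; rewrite regulars_valI regulars_val0; exact: pcompl_meet.
Qed.

HB.instance Definition _ := Order.TBDistrLattice_hasComplement.Build
  _ (regulars L) regular_joinxC regular_meetxC.

Definition regular_rel : set (regulars L * regulars L) :=
  [set ab | well_inside (\val ab.1) (\val ab.2)].

Lemma regular_rel_subordination : subordination regular_rel.
Proof.
rewrite /regular_rel /well_inside; split.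
- by split; rewrite /= !(pcompl0, pcompl1) (join1x, joinx1).
- move=> a b c /= ac bc; rewrite pcompl3 pcompl_join.
  by rewrite frame_joinIl ac bc meetxx.
- move=> a c e /= ac ae; rewrite regular_meetE joinC frame_joinIl.
  by rewrite ![(_ `|` pcompl _)%O]joinC ac ae meetxx.
- move=> a b c e /=; rewrite !regulars_leE => ab bc ce.
  by apply/eqP; rewrite -le1x -bc leU2 // pcompl_le.
Qed.

End RegularAlgebra.

Definition regular_subalg (L : frame) : subalg :=
  SubAlg (@regular_rel_subordination _ L).

(** Contravariant: h : L -> M yields a relation from B(M) to B(L). *)
Definition Bfun : functor KRFrmP (op DeVS) :=
  @Functor KRFrmP (op DeVS) regular_subalg
    (fun L M (h : L -> M) =>
      [set ab : regulars M * regulars L | well_inside (\val ab.1) (h (\val ab.2))]).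

(** Terms for elements of the free boolean algebra on the symbols Box_a and
    Dia_a, a : B. *)
Inductive kterm (B : Type) : Type :=
  | TBox of B
  | TDia of B
  | TBot
  | TTop
  | TMeet of kterm B & kterm B
  | TJoin of kterm B & kterm B
  | TCompl of kterm B.

Arguments TBot {B}.
Arguments TTop {B}.

HB.instance Definition _ B := gen_eqMixin (kterm B).
HB.instance Definition _ B := gen_choiceMixin (kterm B).

(** The congruence generated by the axioms of boolean algebras and the defining
    relations of K(B). *)
Inductive keq d (B : ctbDistrLatticeType d) : kterm B -> kterm B -> Prop :=
  | keq_refl s : keq s s
  | keq_sym s t : keq s t -> keq t s
  | keq_trans s t u : keq s t -> keq t u -> keq s u
  | keq_meet s s' t t' : keq s s' -> keq t t' -> keq (TMeet s t) (TMeet s' t')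
  | keq_join s s' t t' : keq s s' -> keq t t' -> keq (TJoin s t) (TJoin s' t')
  | keq_compl s s' : keq s s' -> keq (TCompl s) (TCompl s')
  | keq_meetC s t : keq (TMeet s t) (TMeet t s)
  | keq_joinC s t : keq (TJoin s t) (TJoin t s)
  | keq_meetA s t u : keq (TMeet s (TMeet t u)) (TMeet (TMeet s t) u)
  | keq_joinA s t u : keq (TJoin s (TJoin t u)) (TJoin (TJoin s t) u)
  | keq_joinKI s t : keq (TMeet s (TJoin s t)) s
  | keq_meetKU s t : keq (TJoin s (TMeet s t)) s
  | keq_meetUl s t u : keq (TMeet (TJoin s t) u) (TJoin (TMeet s u) (TMeet t u))
  | keq_meet0 s : keq (TMeet TBot s) TBot
  | keq_meet1 s : keq (TMeet s TTop) s
  | keq_joinC1 s : keq (TJoin s (TCompl s)) TTop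
  | keq_meetC0 s : keq (TMeet s (TCompl s)) TBot
  | keq_box1 : keq (TBox \top%O) TTop
  | keq_dia0 : keq (TDia \bot%O) TBot
  | keq_boxI a b : keq (TBox (a `&` b)%O) (TMeet (TBox a) (TBox b))
  | keq_diaU a b : keq (TDia (a `|` b)%O) (TJoin (TDia a) (TDia b))
  | keq_boxU_le a b :
      keq (TMeet (TBox (a `|` b)%O) (TJoin (TBox a) (TDia b)))
          (TBox (a `|` b)%O)
  | keq_diaI_le a b :
      keq (TMeet (TMeet (TBox a) (TDia b)) (TDia (a `&` b)%O))
          (TMeet (TBox a) (TDia b)).

Section KAlgebra.
Context {d : Order.disp_t} {B : ctbDistrLatticeType d}.

Let E : rel (kterm B) := fun s t => `[< keq s t >].

Lemma keq_equiv : equiv_class_of E.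
Proof.
split=> [s|s t|t s u].
- exact/asboolP/keq_refl.
- by apply/asboolP/asboolP; exact: keq_sym.
- by move=> /asboolP st /asboolP tu; apply/asboolP; exact: keq_trans st tu.
Qed.

Definition keq_equiv_rel : equiv_rel (kterm B) := EquivRelPack keq_equiv.

End KAlgebra.

Definition kalg d (B : ctbDistrLatticeType d) :=
  {eq_quot (@keq_equiv_rel d B)}.

Section KAlgebraTheory.
Context {d : Order.disp_t} {B : ctbDistrLatticeType d}.
Implicit Types x y z : kalg B.

HB.instance Definition _ := Choice.on (kalg B).
HB.instance Definition _ := Quotient.on (kalg B).

Definition kpi (s : kterm B) : kalg B := \pi_(kalg B) s.

Lemma kpiP s t : kpi s = kpi t <-> keq s t.
Proof.
split=> [/eqmodP/asboolP //|st]; exact/eqmodP/asboolP.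
Qed.

Lemma kpi_surj x : exists s, x = kpi s.
Proof. by exists (repr x); rewrite /kpi reprK. Qed.

Lemma keq_repr s : keq (repr (kpi s)) s.
Proof. by apply/kpiP; rewrite /kpi reprK. Qed.

Definition kmeet x y := kpi (TMeet (repr x) (repr y)).
Definition kjoin x y := kpi (TJoin (repr x) (repr y)).
Definition kcompl x := kpi (TCompl (repr x)).
Definition kbot := kpi TBot.
Definition ktop := kpi TTop.

Lemma kpi_meet s t : kpi (TMeet s t) = kmeet (kpi s) (kpi t).
Proof. by apply/kpiP/keq_sym/keq_meet; exact: keq_repr. Qed.

Lemma kpi_join s t : kpi (TJoin s t) = kjoin (kpi s) (kpi t).
Proof. by apply/kpiP/keq_sym/keq_join; exact: keq_repr. Qed.

Lemma kpi_compl s : kpi (TCompl s) = kcompl (kpi s).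
Proof. by apply/kpiP/keq_sym/keq_compl; exact: keq_repr. Qed.

Lemma kmeetC : commutative kmeet.
Proof. by move=> x y; apply/kpiP; exact: keq_meetC. Qed.

Lemma kjoinC : commutative kjoin.
Proof. by move=> x y; apply/kpiP; exact: keq_joinC. Qed.

Lemma kmeetA : associative kmeet.
Proof.
move=> x y z; have [s ->] := kpi_surj x; have [t ->] := kpi_surj y.
by have [u ->] := kpi_surj z; rewrite -!kpi_meet; apply/kpiP/keq_meetA.
Qed.

Lemma kjoinA : associative kjoin.
Proof.
move=> x y z; have [s ->] := kpi_surj x; have [t ->] := kpi_surj y.
by have [u ->] := kpi_surj z; rewrite -!kpi_join; apply/kpiP/keq_joinA.
Qed.

Lemma kjoinKI y x : kmeet x (kjoin x y) = x.
Proof.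
have [s ->] := kpi_surj x; have [t ->] := kpi_surj y.
by rewrite -kpi_join -kpi_meet; apply/kpiP/keq_joinKI.
Qed.

Lemma kmeetKU y x : kjoin x (kmeet x y) = x.
Proof.
have [s ->] := kpi_surj x; have [t ->] := kpi_surj y.
by rewrite -kpi_meet -kpi_join; apply/kpiP/keq_meetKU.
Qed.

Lemma kmeetUl : left_distributive kmeet kjoin.
Proof.
move=> x y z; have [s ->] := kpi_surj x; have [t ->] := kpi_surj y.
have [u ->] := kpi_surj z; rewrite -kpi_join -!kpi_meet -kpi_join.
exact/kpiP/keq_meetUl.
Qed.

Lemma kmeetxx : idempotent_op kmeet.
Proof. by move=> x; rewrite -[in X in kmeet _ X](kmeetKU x x) kjoinKI. Qed.

Definition kle : rel (kalg B) := fun x y => kmeet x y == x.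
Definition klt : rel (kalg B) := fun x y => (y != x) && kle x y.

HB.instance Definition _ := Order.isMeetJoinDistrLattice.Build d (kalg B)
  (fun _ _ => erefl : kle _ _ = _) (fun _ _ => erefl : klt _ _ = _)
  kmeetC kjoinC kmeetA kjoinA kjoinKI kmeetKU kmeetUl kmeetxx.

Lemma kbot_le x : (kbot <= x)%O.
Proof.
apply/eqP; have [s ->] := kpi_surj x; rewrite -[RHS]/(kpi TBot) /kbot.
by rewrite -kpi_meet; apply/kpiP/keq_meet0.
Qed.

Lemma kle_top x : (x <= ktop)%O.
Proof.
apply/eqP; have [s ->] := kpi_surj x.
by rewrite -kpi_meet; apply/kpiP/keq_meet1.
Qed.

HB.instance Definition _ := Order.hasBottom.Build d (kalg B) kbot_le.
HB.instance Definition _ := Order.hasTop.Build d (kalg B) kle_top.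

Lemma kjoinxC x : (x `|` kcompl x = \top)%O.
Proof.
have [s ->] := kpi_surj x; rewrite -kpi_compl.
by rewrite -[LHS]kpi_join; apply/kpiP/keq_joinC1.
Qed.

Lemma kmeetxC x : (x `&` kcompl x = \bot)%O.
Proof.
have [s ->] := kpi_surj x; rewrite -kpi_compl.
by rewrite -[LHS]kpi_meet; apply/kpiP/keq_meetC0.
Qed.

HB.instance Definition _ := Order.TBDistrLattice_hasComplement.Build
  d (kalg B) kjoinxC kmeetxC.

Definition kbox (a : B) : kalg B := kpi (TBox a).
Definition kdia (a : B) : kalg B := kpi (TDia a).

(** A normal form is given by the list of the pairs
    (a_i, [:: b_i1; ...; b_in_i]), resp. (c_j, [:: d_j1; ...; d_jm_j]). *)
Definition dnf_val (D : seq (B * seq B)) : kalg B :=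
  (\join_(p <- D) (kbox p.1 `&` \meet_(b <- p.2) kdia b))%O.

Definition is_dnf (D : seq (B * seq B)) :=
  forall p, p \in D -> forall b, b \in p.2 -> b <> \bot%O /\ (b <= p.1)%O.

Definition cnf_val (C : seq (B * seq B)) : kalg B :=
  (\meet_(q <- C) (kdia q.1 `|` \join_(e <- q.2) kbox e))%O.

Definition is_cnf (C : seq (B * seq B)) :=
  forall q, q \in C -> forall e, e \in q.2 -> (q.1 <= e)%O /\ e <> \top%O.

End KAlgebraTheory.

Section KSubordination.
Context {d d' : Order.disp_t}.
Context {A : ctbDistrLatticeType d} {B : ctbDistrLatticeType d'}.
Variable S : set (A * B).

Definition box_rel : set (kalg A * kalg B) :=
  [set xy | exists D C,
    [/\ is_dnf D, xy.1 = dnf_val D, is_cnf C, xy.2 = cnf_val C &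
        forall p q, p \in D -> q \in C -> exists2 e, e \in q.2 & S (p.1, e)]].

Definition dia_rel : set (kalg A * kalg B) :=
  [set xy | exists D C,
    [/\ is_dnf D, xy.1 = dnf_val D, is_cnf C, xy.2 = cnf_val C &
        forall p q, p \in D -> q \in C -> exists2 b, b \in p.2 & S (b, q.1)]].

Definition kalg_rel : set (kalg A * kalg B) :=
  smallest (@subordination _ _ (kalg A) (kalg B)) (box_rel `|` dia_rel).

Lemma kalg_rel_subordination : subordination kalg_rel.
Proof.
split.
- by split=> T [[[]]].
- move=> x y z xz yz T TP; have [_ Tj _ _] := TP.1.
  by apply: Tj; [exact: xz | exact: yz].
- move=> x y z xy xz T TP; have [_ _ Tm _] := TP.1.
  by apply: Tm; [exact: xy | exact: xz].
- move=> x y z w xy yz zw T TP; have [_ _ _ Tle] := TP.1.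
  by apply: Tle xy _ zw; exact: yz.
Qed.

End KSubordination.

Definition kalg_subalg (B : subalg) : subalg :=
  SubAlg (@kalg_rel_subordination _ _ B B (subalg_rel B)).

Definition Kfun : functor SubS5S SubS5S :=
  @Functor SubS5S SubS5S kalg_subalg
    (fun A B (T : set (A * B)) => kalg_rel T).

Definition Delta : functor DeVS SubS5S := @full_inclusion SubS5S de_Vries.

Definition Jfun : functor KRFrmP KRFrmP :=
  (Ifun ∘ op_functor Kfun ∘ op_functor Delta ∘ Bfun)%functor.

(* Main.v *)
From HB Require Import structures.
From mathcomp Require Import all_boot all_order finmap.
From mathcomp Require Import all_classical topology.
Require Import Defs.

(** Every comparison is made on points wherever points are available, and a
    category of relations makes this easy, since a closed relation that has a
    closed inverse is an isomorphism: no map between the two sides is needed.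

    V Q ~ Q V.  The projection P : X -> X/E satisfies P P^† = id and
    P^† P = E, and V is functorial on closed relations ([vietoris_rel_comp]).
    So the relation that sends a closed set F of X/E to the class of any closed
    G with image F is invertible, and naturality is a computation with
    converses ([vietoris_quotient]).

    Clop V ~ K Clop.  A set F of points of X satisfies Box_U when F is
    contained in U and Dia_U when F meets U; this interprets K(Clop X) in
    Clop (V X), and compactness makes the interpretation surjective
    ([kext_surj]).  The heart of the matter is that x K(S) y holds if and only
    if, for all F, G that are related by the Egli-Milner lifting of the
    relation dual to S, satisfaction of x by F implies satisfaction of y by G
    ([kalg_rel_sound], [kalg_rel_complete]).  If a disjunct of x and a conjunct
    of y are related by no box and no diamond, finitely many pairs of points
    refute the semantic condition.  Because only finite sets are needed, the
    same argument applies to the prime filters of abstract boolean algebras,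
    where it shows that K preserves composition ([kalg_rel_comp]).

    O Q ~ I Clop.  An open set of X/E corresponds to the S-ideal of the clopens
    contained in its preimage ([opens_quotient]).

    I K ~ J I.  An S5-subordination algebra is isomorphic to the de Vries
    algebra of its regular S-ideals by the membership relation between
    elements and ideals ([regular_ideals_unit]); apply I K to it.

    O V ~ J O.  A compact Hausdorff space Y is the quotient of the Stone space
    of the ultrafilters on Y by the relation of having the same limits
    ([quotient_ultras]), functorially in Y; the clopens of this Stone space
    form an S5-subordination algebra isomorphic to that of the regular opens of
    Y ([regular_opens_clopens]).  Writing G for this cover and B for the
    regular opens, the other isomorphisms give
    O V ~ O V Q G ~ O Q V G ~ I Clop V G ~ I K Clop G ~ I K B O = J O. *)

Set Implicit Arguments.
Unset Strict Implicit.
Unset Printing Implicit Defensive.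

Import Order.Theory.

Local Open Scope classical_set_scope.
Local Open Scope relation_scope.

(** * Functors and natural isomorphisms *)

Section Functors.
Variables C D E : category.

Lemma full_subcategory_category (P : ob C -> Prop) :
  is_category C -> is_category (full_subcategory P).
Proof.
move=> [im cm il ir ca]; split=> /=.
- by move=> X [hX _]; exact: im.
- by move=> X Y Z g f [hX _] [hY _] [hZ _]; exact: cm.
- by move=> X Y f [hX _] [hY _]; exact: il.
- by move=> X Y f [hX _] [hY _]; exact: ir.
- by move=> W X Y Z h g f [hW _] [hX _] [hY _] [hZ _]; exact: ca.
Qed.

Lemma full_inclusion_functor (P : ob C -> Prop) :
  is_functor (full_inclusion P).
Proof. by split=> //= X []. Qed.

Lemma op_is_functor (F : functor C D) :
  is_functor F -> is_functor (op_functor F).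
Proof.
move=> [fo fm fi fc]; split=> /=.
- exact: fo.
- by move=> X Y f hX hY mf; exact: fm.
- exact: fi.
- by move=> X Y Z g f hX hY hZ mg mf; exact: fc.
Qed.

Lemma functor_comp_functor (G : functor D E) (F : functor C D) :
  is_functor G -> is_functor F -> is_functor (functor_comp G F).
Proof.
move=> [go gm gi gc] [fo fm fi fc]; split=> /=.
- by move=> X hX; exact/go/fo.
- by move=> X Y f hX hY mf; apply: gm; [exact: fo | exact: fo | exact: fm].
- by move=> X hX; rewrite fi // gi //; exact: fo.
- move=> X Y Z g f hX hY hZ mg mf; rewrite fc // gc //; try exact: fo.
    exact: fm.
  exact: fm.
Qed.

End Functors.

Section Isos.
Variable C : category.
Hypothesis hC : is_category C.

Lemma is_iso_comp (X Y Z : ob C) (g : mor Y Z) (f : mor X Y) :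
  is_ob C X -> is_ob C Y -> is_ob C Z ->
  is_iso g -> is_iso f -> is_iso (comp g f).
Proof.
move=> hX hY hZ [mg [g' [mg' g'g gg']]] [mf [f' [mf' f'f ff']]].
have [im cm il ir ca] := hC; split; first exact: cm.
exists (comp f' g'); split; first exact: cm.
  rewrite -(ca _ _ _ _ f' g') //; last exact: cm.
  by rewrite (ca _ _ _ _ g' g f) // g'g il.
rewrite -(ca _ _ _ _ g f) //; last exact: cm.
by rewrite (ca _ _ _ _ f f' g') // ff' il.
Qed.

End Isos.

Lemma is_iso_op (C : category) (X Y : ob C) (f : @mor C X Y) :
  is_iso f -> @is_iso (op C) Y X f.
Proof. by move=> [mf [g [mg gf fg]]]; split=> //; exists g. Qed.

Lemma is_iso_fmor (C D : category) (F : functor C D) (X Y : ob C)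
    (f : mor X Y) :
  is_functor F -> is_ob C X -> is_ob C Y -> is_iso f -> is_iso (fmor F f).
Proof.
move=> [fo fm fi fc] hX hY [mf [g [mg gf fg]]]; split; first exact: fm.
exists (fmor F g); split; first exact: fm.
  by rewrite -fc // gf fi.
by rewrite -fc // fg fi.
Qed.

Section NatIso.
Variables C D : category.
Hypothesis hD : is_category D.

Lemma nat_iso_sym (F G : functor C D) :
  is_functor F -> is_functor G -> nat_iso F G -> nat_iso G F.
Proof.
move=> hF hG [a [ai an]]; have [im cm il ir ca] := hD.
have fo := fob_ob hF; have go := fob_ob hG.
have inv X hX := cid (proj2 (ai X hX)).
exists (fun X hX => projT1 (inv X hX)); split=> [X hX|X Y hX hY f mf].
  have [mb ba ab] := projT2 (inv X hX); split=> //.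
  by exists (a X hX); have [ma _] := ai X hX; split.
have [mbX baX abX] := projT2 (inv X hX).
have [mbY baY abY] := projT2 (inv Y hY).
set bX := projT1 _ in mbX baX abX *; set bY := projT1 _ in mbY baY abY *.
have [[maX _] [maY _]] := (ai X hX, ai Y hY).
have mF : is_mor (fmor F f) by exact: fmor_mor.
have mG : is_mor (fmor G f) by exact: fmor_mor.
have mfb : is_mor (comp bY (fmor G f)) by apply: cm; auto.
have mfb' : is_mor (comp (fmor G f) (a X hX)) by apply: cm; auto.
rewrite -[LHS]ir; auto; rewrite -abX ca; auto.
rewrite -(ca _ _ _ _ bY); auto.
by rewrite -(an _ _ hX hY) // ca; auto; rewrite baY il; auto.
Qed.

Lemma nat_iso_trans (F G H : functor C D) :
  is_functor F -> is_functor G -> is_functor H ->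
  nat_iso F G -> nat_iso G H -> nat_iso F H.
Proof.
move=> hF hG hH [a [ai an]] [b [bi bn]]; have [im cm il ir ca] := hD.
have fo := fob_ob hF; have go := fob_ob hG; have ho := fob_ob hH.
exists (fun X hX => comp (b X hX) (a X hX)); split=> [X hX|X Y hX hY f mf].
  by apply: is_iso_comp => //; [exact: fo|exact: go|exact: ho].
have [[maX _] [maY _]] := (ai X hX, ai Y hY).
have [[mbX _] [mbY _]] := (bi X hX, bi Y hY).
have mF : is_mor (fmor F f) by exact: fmor_mor.
have mG : is_mor (fmor G f) by exact: fmor_mor.
have mH : is_mor (fmor H f) by exact: fmor_mor.
rewrite -ca //; auto.
rewrite (an _ _ hX hY) // ca //; auto.
rewrite (bn _ _ hX hY) // -ca //; auto.
Qed.

Lemma nat_iso_op (F G : functor C D) :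
  is_functor F -> is_functor G -> nat_iso F G ->
  nat_iso (op_functor F) (op_functor G).
Proof.
move=> hF hG /(nat_iso_sym hF hG)[b [bi bn]]; exists b; split=> [X hX|X Y hX hY f mf].
  exact: (is_iso_op (bi X hX)).
by rewrite /= (bn _ _ hY hX).
Qed.

Lemma nat_iso_whiskerr (B : category) (F G : functor C D) (H : functor B C) :
  is_functor H -> nat_iso F G -> nat_iso (functor_comp F H) (functor_comp G H).
Proof.
move=> hH [a [ai an]]; exists (fun X hX => a (H X) (fob_ob hH hX)).
split=> [X hX|X Y hX hY f mf]; first exact: ai.
by apply: an; exact: fmor_mor.
Qed.

End NatIso.

Lemma nat_iso_whiskerl (C D E : category) (F G : functor C D)
    (H : functor D E) :
  is_functor F -> is_functor G -> is_functor H ->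
  nat_iso F G -> nat_iso (functor_comp H F) (functor_comp H G).
Proof.
move=> hF hG hH [a [ai an]]; exists (fun X hX => fmor H (a X hX)).
have fo := fob_ob hF; have go := fob_ob hG.
split=> [X hX|X Y hX hY f mf].
  exact: (is_iso_fmor hH (fo X hX) (go X hX) (ai X hX)).
have [[maX _] [maY _]] := (ai X hX, ai Y hY).
have mF : is_mor (fmor F f) by exact: fmor_mor.
have mG : is_mor (fmor G f) by exact: fmor_mor.
by rewrite /= -!(fmor_comp hH) ?(an _ _ hX hY); auto.
Qed.

(** * Relation algebra *)

(** Named composition and converse: the bare set comprehensions are
    reduced by simplification and cannot be rewritten with. *)
Definition rcomp (X Y Z : Type) (T : set (Y * Z)) (R : set (X * Y)) :
  set (X * Z) := T \; R.
Definition rconv (X Y : Type) (R : set (X * Y)) : set (Y * X) := R^-1.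

Notation "T ⊚ R" := (rcomp T R) (at level 40, left associativity).
Notation "R ^†" := (rconv R) (at level 1, format "R ^†").

Section RelationAlgebra.
Variables W X Y Z : Type.

Lemma rel_compA (S : set (Y * Z)) (T : set (X * Y)) (R : set (W * X)) :
  S ⊚ (T ⊚ R) = S ⊚ T ⊚ R.
Proof.
apply/seteqP; split=> [[w z] [y [x wx xy] yz]|[w z] [x wx [y xy yz]]].
  by exists x => //; exists y.
by exists y => //; exists x.
Qed.

Lemma rel_comp_idl (R : set (X * Y)) : @rel_id Y ⊚ R = R.
Proof.
rewrite /rcomp /rel_id; apply/seteqP.
by split=> [[x y] [z /= xz <- //]|[x y] xy]; exists y.
Qed.

Lemma rel_comp_idr (R : set (X * Y)) : R ⊚ @rel_id X = R.
Proof.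
rewrite /rcomp /rel_id; apply/seteqP.
by split=> [[x y] [z /= -> //]|[x y] xy]; exists x.
Qed.

End RelationAlgebra.

Lemma graph_surj (X Y : Type) (f : X -> Y) :
  (forall y, exists x, f x = y) -> graph f ⊚ (graph f)^† = @rel_id Y.
Proof.
rewrite /rcomp /rconv /graph /rel_id => fs; apply/seteqP.
split=> [[y y'] [x /= <- <-] //|[y _] /= <-].
by have [x <-] := fs y; exists x.
Qed.

Lemma rel_image_comp (X Y Z : Type) (T : set (Y * Z)) (R : set (X * Y)) A :
  rel_image (T ⊚ R) A = rel_image T (rel_image R A).
Proof.
apply/seteqP; split=> [z [x Ax [y xy yz]]|z [y [x Ax xy] yz]].
  by exists y => //; exists x.
by exists x => //; exists y.
Qed.

(** * Compactness and closed relations *)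

(** Otherwise the traces on K of the complements of the members generate a
    proper filter, and no member contains its cluster point in K.  Stated for
    directed families, compactness can be applied to any property of open sets
    that is stable under binary unions. *)
Lemma compact_directed (X : topologicalType) (K : set X) (D : set (set X)) :
  compact K -> (forall U, D U -> open U) -> D !=set0 ->
  (forall U V, D U -> D V -> exists2 W, D W & U `|` V `<=` W) ->
  (forall x, K x -> exists2 U, D U & U x) ->
  exists2 U, D U & K `<=` U.
Proof.
move=> cK Do [U0 DU0] Dd Dc; apply: contrapT => nD.
pose F := filter_from D (fun U => K `\` U).
have FF : ProperFilter F.
  apply: filter_from_proper.
    apply: filter_from_filter; first by exists U0.
    move=> U V DU DV; have [W DW UVW] := Dd _ _ DU DV; exists W => //.
    by move=> x [Kx Wx]; split; split=> // ?; apply: Wx; apply: UVW; [left|right].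
  move=> U DU; apply/set0P/negP => /eqP K0; apply: nD; exists U => //.
  by rewrite -setD_eq0.
have [x [Kx clx]] : K `&` cluster F !=set0.
  by apply: cK; exists U0 => // x [].
have [U DU Ux] := Dc x Kx.
have [||y [[_ nUy] Uy]] := clx (K `\` U) U; last exact: nUy.
  by exists U.
by apply: open_nbhs_nbhs; split => //; exact: Do.
Qed.

Lemma openP_nbhd (X : topologicalType) (A : set X) :
  (forall x, A x -> exists U, [/\ open U, U x & U `<=` A]) -> open A.
Proof.
move=> h; rewrite openE => x /h[U [oU Ux UA]].
by apply: filterS UA _; apply: open_nbhs_nbhs.
Qed.

Lemma closedP_nbhd (X : topologicalType) (A : set X) :
  (forall x, ~ A x -> exists U, [/\ open U, U x & U `<=` ~` A]) -> closed A.
Proof. by move=> h; rewrite -openC; exact: openP_nbhd. Qed.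

Section ClosedRelations.
Variables X Y : topologicalType.

Lemma closed_relP (R : set (X * Y)) :
  closed R <-> forall x y, ~ R (x, y) -> exists U V,
    [/\ open U /\ U x, open V /\ V y &
        forall x' y', U x' -> V y' -> ~ R (x', y')].
Proof.
split=> [cR x y nR|h].
  have : nbhs (x, y) (~` R) by apply: open_nbhs_nbhs; split=> //; rewrite openC.
  case=> -[A B] /= []; rewrite !nbhsE => -[U [oU Ux] UA] [V [oV Vy] VB] AB.
  exists U, V; split=> // x' y' /UA Ax /VB By Rxy.
  exact: (AB (x', y')).
rewrite -openC openE => -[x y] /= nR; have [U [V [[oU Ux] [oV Vy] UV]]] := h x y nR.
exists (U, V) => /=; first by split; apply: open_nbhs_nbhs.
by move=> [x' y'] /= [Ux' Vy']; exact: UV.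
Qed.

Lemma closed_rel_conv (R : set (X * Y)) : closed R -> closed R^†.
Proof.
move=> /closed_relP cR; rewrite -openC openE => -[y x] /= nR.
have [U [V [[oU Ux] [oV Vy] UV]]] := cR x y nR.
exists (V, U) => /=; first by split; apply: open_nbhs_nbhs.
by move=> [y' x'] /= [Vy' Ux']; exact: UV.
Qed.

Lemma closed_graph (f : X -> Y) :
  hausdorff_space Y -> continuous f -> closed (graph f).
Proof.
rewrite open_hausdorff => hY fc; apply/closed_relP => x y /eqP fxy.
have [[U V] /= [/set_mem Ux /set_mem Vy] [oU oV /eqP UV0]] := hY _ _ fxy.
exists (f @^-1` U), V; split=> //.
  by split=> //; move/continuousP: fc; apply.
move=> x' y' Ux' Vy' fx'; have : (U `&` V) (f x') by split=> //; rewrite fx'.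
by rewrite UV0.
Qed.

(** For y outside the image, the opens U from which no pair of R leads into
    some neighbourhood of y are stable under unions and cover K. *)
Lemma closed_rel_image (R : set (X * Y)) (K : set X) :
  compact K -> closed R -> closed (rel_image R K).
Proof.
move=> cK /closed_relP cR; apply: closedP_nbhd => y nRy.
pose D := [set U : set X | open U /\ exists V,
  [/\ open V, V y & forall x' y', U x' -> V y' -> ~ R (x', y')]].
have [|||x Kx|U [oU [V [oV Vy UV]]] KU] := @compact_directed X K D cK.
- by move=> U [].
- exists set0; split; first exact: open0.
  by exists setT; split=> //; exact: openT.
- move=> U U' [oU [V [oV Vy UV]]] [oU' [V' [oV' Vy' UV']]].
  exists (U `|` U') => //; split; first exact: openU.
  exists (V `&` V'); split=> //; first exact: openI.
  by move=> x' y' [Ux|Ux] [Vy1 Vy2]; [exact: UV|exact: UV'].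
- have [|U [V [[oU Ux] [oV Vy] UV]]] := cR x y.
    by move=> xy; apply: nRy; exists x.
  by exists U => //; split=> //; exists V.
exists V; split=> // y' Vy' [x Kx xy'].
by apply: (UV x y') => //; exact: KU.
Qed.

End ClosedRelations.

(** The same covering argument for the middle space: if (x, z) is not in the
    composite, every y has a neighbourhood through which no pair near (x, z)
    is connected. *)
Lemma closed_rel_comp (X Y Z : topologicalType)
    (T : set (Y * Z)) (R : set (X * Y)) :
  compact [set: Y] -> closed T -> closed R -> closed (T ⊚ R).
Proof.
move=> cY /closed_relP cT /closed_relP cR; apply/closed_relP => x z nTR.
pose D := [set W : set Y | open W /\ exists U V,
  [/\ open U /\ U x, open V /\ V z & forall x' y' z',
      U x' -> W y' -> V z' -> R (x', y') -> T (y', z') -> False]].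
have [|||y _|W [oW [U [V [oU oV UV]]]] WT] := @compact_directed Y setT D cY.
- by move=> W [].
- exists set0; split; first exact: open0.
  by exists setT, setT; split=> //; split=> //; exact: openT.
- move=> W W' [oW [U [V [[oU Ux] [oV Vz] UV]]]].
  move=> [oW' [U' [V' [[oU' Ux'] [oV' Vz'] UV']]]].
  exists (W `|` W') => //; split; first exact: openU.
  exists (U `&` U'), (V `&` V'); split; try by split=> //; exact: openI.
  by move=> x' y' z' [? ?] [Wy|Wy] [? ?]; [exact: UV|exact: UV'].
- have [xy|nxy] := pselect (R (x, y)).
    have [|W [V [[oW Wy] [oV Vz] WV]]] := cT y z.
      by move=> yz; apply: nTR; exists y.
    exists W => //; split=> //; exists setT, V; split=> //.
      by split=> //; exact: openT.
    by move=> x' y' z' _ Wy' Vz' _; exact: WV.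
  have [U [W [[oU Ux] [oW Wy] UW]]] := cR x y nxy.
  exists W => //; split=> //; exists U, setT; split=> //.
    by split=> //; exact: openT.
  by move=> x' y' z' Ux' Wy' _ xy' _; exact: (UW x' y').
exists U, V; split=> // x' z' Ux' Vz' [y' /= xy yz].
by apply: (UV x' y' z') => //; exact: WT.
Qed.

Lemma closed_rel_id (X : topologicalType) :
  hausdorff_space X -> closed (@rel_id X).
Proof. by move=> hX; apply: (@closed_graph X X id hX) => x. Qed.

Lemma closed_compact (X : topologicalType) (K : set X) :
  compact [set: X] -> closed K -> compact K.
Proof. by move=> cX cK; exact: (subclosed_compact cK cX). Qed.

Lemma hausdorff_point_sep (X : topologicalType) :
  (forall x y : X, x <> y -> exists U V : set X,
    [/\ open U /\ U x, open V /\ V y & U `&` V `<=` set0]) ->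
  hausdorff_space X.
Proof.
move=> h; rewrite open_hausdorff => x y /eqP /h[U [V [[oU Ux] [oV Vy] UV]]].
exists (U, V) => /=; first by split; exact/mem_set.
by split=> //; apply/eqP/seteqP; split.
Qed.

(** * Normality and Stone spaces *)

(** Normality, with the two neighbourhoods made explicit. *)
Lemma compact_hausdorff_sep (X : topologicalType) (A B : set X) :
  compact [set: X] -> hausdorff_space X -> closed A -> closed B ->
  A `&` B `<=` set0 ->
  exists U V, [/\ open U, open V, A `<=` U, B `<=` V & U `&` V `<=` set0].
Proof.
move=> cX hX cA cB AB0; have nX := compact_normal hX cX.
have nAB : set_nbhs A (~` B).
  apply/set_nbhsP; exists (~` B); split=> //; first by rewrite openC.
  by move=> x Ax Bx; exact: (AB0 x).
have [W /set_nbhsP[U [oU AU UW]] WB] := nX A cA _ nAB.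
exists U, (~` closure W); split=> //.
- by rewrite openC; exact: closed_closure.
- by move=> x Bx /WB.
- by move=> x [/UW Wx]; apply; exact: subset_closure.
Qed.

(** The clopens contained in U form a directed cover of K. *)
Lemma clopen_between (X : topologicalType) (K U : set X) :
  stone_space X -> closed K -> open U -> K `<=` U ->
  exists C, [/\ clopen C, K `<=` C & C `<=` U].
Proof.
move=> [cX hX [_ bX]] cK oU KU.
have [||||C [cC CU] KC] := @compact_directed X K
    [set C | clopen C /\ C `<=` U] (closed_compact cX cK).
- by move=> C [[]].
- by exists set0; split=> //; exact: clopen0.
- move=> C C' [cC CU] [cC' CU']; exists (C `|` C') => //.
  by split; [exact: clopenU|rewrite subUset].
- move=> x /KU Ux.
  have /bX[C [cC Cx] CU] : nbhs x U by exact: open_nbhs_nbhs.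
  by exists C.
by exists C.
Qed.

(** Compactness turns separation of points into a base: the clopens that
    avoid x form a directed cover of the complement of any neighbourhood of x. *)
Lemma zero_dimensional_stone (X : topologicalType) :
  compact [set: X] -> hausdorff_space X ->
  (forall x y : X, x <> y -> exists C, [/\ clopen C, C x & ~ C y]) ->
  stone_space X.
Proof.
move=> cX hX sep; split=> //; split=> [C [] //|x A].
rewrite nbhsE => -[U [oU Ux] UA].
have cU : closed (~` U) by rewrite closedC.
have [||||C [[cC1 cC2] nCx] UC] := @compact_directed X (~` U)
    [set C | clopen C /\ ~ C x] (closed_compact cX cU).
- by move=> C [[]].
- by exists set0; split=> //; exact: clopen0.
- move=> C C' [cC Cx] [cC' Cx']; exists (C `|` C') => //.
  by split; [exact: clopenU|case].
- move=> y nUy; have [|C [cC Cy nCx]] := sep y x; last by exists C.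
  by move=> yx; apply: nUy; rewrite yx.
exists (~` C); first by split=> //; exact: clopenC.
by move=> y nCy; apply: UA; apply: contrapT => /UC.
Qed.

Lemma compact_continuous_image (X Y : topologicalType) (f : X -> Y) :
  compact [set: X] -> continuous f -> (forall y, exists x, f x = y) ->
  compact [set: Y].
Proof.
move=> cX fc fs; have -> : [set: Y] = f @` setT.
  by apply/seteqP; split=> // y _; have [x <-] := fs y; exists x.
by apply: continuous_compact => //; exact: continuous_subspaceT.
Qed.

(** * Quotients of compact Hausdorff spaces *)

Section QuotientProjection.
Variable X : eqspace.

Lemma qproj_surj (q : qspace X) : exists x, qproj x = q.
Proof. by exists (repr q); rewrite /qproj reprK. Qed.

Lemma qprojP x y : qproj x = qproj y :> qspace X <-> eqsp_rel X (x, y).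
Proof.
split=> [/eqmodP/asboolP //|xy].
exact/eqmodP/asboolP.
Qed.

Lemma qproj_continuous : continuous (@qproj X).
Proof. exact: pi_continuous. Qed.

Lemma qproj_comp_conv : (graph (@qproj X))^† ⊚ graph (@qproj X) = eqsp_rel X.
Proof.
rewrite /rcomp /rconv /graph; apply/seteqP.
split=> [[x y] [q /= <-] /esym/qprojP //|[x y] xy].
by exists (qproj y) => //=; apply/qprojP.
Qed.

Lemma conv_comp_qproj : graph (@qproj X) ⊚ (graph (@qproj X))^† = @rel_id (qspace X).
Proof. exact: graph_surj qproj_surj. Qed.

Lemma open_qspace (U : set (qspace X)) : open (@qproj X @^-1` U) -> open U.
Proof. by []. Qed.

Hypothesis cX : compact [set: X].
Hypothesis hX : hausdorff_space X.
Hypothesis cE : closed (eqsp_rel X).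

Lemma closed_saturation (K : set X) : closed K -> closed (rel_image (eqsp_rel X) K).
Proof. by move=> cK; apply: closed_rel_image => //; exact: closed_compact. Qed.

Lemma qspace_compact : compact [set: qspace X].
Proof.
exact: (compact_continuous_image cX qproj_continuous qproj_surj).
Qed.

(** Distinct classes are disjoint closed sets, hence have disjoint open
    neighbourhoods; these are shrunk to saturated ones. *)
Lemma qspace_hausdorff : hausdorff_space (qspace X).
Proof.
apply: hausdorff_point_sep => p q.
have [x <-] := qproj_surj p; have [y <-] := qproj_surj q => nxy.
pose cl z := rel_image (eqsp_rel X) [set z].
have ccl z : closed (cl z).
  by apply: closed_rel_image => //; exact: compact_set1.
have [|U [V [oU oV xU yV UV]]] := @compact_hausdorff_sep X (cl x) (cl y) cX hX
    (ccl x) (ccl y).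
  move=> z [[_ -> xz] [_ -> yz]]; apply: nxy; apply/qprojP.
  exact: eqsp_trans xz (eqsp_sym yz).
(* the largest saturated subset of an open set is open *)
pose core (W : set X) := [set p : qspace X | forall z, qproj z = p -> W z].
have ocore W : open W -> open (core W).
  move=> oW; apply: open_qspace.
  rewrite (_ : _ @^-1` _ = ~` rel_image (eqsp_rel X) (~` W)).
    by rewrite openC; apply: closed_saturation; rewrite closedC.
  apply/seteqP; split=> [z /= Wz [w nWw wz]|z nz w /qprojP wz].
    by apply: nWw; apply: Wz; apply/qprojP.
  by apply: contrapT => nWw; apply: nz; exists w.
exists (core U), (core V); split.
- by split; [exact: ocore|move=> z /qprojP/eqsp_sym xz; apply: xU; exists x].
- by split; [exact: ocore|move=> z /qprojP/eqsp_sym xz; apply: yV; exists y].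
- move=> r [Ur Vr]; have [z zr] := qproj_surj r.
  by apply: (UV z); split; [exact: Ur|exact: Vr].
Qed.

End QuotientProjection.

(** * The categories of spaces and the quotient functor *)

Lemma KHausR_category : is_category KHausR.
Proof.
split=> /=.
- by move=> X [_ hX]; exact: closed_rel_id.
- by move=> X Y Z g f _ [cY _] _; exact: closed_rel_comp.
- by move=> X Y f _ _ _; exact: rel_comp_idl.
- by move=> X Y f _ _ _; exact: rel_comp_idr.
- by move=> W X Y Z h g f *; exact: rel_compA.
Qed.

Lemma eqsp_rel_idem (X : eqspace) : eqsp_rel X ⊚ eqsp_rel X = eqsp_rel X.
Proof.
apply/seteqP; split=> [[x y] [z /= xz zy]|[x y] xy]; first exact: eqsp_trans xz zy.
by exists x => //; exact: eqsp_refl.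
Qed.

Lemma StoneER_category : is_category StoneER.
Proof.
split=> /=.
- by move=> X [_ cE]; split=> //; exact: eqsp_rel_idem.
- move=> X Y Z g f _ [[cY _ _] _] _ [cg gE Eg] [cf fE Ef].
  split; first exact: closed_rel_comp.
    by rewrite -[LHS]rel_compA [X in _ ⊚ X]fE.
  by rewrite [LHS]rel_compA [X in X ⊚ _]Eg.
- by move=> X Y f _ _ [].
- by move=> X Y f _ _ [].
- by move=> W X Y Z h g f *; exact: rel_compA.
Qed.

Lemma qspace_ob (X : eqspace) : is_ob StoneER X -> is_ob KHausR (qspace X).
Proof.
by move=> [[cX hX _] cE]; split; [exact: qspace_compact|exact: qspace_hausdorff].
Qed.

Lemma closed_qproj (X : eqspace) : is_ob StoneER X -> closed (graph (@qproj X)).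
Proof.
by move=> /qspace_ob[_ hQ]; apply: closed_graph => //; exact: qproj_continuous.
Qed.

Lemma Qfun_functor : is_functor Qfun.
Proof.
split.
- exact: qspace_ob.
- move=> X Y R hX hY [cR _ _]; have [[[cX _ _] _] [[cY _ _] _]] := (hX, hY).
  exact: (closed_rel_comp cY (closed_qproj hY)
    (closed_rel_comp cX cR (closed_rel_conv (closed_qproj hX)))).
- move=> X _; rewrite /= /graph /rel_id; apply/seteqP.
  split=> [[p q] [y [x /= <- xy] <-]|[p _] /= <-]; first exact/qprojP.
  have [x <-] := qproj_surj p; exists x => //; exists x => //; exact: eqsp_refl.
- move=> X Y Z T R _ _ _ [_ TE _] _.
  pose P W := graph (@qproj W).
  change (P Z ⊚ (T ⊚ R ⊚ (P X)^†) =
    P Z ⊚ (T ⊚ (P Y)^†) ⊚ (P Y ⊚ (R ⊚ (P X)^†))).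
  (* the equivalence created by the middle projections is absorbed by T *)
  have {1}<- : T ⊚ ((P Y)^† ⊚ P Y) = T by rewrite qproj_comp_conv.
  by rewrite !rel_compA.
Qed.

(** * The Vietoris space *)

Section Vietoris.
Variable X : topologicalType.
Implicit Types (F G : closeds X) (U : set X).

Definition vsub U : set (closeds X) := [set F | \val F `<=` U].
Definition vmeet U : set (closeds X) := [set F | \val F `&` U !=set0].

(** Convergence in the Vietoris topology need only be tested on the subbase. *)
Lemma vietoris_cvg (L : set_system (closeds X)) F :
  Filter L ->
  (forall U, open U -> vsub U F -> L (vsub U)) ->
  (forall U, open U -> vmeet U F -> L (vmeet U)) ->
  L --> F.
Proof.
move=> FL Ls Lm A; rewrite nbhs_simpl nbhsE => -[B [oB BF] BA].
apply: filterS BA _; case: oB BF => D' sD' <- [C D'C CF].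
have CB : C `<=` \bigcup_(i in D') id i by move=> G CG; exists C.
apply: filterS CB _; have [I sI IC] := sD' _ D'C; rewrite -IC in CF *.
apply: filter_bigI => -[U b] iI; have /set_mem /= oU := sI _ iI.
by have := CF _ iI; clear iI; case: b => ?; [exact: Ls | exact: Lm].
Qed.

Lemma open_vietoris_subbase (U : set X) b : open U ->
  open (if b then vsub U else vmeet U).
Proof.
move=> oU.
exists [set if b then vsub U else vmeet U]; last by rewrite bigcup_set1.
move=> _ ->; exists [fset (U, b)]%fset; first by move=> i /fset1P ->; exact/mem_set.
apply/seteqP; split=> [G /(_ (U, b))|G GU i]; first by apply; exact/fset1P.
by move=> /fset1P ->.
Qed.

Lemma open_vsub U : open U -> open (vsub U).
Proof. exact: (@open_vietoris_subbase U true). Qed.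

Lemma open_vmeet U : open U -> open (vmeet U).
Proof. exact: (@open_vietoris_subbase U false). Qed.

Lemma vsubC U : ~` vsub (~` U) = vmeet U.
Proof.
apply/seteqP; split=> [F nFU|F [x [Fx Ux]] FU]; last exact: (FU x).
by apply: contrapT => nF; apply: nFU => x Fx Ux; apply: nF; exists x.
Qed.

Lemma clopen_vmeet U : clopen U -> clopen (vmeet U).
Proof.
move=> [oU cU]; split; first exact: open_vmeet.
by rewrite -vsubC closedC; apply: open_vsub; rewrite openC.
Qed.

Lemma clopen_vsub U : clopen U -> clopen (vsub U).
Proof.
move=> cU; rewrite -(setCK U) -[vsub _]setCK vsubC.
exact: (clopenC set0 (clopen_vmeet (clopenC U cU))).
Qed.

(** An ultrafilter L of closed sets converges to the set K of the points all
    of whose neighbourhoods are met by L-almost all sets.  That L-almost all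
    sets lie in U when K does is the compactness of the complement of U. *)
Lemma vietoris_compact : compact [set: X] -> compact [set: closeds X].
Proof.
move=> cX; rewrite compact_ultra => L UL _.
pose K := [set x | forall U, open U -> U x -> L (vmeet U)].
have cK : closed K.
  apply: closedP_nbhd => x nKx.
  have [U [oU Ux nLU]] : exists U, [/\ open U, U x & ~ L (vmeet U)].
    apply: contrapT => h; apply: nKx => U oU Ux; apply: contrapT => nL.
    by apply: h; exists U.
  by exists U; split=> // y Uy /(_ U oU Uy).
exists (set_elt cK); split=> //; apply: vietoris_cvg => U oU.
  move=> /= KU.
  have cU : closed (~` U) by rewrite closedC.
  have [||||V [oV LV] UV] := @compact_directed X (~` U)
    [set V | open V /\ L (vsub (~` V))] (closed_compact cX cU).
  - by move=> V [].
  - exists set0; split; first exact: open0.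
    by rewrite setC0; apply: filterS filterT => F _ x _.
  - move=> V V' [oV LV] [oV' LV']; exists (V `|` V') => //; split; first exact: openU.
    apply: filterS (filterI LV LV') => F [FV FV'] x Fx.
    by rewrite setCU; split; [exact: FV|exact: FV'].
  - move=> x nUx.
    have [V [oV Vx nLV]] : exists V, [/\ open V, V x & ~ L (vmeet V)].
      apply: contrapT => h; apply: nUx; apply: KU => V oV Vx.
      by apply: contrapT => nL; apply: h; exists V.
    exists V => //; split=> //.
    have [//|] := in_ultra_setVsetC (vmeet V) UL.
    by rewrite -vsubC setCK.
  apply: filterS LV => F FV x Fx; apply: contrapT => nUx.
  exact: (FV x Fx (UV x nUx)).
by move=> [x [Kx Ux]]; exact: Kx.
Qed.

Hypothesis cX : compact [set: X].
Hypothesis hX : hausdorff_space X.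

Lemma closeds_neq F G : F <> G ->
  (exists2 x, \val F x & ~ \val G x) \/ (exists2 x, \val G x & ~ \val F x).
Proof.
move=> FG; apply: contrapT => h; apply: FG; apply: val_inj.
by apply/seteqP; split=> x Hx; apply: contrapT => nx; apply: h; [left|right]; exists x.
Qed.

Lemma vietoris_hausdorff : hausdorff_space (closeds X).
Proof.
suff sep F G x : \val F x -> ~ \val G x -> exists U V : set (closeds X),
    [/\ open U /\ U F, open V /\ V G & U `&` V `<=` set0].
  apply: hausdorff_point_sep => F G /closeds_neq[[x Fx Gx]|[x Gx Fx]].
    exact: sep Fx Gx.
  have [U [V [hU hV UV]]] := sep G F x Gx Fx; exists V, U; split=> //.
  by rewrite setIC.
move=> Fx Gx; have [||U [V [oU oV xU GV UV]]] := @compact_hausdorff_sep X [set x]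
    (\val G) cX hX _ (set_valP G).
- by apply: accessible_closed_set1; exact: hausdorff_accessible.
- by move=> y [-> /Gx].
exists (vmeet U), (vsub V); split.
- by split; [exact: open_vmeet | exists x; split=> //; exact: xU].
- by split; [exact: open_vsub | ].
- by move=> H [[y [Hy Uy]] HV]; apply: (UV y); split=> //; exact: HV.
Qed.

Lemma vietoris_stone : stone_space X -> stone_space (closeds X).
Proof.
move=> sX; apply: zero_dimensional_stone => //.
- exact: vietoris_compact.
- exact: vietoris_hausdorff.
suff sep F G x : \val F x -> ~ \val G x -> exists U, [/\ clopen U, U x & \val G `<=` ~` U].
  move=> F G /closeds_neq[[x Fx Gx]|[x Gx Fx]].
    have [U [cU Ux GU]] := sep _ _ _ Fx Gx.
    exists (vmeet U); split; [exact: clopen_vmeet|by exists x|].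
    by move=> [y [Gy Uy]]; exact: (GU y).
  have [U [cU Ux FU]] := sep _ _ _ Gx Fx.
  exists (vsub (~` U)); split=> //; first exact: (clopen_vsub (clopenC U cU)).
  by move=> /(_ x Gx).
move=> Fx Gx; have cG : open (~` \val G) by rewrite openC; exact: set_valP.
have [||U [cU xU UG]] := @clopen_between X [set x] _ sX _ cG.
- by apply: accessible_closed_set1; exact: hausdorff_accessible.
- by move=> _ ->.
exists U; split=> //; first exact: xU.
by move=> y Gy /UG.
Qed.

End Vietoris.

(** * The Vietoris functors *)

Lemma vietoris_rel_id (X : topologicalType) :
  vietoris_rel (@rel_id X) = @rel_id (closeds X).
Proof.
rewrite /vietoris_rel /rel_id; apply/seteqP; split=> [[F G] /= [GF FG]|[F G] /= ->].
  apply: val_inj; apply/seteqP; split=> x.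
    by move=> /FG[y Gy] /= ->.
  by move=> /GF[y Fy] /= <-.
by split=> x Gx; exists x.
Qed.

(** The points of R[F] that are T-related to a point of H form a closed
    intermediate set. *)
Lemma vietoris_rel_comp (X Y Z : topologicalType) (T : set (Y * Z)) (R : set (X * Y)) :
  compact [set: X] -> compact [set: Z] -> closed T -> closed R ->
  vietoris_rel (T ⊚ R) = vietoris_rel T ⊚ vietoris_rel R.
Proof.
move=> cX cZ cT cR; apply/seteqP; split=> [[F H] [/= HF FH]|[F H] [G [/= GF FG] [/= HG GH]]].
  have cG : closed (rel_image R (\val F) `&` rel_image T^† (\val H)).
    apply: closedI; apply: closed_rel_image; rewrite ?openC //.
    - exact: closed_compact (set_valP F).
    - exact: closed_compact (set_valP H).
    - exact: closed_rel_conv.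
  exists (set_elt cG); split=> /=.
  - by move=> y [].
  - move=> x /[dup] Fx /FH[z Hz [y xy yz]]; exists y => //.
    by split; [exists x|exists z].
  - move=> z /[dup] Hz /HF[x Fx [y xy yz]]; exists y => //.
    by split; [exists x|exists z].
  - by move=> y [].
split=> [z /HG[y /GF[x Fx xy] yz]|x /FG[y /GH[z Hz yz] xy]].
  by exists x => //; exists y.
by exists z => //; exists y.
Qed.

Lemma closed_vietoris_rel (X Y : topologicalType) (R : set (X * Y)) :
  compact [set: X] -> compact [set: Y] ->
  hausdorff_space X -> hausdorff_space Y ->
  closed R -> closed (vietoris_rel R).
Proof.
move=> cX cY hX hY cR.
(* one half of the Egli-Milner condition; the other is its converse *)
have half (X' Y' : topologicalType) (Q : set (X' * Y')) :
    compact [set: X'] -> compact [set: Y'] -> hausdorff_space Y' -> closed Q ->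
    closed [set FG : closeds X' * closeds Y' | \val FG.2 `<=` rel_image Q (\val FG.1)].
  move=> cX' cY' hY' cQ; apply/closed_relP => F G /= nGF.
  have [y Gy nFy] : exists2 y, \val G y & ~ rel_image Q (\val F) y.
    by apply: contrapT => h; apply: nGF => y Gy; apply: contrapT => ny; apply: h; exists y.
  have cQF : closed (rel_image Q (\val F)).
    by apply: closed_rel_image => //; exact: closed_compact (set_valP F).
  have [||V [W [oV oW yV FW VW]]] := @compact_hausdorff_sep Y' [set y] _ cY' hY' _ cQF.
  - by apply: accessible_closed_set1; exact: hausdorff_accessible.
  - by move=> z [-> ].
  exists (vsub (~` rel_image Q^† (~` W))), (vmeet V); split.
  - split.
      apply: open_vsub; rewrite openC; apply: closed_rel_image; last exact: closed_rel_conv.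
      by apply: closed_compact => //; rewrite closedC.
    by move=> x Fx [z nWz xz]; apply: nWz; apply: FW; exists x.
  - by split; [exact: open_vmeet|exists y; split=> //; exact: yV].
  - move=> F' G' FW' [z [Gz Vz]] /(_ z Gz)[x /FW' nx xz].
    apply: nx; exists z => // Wz; exact: (VW z).
have := closedI (half _ _ R cX cY hY cR)
  (closed_rel_conv (half _ _ R^† cY cX hX (closed_rel_conv cR))).
by congr closed; apply/seteqP; split=> [[F G]|[F G]].
Qed.

Lemma VKHaus_functor : is_functor VKHaus.
Proof.
split.
- by move=> X [cX hX]; split; [exact: vietoris_compact|exact: vietoris_hausdorff].
- by move=> X Y R [cX hX] [cY hY]; exact: closed_vietoris_rel.
- by move=> X _; exact: vietoris_rel_id.
- by move=> X Y Z T R [cX _] _ [cZ _]; exact: vietoris_rel_comp.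
Qed.

Lemma VStoneE_functor : is_functor VStoneE.
Proof.
split.
- move=> X [[cX hX bX] cE]; split; first exact: vietoris_stone.
  exact: closed_vietoris_rel.
- move=> X Y R [[cX hX bX] cEX] [[cY hY bY] cEY] [cR RE ER]; split.
  + exact: closed_vietoris_rel.
  + rewrite -[LHS]/(vietoris_rel R ⊚ vietoris_rel (eqsp_rel X)).
    by rewrite -vietoris_rel_comp //; congr vietoris_rel.
  + rewrite -[LHS]/(vietoris_rel (eqsp_rel Y) ⊚ vietoris_rel R).
    by rewrite -vietoris_rel_comp //; congr vietoris_rel.
- by [].
- move=> X Y Z T R [[cX _ _] _] _ [[cZ _ _] _] [cT _ _] [cR _ _].
  exact: vietoris_rel_comp.
Qed.

(** * Vietoris spaces of quotients *)

(** With P P^† = id and P^† P = E, and the same for the projection P_V of the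
    Vietoris space, P_V V(P^†) and V(P) P_V^† are mutually inverse. *)
Lemma vietoris_quotient : nat_iso (functor_comp VKHaus Qfun) (functor_comp Qfun VStoneE).
Proof.
pose P X := graph (@qproj X).
pose PV X := graph (@qproj (vietoris_eqspace X)).
have VK X := fob_ob VStoneE_functor (X := X).
have PP X : P X ⊚ (P X)^† = @rel_id (qspace X) by exact: conv_comp_qproj.
have PPV X : PV X ⊚ (PV X)^† = @rel_id (qspace (vietoris_eqspace X)) by exact: conv_comp_qproj.
have PE X : (P X)^† ⊚ P X = eqsp_rel X by exact: qproj_comp_conv.
have PEV X : (PV X)^† ⊚ PV X = vietoris_rel (eqsp_rel X).
  exact: (@qproj_comp_conv (vietoris_eqspace X)).
have PEP X : P X ⊚ eqsp_rel X ⊚ (P X)^† = @rel_id (qspace X).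
  by rewrite -PE !rel_compA PP rel_comp_idl.
pose al X := PV X ⊚ vietoris_rel (P X)^†.
exists (fun X _ => al X); split=> [X hX|X Y hX hY R [cR RE ER]].
  have [[[cX hX' _] cE] [cQ hQ]] := (hX, qspace_ob hX).
  have [[[cV hV _] _] [cQV hQV]] := (VK X hX, qspace_ob (VK X hX)).
  have cP : closed (P X) by exact: closed_qproj.
  have cPV : closed (PV X) by exact: (closed_qproj (VK X hX)).
  have cP' := closed_rel_conv cP; have cPV' := closed_rel_conv cPV.
  have cVP : closed (vietoris_rel (P X)) by exact: closed_vietoris_rel.
  have cVP' : closed (vietoris_rel (P X)^†) by exact: closed_vietoris_rel.
  split; first exact: (closed_rel_comp cV cPV cVP').
  exists (vietoris_rel (P X) ⊚ (PV X)^†); split.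
  - exact: (closed_rel_comp cV cVP cPV').
  - rewrite -[LHS]/(vietoris_rel (P X) ⊚ (PV X)^† ⊚ (PV X ⊚ vietoris_rel (P X)^†)).
    rewrite rel_compA -(rel_compA _ _ (PV X)) PEV -!vietoris_rel_comp //.
      by rewrite PEP vietoris_rel_id.
    exact: closed_rel_comp.
  - rewrite -[LHS]/(PV X ⊚ vietoris_rel (P X)^† ⊚ (vietoris_rel (P X) ⊚ (PV X)^†)).
    rewrite rel_compA -(rel_compA _ _ (vietoris_rel (P X))) -vietoris_rel_comp //.
    by rewrite PE -PEV !rel_compA PPV rel_comp_idl PPV.
have [[[cX hX' _] cE] [cQ hQ]] := (hX, qspace_ob hX).
have [[[cY hY' _] cEY] [cQY hQY]] := (hY, qspace_ob hY).
have cPX : closed (P X) by exact: closed_qproj.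
have cPY : closed (P Y) by exact: closed_qproj.
have cPX' := closed_rel_conv cPX; have cPY' := closed_rel_conv cPY.
have cRP : closed (R ⊚ (P X)^†) by exact: closed_rel_comp.
have cPRP : closed (P Y ⊚ (R ⊚ (P X)^†)) by exact: closed_rel_comp.
rewrite -[LHS]/(PV Y ⊚ vietoris_rel (P Y)^† ⊚ vietoris_rel (P Y ⊚ (R ⊚ (P X)^†))).
rewrite -[RHS]/(PV Y ⊚ (vietoris_rel R ⊚ (PV X)^†) ⊚
  (PV X ⊚ vietoris_rel (P X)^†)).
rewrite -rel_compA -vietoris_rel_comp // rel_compA PE rel_compA.
rewrite [X in vietoris_rel (X ⊚ _)]ER vietoris_rel_comp //.
rewrite -!rel_compA (rel_compA (PV X)^†) PEV.
have RVE : vietoris_rel R ⊚ vietoris_rel (eqsp_rel X) = vietoris_rel R.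
  by rewrite -vietoris_rel_comp // [R ⊚ _]RE.
by rewrite (rel_compA (vietoris_rel R)) RVE.
Qed.

(** * Compatible subordinations *)

Section Subordinations.
Context {d1 d2 d3 : Order.disp_t}.
Context {A : ctbDistrLatticeType d1} {B : ctbDistrLatticeType d2}.
Context {C : ctbDistrLatticeType d3}.

Lemma subordination_comp (T : set (B * C)) (S : set (A * B)) :
  subordination T -> subordination S -> subordination (T ⊚ S).
Proof.
move=> [[T0 T1] Tj Tm Tle] [[S0 S1] Sj Sm Sle]; split.
- by split; [exists \bot%O | exists \top%O].
- move=> a b c [x ax xc] [y bY yc]; exists (x `|` y)%O; last exact: Tj.
  apply: Sj; [exact: Sle (lexx _) ax (leUl _ _)|exact: Sle (lexx _) bY (leUr _ _)].
- move=> a c e [x ax xc] [y ay ye]; exists (x `&` y)%O; first exact: Sm.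
  by apply: Tm; [exact: Tle (leIl _ _) xc _|exact: Tle (leIr _ _) ye _].
- move=> a b c e ab [x bx xc] ce; exists x.
    exact: Sle ab bx (lexx _).
  exact: Tle (lexx _) xc ce.
Qed.

End Subordinations.

Lemma subalg_rel_idem (B : subalg) :
  is_ob SubS5S B -> subalg_rel B ⊚ subalg_rel B = subalg_rel B.
Proof.
move=> [S5 _ S7]; have [_ _ _ Sle] := @subalg_subordination B.
apply/seteqP; split=> [[a b] [c ac /S5 /= cb]|[a b] /S7[c [ac cb]]]; last by exists c.
exact: Sle (lexx _) ac cb.
Qed.

Lemma SubS5S_category : is_category SubS5S.
Proof.
split=> /=.
- move=> B hB; split; try exact: subalg_rel_idem.
  exact: subalg_subordination.
- move=> X Y Z g f _ _ _ [sg gX Zg] [sf fX Zf]; split.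
  + exact: subordination_comp.
  + by rewrite -[LHS]rel_compA [X in _ ⊚ X]fX.
  + by rewrite [LHS]rel_compA [X in X ⊚ _]Zg.
- by move=> X Y f _ _ [].
- by move=> X Y f _ _ [].
- by move=> W X Y Z h g f *; exact: rel_compA.
Qed.

Lemma DeVS_category : is_category DeVS.
Proof. exact: full_subcategory_category SubS5S_category. Qed.

(** Compatibility on the other side comes from rebracketing f g f and g f g. *)
Lemma subalg_iso (A B : subalg) (f : set (A * B)) (g : set (B * A)) :
  subordination f -> subordination g ->
  f ⊚ subalg_rel A = f -> g ⊚ subalg_rel B = g ->
  g ⊚ f = subalg_rel A -> f ⊚ g = subalg_rel B -> @is_iso SubS5S A B f.
Proof.
move=> sf sg fA gB gf fg; split.
  by split=> //; rewrite -[LHS]/(_ ⊚ _) -fg -rel_compA gf.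
exists g; split=> //.
by split=> //; rewrite -[LHS]/(_ ⊚ _) -gf -rel_compA fg.
Qed.

(** * The clopen functor *)

(** R[U] is closed, and the points whose T-successors all lie in W form an
    open set. *)
Lemma clopen_interpolate (X Y Z : topologicalType) (T : set (Y * Z))
    (R : set (X * Y)) (U : set X) (W : set Z) :
  compact [set: X] -> stone_space Y -> compact [set: Z] ->
  closed T -> closed R -> closed U -> open W ->
  rel_image (T ⊚ R) U `<=` W ->
  exists V : clopens Y, rel_image R U `<=` \val V /\ rel_image T (\val V) `<=` W.
Proof.
move=> cX sY cZ cT cR cU oW; rewrite rel_image_comp => TRU.
have [|||V [cV RV VT]] := @clopen_between Y (rel_image R U)
    (~` rel_image T^† (~` W)) sY.
- by apply: closed_rel_image => //; exact: closed_compact.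
- rewrite openC; apply: closed_rel_image; last exact: closed_rel_conv.
  by apply: closed_compact => //; rewrite closedC.
- by move=> y Ry [z nWz yz]; apply: nWz; apply: TRU; exists y.
exists (set_elt cV); split=> // z [y /VT ny yz].
by apply: contrapT => nWz; apply: ny; exists z.
Qed.

Lemma clopens_closed (X : topologicalType) (U : clopens X) : closed (\val U).
Proof. by have [] := set_valP U. Qed.

Lemma clopens_open (X : topologicalType) (U : clopens X) : open (\val U).
Proof. by have [] := set_valP U. Qed.

Lemma clop_rel_comp (X Y Z : topologicalType) (T : set (Y * Z))
    (R : set (X * Y)) :
  compact [set: X] -> stone_space Y -> compact [set: Z] ->
  closed T -> closed R -> clop_rel (T ⊚ R) = clop_rel T ⊚ clop_rel R.
Proof.
move=> cX sY cZ cT cR; apply/seteqP; split=> [[U W]|[U W] [V UV VW]].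
  move=> /(clopen_interpolate cX sY cZ cT cR (@clopens_closed _ U) (@clopens_open _ W)).
  by move=> [V [UV VW]]; exists V.
rewrite /clop_rel /= rel_image_comp => z [y /UV Vy yz].
by apply: VW; exists y.
Qed.

Lemma clop_rel_S5 (X : eqspace) :
  is_ob StoneER X -> S5_subordination (clop_rel (eqsp_rel X)).
Proof.
move=> [sX cE]; have [cX _ _] := sX; split.
- move=> U V UV; apply/clopens_leP => x Ux; apply: UV => /=; exists x => //.
  exact: eqsp_refl.
- move=> U V UV y [x nVx xy]; have {}nVx : ~ \val V x by [].
  change (~ \val U y) => Uy.
  apply: nVx; apply: UV; exists y => //.
  exact: eqsp_sym.
- move=> U V; rewrite -{1}[eqsp_rel X]eqsp_rel_idem.
  rewrite clop_rel_comp // => -[W UW WV].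
  by exists W.
Qed.

Lemma Clopfun_functor : is_functor Clopfun.
Proof.
split.
- by move=> X hX; exact: clop_rel_S5.
- move=> X Y R [sX cEX] [sY cEY] [cR RE ER].
  have [[cX _ _] [cY _ _]] := (sX, sY).
  split; first exact: clop_rel_subordination.
    rewrite -[LHS]/(clop_rel R ⊚ clop_rel (eqsp_rel X)) -clop_rel_comp //.
    by congr clop_rel.
  rewrite -[LHS]/(clop_rel (eqsp_rel Y) ⊚ clop_rel R) -clop_rel_comp //.
  by congr clop_rel.
- by [].
- move=> X Y Z T R [[cX _ _] _] [sY _] [[cZ _ _] _] [cT _ _] [cR _ _].
  exact: clop_rel_comp.
Qed.

(** * Frames *)

Section FrameLemmas.
Context {d : Order.disp_t} {L : frameType d}.
Implicit Types (a b c : L) (A : set L).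

Lemma fsup_eq A s : supremums A s -> fsup A = s.
Proof. exact: is_subset1_supremums (fsupP A). Qed.

Lemma fsup_ub A a : A a -> (a <= fsup A)%O.
Proof. by have [ub _] := fsupP A; exact: ub. Qed.

Lemma fsup_le A b : (forall a, A a -> (a <= b)%O) -> (fsup A <= b)%O.
Proof. by have [_ least] := fsupP A; exact: least. Qed.

Lemma well_inside_le a b : well_inside a b -> (a <= b)%O.
Proof.
rewrite /well_inside => ab.
rewrite -[a]meetx1 -ab frame_meetUr pcompl_meet join0x; exact: leIr.
Qed.

Lemma well_insideS a a' b b' :
  (a' <= a)%O -> well_inside a b -> (b <= b')%O -> well_inside a' b'.
Proof.
rewrite /well_inside => aa ab bb; apply/eqP; rewrite -le1x -ab.
by apply: leU2 => //; exact: pcompl_le.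
Qed.

Lemma regular_frameP :
  (forall a b, (forall c, well_inside c a -> (c <= b)%O) -> (a <= b)%O) ->
  regular_frame L.
Proof.
move=> h a; apply/eqP; rewrite eq_le; apply/andP; split.
  by apply: h => c ca; exact: fsup_ub.
by apply: fsup_le => c; exact: well_inside_le.
Qed.

End FrameLemmas.

Lemma KRFrmP_category : is_category KRFrmP.
Proof.
split=> //=; first by move=> L _; split=> //= A _; rewrite image_id.
move=> L M N g f _ _ _ [g1 gI gs] [f1 fI fs]; split=> /=.
- by rewrite f1 g1.
- by move=> a b; rewrite fI gI.
- move=> A dA; rewrite fs // gs; first by rewrite image_comp.
  have fle a b : (a <= b)%O -> (f a <= f b)%O.
    by rewrite !leEmeet => /eqP ab; rewrite -fI ab.
  have [[a Aa] dA'] := dA; split; first by exists (f a); exists a.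
  move=> _ _ [x Ax <-] [y Ay <-]; have [z [Az xz yz]] := dA' x y Ax Ay.
  by exists (f z); split; [exists z|exact: fle|exact: fle].
Qed.

(** Order isomorphisms preserve whatever the order determines, in particular
    finite meets and directed joins. *)
Lemma frame_iso (L M : frame) (f : L -> M) :
  (forall a b, (f a <= f b)%O = (a <= b)%O) ->
  (forall y, exists x, f x = y) -> @is_iso KRFrmP L M f.
Proof.
have hom (L' M' : frame) (h : L' -> M') :
    (forall a b, (h a <= h b)%O = (a <= b)%O) ->
    (forall y, exists x, h x = y) -> preframe_hom h.
  move=> hle hs; split.
  - by apply/eqP; rewrite -le1x; have [x <-] := hs \top%O; rewrite hle lex1.
  - move=> a b; apply/eqP; rewrite eq_le lexI !hle leIl leIr /=.
    have [x xab] := hs (h a `&` h b)%O; rewrite -xab hle lexI -!hle xab.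
    by rewrite leIl leIr.
  - move=> A _; apply/esym/fsup_eq; split=> [_ [a Aa <-]|y ub].
      by rewrite hle; exact: fsup_ub.
    have [x xy] := hs y; rewrite -xy hle; apply: fsup_le => a Aa.
    by rewrite -hle xy; apply: ub; exists a.
move=> fle fs; split; first exact: hom.
pose g y := projT1 (cid (fs y)).
have fK y : f (g y) = y by exact: projT2 (cid (fs y)).
have gK x : g (f x) = x by apply/eqP; rewrite eq_le -!fle fK lexx.
exists g; split; [|exact/funext|exact/funext].
apply: hom => [a b|x]; first by rewrite -fle !fK.
by exists (f x); exact: gK.
Qed.

(** * The frame of opens *)

Section Opens.
Variable X : topologicalType.
Implicit Types (U V W : opens X) (A : set (opens X)).

Lemma val_fsup_opens A : \val (fsup A) = \bigcup_(U in A) \val U.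
Proof. by rewrite (fsup_eq (opens_unionP A)). Qed.

Lemma opens_directed_cover (K : set X) A :
  compact K -> directed A -> K `<=` \val (fsup A) ->
  exists2 U, A U & K `<=` \val U.
Proof.
move=> cK [[U0 AU0] dA]; rewrite val_fsup_opens => KA.
have [||||_ [U AU <-] KU] := @compact_directed X K [set \val U | U in A] cK.
- by move=> _ [U AU <-]; exact: (set_valP U).
- by exists (\val U0); exists U0.
- move=> _ _ [U AU <-] [V AV <-]; have [W [AW /opens_leP UW /opens_leP VW]] := dA U V AU AV.
  by exists (\val W); [exists W|rewrite subUset].
- by move=> x /KA[U AU Ux]; exists (\val U) => //; exists U.
by exists U.
Qed.

Lemma finite_joins_directed d (L : frameType d) (A : set L) :
  directed [set a | exists2 s : seq L, (forall x, x \in s -> A x) &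
                      a = (\join_(x <- s) x)%O].
Proof.
split; first by exists \bot%O, [::] => //; rewrite big_nil.
move=> _ _ [s sA ->] [t tA ->]; exists (\join_(x <- s ++ t) x)%O; split.
- by exists (s ++ t) => // x; rewrite mem_cat => /orP[/sA|/tA].
- by rewrite big_cat leUl.
- by rewrite big_cat leUr.
Qed.

Lemma opens_compact : compact [set: X] -> compact_frame (opens X).
Proof.
move=> cX A A1; have [|_ [s sA ->] ls] := opens_directed_cover cX (finite_joins_directed A).
  rewrite -opens_val1 -A1; apply/opens_leP; apply: fsup_le => U AU.
  apply: fsup_ub; exists [:: U]; last by rewrite big_seq1.
  by move=> x; rewrite inE => /eqP ->.
exists s; split=> //; apply/eqP; rewrite -le1x; apply/opens_leP.
by rewrite opens_val1.
Qed.

(** The pseudocomplement of an open set is the complement of its closure. *)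
Lemma opens_well_insideP U V : well_inside U V <-> closure (\val U) `<=` \val V.
Proof.
split=> [UV|UV].
  have : \val (pcompl U `|` V)%O = setT by rewrite UV.
  rewrite opens_valU => UVT x cx; have : [set: X] x by [].
  rewrite -UVT => -[nx|//]; have [|y [Uy nUy]] := cx (\val (pcompl U)).
    by apply: open_nbhs_nbhs; split=> //; exact: set_valP.
  have : \val (U `&` pcompl U)%O y by [].
  by rewrite pcompl_meet.
have oc : open (~` closure (\val U)) by rewrite openC; exact: closed_closure.
have h : (\top <= (set_elt oc : opens X) `|` V)%O.
  by apply/opens_leP => x _; case: (pselect (closure (\val U) x)) => [/UV|]; [right|left].
apply/eqP; rewrite -le1x; apply: le_trans h _; apply: leU2 => //; rewrite le_pcompl; apply/eqP/val_inj.
apply/seteqP; split=> // x [Ux]; apply; exact: subset_closure.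
Qed.

Lemma opens_regular : compact [set: X] -> hausdorff_space X -> regular_frame (opens X).
Proof.
move=> cX hX; apply: regular_frameP => U V UV; apply/opens_leP => x Ux.
have [|||O [P [oO oP xO UP OP]]] := @compact_hausdorff_sep X [set x] (~` \val U) cX hX.
- by apply: accessible_closed_set1; exact: hausdorff_accessible.
- by rewrite closedC; exact: set_valP.
- by move=> y [-> ].
have /UV/opens_leP : well_inside (set_elt oO : opens X) U.
  apply/opens_well_insideP => y cy; apply: contrapT => /UP Py.
  have [|z [Oz Pz]] := cy P; first by apply: open_nbhs_nbhs.
  exact: (OP z).
by apply; exact: xO.
Qed.

End Opens.

Lemma val_box (X Y : topologicalType) (R : set (X * Y)) (U : opens Y) :
  compact [set: Y] -> closed R ->
  \val (box R U) = ~` rel_image R^† (~` \val U).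
Proof.
move=> cY cR; rewrite /box val_insubd; case: ifPn => // /negP[].
apply/mem_set; rewrite openC; apply: closed_rel_image; last exact: closed_rel_conv.
by apply: closed_compact => //; rewrite closedC; exact: set_valP.
Qed.

Lemma box_valP (X Y : topologicalType) (R : set (X * Y)) (U : opens Y) x :
  compact [set: Y] -> closed R ->
  \val (box R U) x <-> (forall y, R (x, y) -> \val U y).
Proof.
move=> cY cR; rewrite val_box //; split=> [h y xy|h [y nUy xy]]; last exact/nUy/h.
by apply: contrapT => nUy; apply: h; exists y.
Qed.

Lemma Ofun_functor : is_functor Ofun.
Proof.
split.
- by move=> X [cX hX]; split; [exact: opens_compact|exact: opens_regular].
- move=> Y X R [cY hY] [cX hX] cR; rewrite /= in R cR *.
  have bP U x := box_valP U x cY cR.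
  have lebox U V : (U <= V)%O -> (box R U <= box R V)%O.
    move=> /opens_leP UV; apply/opens_leP => x /bP h; apply/bP => y /h; exact: UV.
  split.
  + by apply/val_inj/seteqP; split=> // x _; apply/bP.
  + move=> U V; apply/val_inj/seteqP; split=> x.
      by move=> /bP h; split; apply/bP => y /h[].
    by move=> [/bP hU /bP hV]; apply/bP => y xy; split; [exact: hU|exact: hV].
  + move=> A dA; apply/eqP; rewrite eq_le; apply/andP; split; last first.
      by apply: fsup_le => _ [U AU <-]; apply: lebox; exact: fsup_ub.
    apply/opens_leP => x /bP h.
    have cRx : compact (rel_image R [set x]).
      by apply: closed_compact => //; apply: closed_rel_image => //; exact: compact_set1.
    have [|U AU RU] := opens_directed_cover cRx dA; first by move=> y [_ -> /h].
    rewrite val_fsup_opens; exists (box R U); first by exists U.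
    by apply/bP => y xy; apply: RU; exists x.
- move=> X [cX hX]; apply/funext => U /=; apply/val_inj/seteqP.
  have bP V x := box_valP V x cX (closed_rel_id hX).
  by split=> x; [move=> /bP; apply|move=> Ux; apply/bP => y; rewrite /rel_id /= => <-].
- move=> Z Y X R T [cZ hZ] [cY hY] [cX hX] cR cT; rewrite /= in R T cR cT *.
  apply/funext => U; have cTR := closed_rel_comp cY cT cR.
  apply/val_inj/seteqP; split=> x.
    move=> /(box_valP _ _ cZ cTR) h; apply/(box_valP _ _ cY cR) => y xy.
    by apply/(box_valP _ _ cZ cT) => z yz; apply: h; exists y.
  move=> /(box_valP _ _ cY cR) h; apply/(box_valP _ _ cZ cTR) => z [y xy yz].
  by move: (h y xy) => /(box_valP _ _ cZ cT); apply.
Qed.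

(** * Frames of S-ideals *)

Section Ideals.
Variable B : subalg.
Hypothesis hB : is_ob SubS5S B.
Implicit Types (a b x y : B) (I J K : S_ideals B) (A : set (S_ideals B)).
Local Notation S := (subalg_rel B).

Lemma sub_le a b : S (a, b) -> (a <= b)%O.
Proof. by have [h _ _] := hB; exact: h. Qed.

Lemma subC a b : S (a, b) -> S (~` b, ~` a)%O.
Proof. by have [_ h _] := hB; exact: h. Qed.

Lemma S_ideal_sub I a b : S (a, b) -> \val I b -> \val I a.
Proof. by have [_ _ Ile _] := set_valP I => /sub_le; exact: Ile. Qed.

(** Roundness of this ideal is the interpolation axiom (S7). *)
Lemma S_ideal_below b : @S_ideal B [set a | S (a, b)].
Proof.
have [[S00 _] Sj _ Sle] := @subalg_subordination B; have [_ _ S7] := hB.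
split=> /=.
- exact: Sle (lexx _) S00 (le0x _).
- by move=> x y; exact: Sj.
- by move=> x y xy yb; exact: Sle xy yb (lexx _).
- by move=> x /S7[c [xc cb]]; exists c.
Qed.

Definition below b : S_ideals B := set_elt (S_ideal_below b).

Lemma S_ideal_full : @S_ideal B setT.
Proof.
have [[_ S11] _ _ Sle] := @subalg_subordination B.
by split=> // a _; exists \top%O; split=> //; exact: Sle (lex1 _) S11 (lexx _).
Qed.

Lemma S_ideals_topP I : I = \top%O <-> \val I \top%O.
Proof.
split=> [->|I1].
  have [ub _] := ideal_supP (@setT (S_ideals B)).
  have /S_ideals_leP := ub (set_elt S_ideal_full) Logic.I; exact.
have [_ _ Ile _] := set_valP I.
by apply/eqP; rewrite -le1x; apply/S_ideals_leP => a _; exact: Ile (lex1 a) _.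
Qed.

Lemma S_ideals_bot a : \val (\bot%O : S_ideals B) a -> a = \bot%O.
Proof.
have [[S00 _] _ _ Sle] := @subalg_subordination B.
have I0 : @S_ideal B [set \bot%O].
  split=> // [x y -> ->|x y|x ->]; first by rewrite /= joinxx.
    by move=> xy y0; apply/eqP; rewrite -lex0 -y0.
  by exists \bot%O.
by have /S_ideals_leP := le0x (set_elt I0 : S_ideals B); apply.
Qed.

(** The set on the right is already an S-ideal: the joins of elements of I and
    J witness roundness. *)
Lemma S_ideals_joinP I J a :
  \val (I `|` J)%O a <-> exists x y, [/\ \val I x, \val J y & (a <= x `|` y)%O].
Proof.
have [[S00 _] Sj _ Sle] := @subalg_subordination B.
have [I0 Ij Ile Ir] := set_valP I; have [J0 Jj Jle Jr] := set_valP J.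
have [K0 Kj Kle _] := set_valP (I `|` J)%O.
split=> [|[x [y [Ix Jy axy]]]]; last first.
  apply: Kle axy _; apply: Kj.
    by have /S_ideals_leP := leUl I J; apply.
  by have /S_ideals_leP := leUr J I; apply.
have PS : @S_ideal B [set a | exists x y, [/\ \val I x, \val J y & (a <= x `|` y)%O]].
  split=> /=.
  - by exists \bot%O, \bot%O; split=> //; rewrite le0x.
  - move=> b c [x [y [Ix Jy bxy]]] [x' [y' [Ix' Jy' cxy]]].
    exists (x `|` x')%O, (y `|` y')%O; split; [exact: Ij|exact: Jj|].
    by rewrite joinACA leU2.
  - move=> b c bc [x [y [Ix Jy cxy]]]; exists x, y; split=> //.
    exact: le_trans bc cxy.
  - move=> b [x [y [Ix Jy bxy]]].
    have [[x' [Ix' xx]] [y' [Jy' yy]]] := (Ir x Ix, Jr y Jy).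
    exists (x' `|` y')%O; split; first by exists x', y'.
    apply: (Sle _ _ _ _ bxy _ (lexx _)); apply: Sj.
      exact: Sle (lexx _) xx (leUl _ _).
    exact: Sle (lexx _) yy (leUr _ _).
have /S_ideals_leP : (I `|` J <= (set_elt PS : S_ideals B))%O.
  rewrite leUx; apply/andP; split; apply/S_ideals_leP => b bI.
    by exists b, \bot%O; split=> //; rewrite joinx0.
  by exists \bot%O, b; split=> //; rewrite join0x.
by apply.
Qed.

(** Being disjoint from J is not enough for x, since S-ideals are round: some
    element to which x is S-related must still be disjoint from J. *)
Lemma pcompl_idealP J x :
  \val (pcompl J) x <->
  exists y, S (x, y) /\ forall j, \val J j -> (j `&` y = \bot)%O.
Proof.
have [_ _ Jle _] := set_valP J; split=> [|[y [xy Jy]]].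
  have [_ _ Cle Cr] := set_valP (pcompl J); move=> /Cr[y [Cy xy]].
  exists y; split=> // j Jj; apply: S_ideals_bot; rewrite -(pcompl_meet J).
  by split; [exact: Jle (leIl _ _) Jj|exact: Cle (leIr _ _) Cy].
suff /S_ideals_leP : (below y <= pcompl J)%O by apply.
rewrite le_pcompl -lex0; apply/S_ideals_leP => a [Ja /sub_le ay].
have -> : a = \bot%O by rewrite -(Jy a Ja); apply/esym/eqP; rewrite -leEmeet.
by have [h] := set_valP (\bot%O : S_ideals B).
Qed.

(** If x in the pseudocomplement of J and y in I join to the top, then y
    bounds J.  Conversely, if y bounds J and y S y' with y' in I, then the
    complement of y' is in the pseudocomplement of J. *)
Lemma well_inside_idealP J I :
  well_inside J I <-> exists2 y, \val I y & forall j, \val J j -> (j <= y)%O.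
Proof.
have [_ _ Ile Ir] := set_valP I; rewrite /well_inside; split=> [/S_ideals_topP|[y Iy Jy]].
  move=> /S_ideals_joinP[x [y [/pcompl_idealP[x' [/sub_le xx Jx]] Iy xy]]].
  exists y => // j Jj; have {}Jx := Jx j Jj.
  rewrite -[j]meetx1; apply: le_trans (leI2 (lexx j) xy) _.
  rewrite meetUr; have -> : (j `&` x = \bot)%O.
    by apply/eqP; rewrite -lex0 -Jx leI2.
  by rewrite join0x leIr.
have [y' [Iy' yy]] := Ir y Iy; apply/S_ideals_topP/S_ideals_joinP.
exists (~` y')%O, y'; split=> //; last by rewrite joinCx.
apply/pcompl_idealP; exists (~` y)%O; split; first exact: subC.
by move=> j /Jy jy; apply/eqP; rewrite -lex0 -(meetxC y) leI2.
Qed.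

Lemma S_ideals_regular : regular_frame (S_ideals B).
Proof.
apply: regular_frameP => I J IJ; apply/S_ideals_leP => a Ia.
have [_ _ _ /(_ a Ia)[b [Ib ab]]] := set_valP I.
have /IJ/S_ideals_leP : well_inside (below b) I.
  by apply/well_inside_idealP; exists b => // j /sub_le.
by apply.
Qed.

Lemma val_fsup_ideals A : \val (fsup A) = ideal_union A.
Proof. by rewrite (fsup_eq (ideal_supP A)). Qed.

(** Finitely many elements of members of a directed family all lie in one of
    the members, which is closed under their join. *)
Lemma val_directed_fsup A a : directed A ->
  \val (fsup A) a <-> exists2 I, A I & \val I a.
Proof.
move=> [[I0 AI0] dA]; split=> [|[I AI Ia]]; last first.
  by have /S_ideals_leP := fsup_ub AI; apply.
rewrite val_fsup_ideals => -[s sA le_as].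
suff [I AI Is] : exists2 I, A I & \val I (\join_(x <- s) x)%O.
  by exists I => //; have [_ _ Ile _] := set_valP I; exact: Ile le_as Is.
elim: s sA {le_as} => [|x s IHs] sA.
  by exists I0 => //; rewrite big_nil; have [] := set_valP I0.
have [|I AI Is] := IHs; first by move=> y ys; apply: sA; rewrite inE ys orbT.
have [J AJ Jx] : exists2 J, A J & \val J x by apply: sA; rewrite inE eqxx.
have [K [AK /S_ideals_leP IK /S_ideals_leP JK]] := dA I J AI AJ.
exists K => //; rewrite big_cons; have [_ Kj _ _] := set_valP K.
by apply: Kj; [exact: JK|exact: IK].
Qed.

Lemma S_ideals_compact : compact_frame (S_ideals B).
Proof.
move=> A A1; have dA := finite_joins_directed A.
have /(val_directed_fsup _ dA)[_ [s sA ->] /S_ideals_topP s1] :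
    \val (fsup [set K | exists2 s : seq (S_ideals B), (forall I, I \in s -> A I) &
                      K = (\join_(I <- s) I)%O]) \top%O.
  apply/S_ideals_topP/eqP; rewrite -le1x -A1; apply: fsup_le => I AI; apply: fsup_ub.
  exists [:: I]; last by rewrite big_seq1.
  by move=> J; rewrite inE => /eqP ->.
by exists s.
Qed.

End Ideals.

Lemma ideal_preimage_S_ideal (A B : subalg) (T : set (A * B)) (J : S_ideals B) :
  @is_mor SubS5S A B T -> S_ideal (rel_image T^-1 (\val J)).
Proof.
move=> [[[T00 _] Tj _ Tle] TA BT]; have [J0 Jj Jle _] := set_valP J; split.
- by exists \bot%O.
- move=> a b [x Jx ax] [y Jy bY]; exists (x `|` y)%O; first exact: Jj.
  apply: Tj; [exact: Tle (lexx _) ax (leUl _ _)|exact: Tle (lexx _) bY (leUr _ _)].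
- by move=> a b ab [x Jx bx]; exists x => //; exact: Tle ab bx (lexx _).
- move=> a [x Jx ax]; have [b ab bx] : (T ⊚ subalg_rel A) (a, x).
    by rewrite /rcomp TA.
  by exists b; split=> //; exists x.
Qed.

Lemma ideal_preimageP (A B : subalg) (T : set (A * B)) (J : S_ideals B) a :
  @is_mor SubS5S A B T ->
  \val (ideal_preimage T J) a <-> exists2 b, \val J b & T (a, b).
Proof.
move=> mT; rewrite /ideal_preimage val_insubd; case: ifPn => // /negP[].
exact/mem_set/ideal_preimage_S_ideal.
Qed.

Lemma Ifun_functor : is_functor Ifun.
Proof.
split.
- by move=> B hB; split; [exact: S_ideals_compact|exact: S_ideals_regular].
- move=> B A T hB hA mT; rewrite /= in T mT *.
  have [[[_ T11] Tj Tm Tle] TA BT] := mT.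
  have pP J a := ideal_preimageP J a mT.
  have lep I J : (I <= J)%O -> (ideal_preimage T I <= ideal_preimage T J)%O.
    move=> /S_ideals_leP IJ; apply/S_ideals_leP => a /pP[b Ib ab]; apply/pP.
    by exists b => //; exact: IJ.
  split.
  + by apply/S_ideals_topP/pP; exists \top%O => //; exact/S_ideals_topP.
  + move=> I J; have [_ _ Ile _] := set_valP I; have [_ _ Jle _] := set_valP J.
    apply/val_inj/seteqP; split=> a.
      by move=> /pP[b [Ib Jb] ab]; split; apply/pP; exists b.
    move=> [/pP[b Ib ab] /pP[c Jc ac]]; apply/pP; exists (b `&` c)%O; last exact: Tm.
    by split; [exact: Ile (leIl _ _) Ib|exact: Jle (leIr _ _) Jc].
  + move=> D dD; have dD' : directed [set ideal_preimage T I | I in D].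
      have [[I0 DI0] dD'] := dD; split; first by exists (ideal_preimage T I0); exists I0.
      move=> _ _ [I DI <-] [J DJ <-]; have [K [DK IK JK]] := dD' I J DI DJ.
      by exists (ideal_preimage T K); split; [exists K|exact: lep|exact: lep].
    apply/val_inj/seteqP; split=> a.
      move=> /pP[b /(val_directed_fsup _ dD)[I DI Ib] ab].
      apply/(val_directed_fsup _ dD'); exists (ideal_preimage T I); first by exists I.
      by apply/pP; exists b.
    move=> /(val_directed_fsup _ dD')[_ [I DI <-] /pP[b Ib ab]].
    by apply/pP; exists b => //; apply/(val_directed_fsup _ dD); exists I.
- move=> B hB; apply/funext => J; have mS := idm_mor SubS5S_category hB.
  have [_ _ Jle Jr] := set_valP J.
  apply/val_inj/seteqP; split=> a.
    by move=> /(ideal_preimageP _ _ mS)[b Jb ab]; exact: S_ideal_sub ab Jb.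
  by move=> /Jr[b [Jb ab]]; apply/(ideal_preimageP _ _ mS); exists b.
- move=> C B A S T hC hB hA mS mT; rewrite /= in S T mS mT *.
  have mTS := comp_mor SubS5S_category hA hB hC mT mS.
  apply/funext => J; apply/val_inj/seteqP; split=> a.
    move=> /(ideal_preimageP _ _ mTS)[c Jc [b ab bc]].
    apply/(ideal_preimageP _ _ mS); exists b => //.
    by apply/(ideal_preimageP _ _ mT); exists c.
  move=> /(ideal_preimageP _ _ mS)[b /(ideal_preimageP _ _ mT)[c Jc bc] ab].
  by apply/(ideal_preimageP _ _ mTS); exists c => //; exists b.
Qed.

(** * Opens of the quotient are ideals of clopens *)

Lemma clopens_cover (X : topologicalType) (W : set X) x :
  stone_space X -> open W -> W x -> exists2 U : clopens X, \val U x & \val U `<=` W.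
Proof.
move=> [_ _ [_ bX]] oW Wx.
have /bX[U [cU Ux] UW] : nbhs x W by exact: open_nbhs_nbhs.
by exists (set_elt cU).
Qed.

Section QuotientOpens.
Variable X : eqspace.
Hypothesis hX : is_ob StoneER X.

Lemma open_ideal_S_ideal (W : opens (qspace X)) :
  @S_ideal (clop_subalg X) [set U : clopens X | \val U `<=` @qproj X @^-1` \val W].
Proof.
have [sX cE] := hX; have [cX _ _] := sX; split=> /=.
- by [].
- by move=> U V UW VW x [/UW|/VW].
- by move=> U V /clopens_leP UV VW x /UV /VW.
- move=> U UW; have oW : open (@qproj X @^-1` \val W) by exact: (set_valP W).
  have [||V [cV EV VW]] := @clopen_between X (rel_image (eqsp_rel X) (\val U)) _ sX _ oW.
  + apply: closed_rel_image => //; apply: closed_compact => //; exact: clopens_closed.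
  + by move=> y [x /UW Wx /qprojP xy]; rewrite /preimage /= -xy.
  by exists (set_elt cV).
Qed.

Definition open_ideal (W : opens (qspace X)) : S_ideals (clop_subalg X) :=
  set_elt (open_ideal_S_ideal W).

Lemma open_idealP (W : opens (qspace X)) (U : clopens X) :
  \val (open_ideal W) U <-> forall x, \val U x -> \val W (qproj x).
Proof. by []. Qed.

Lemma open_ideal_le W W' : (open_ideal W <= open_ideal W')%O = (W <= W')%O.
Proof.
have [sX cE] := hX.
apply/S_ideals_leP/opens_leP => [WW' q|WW' U UW x /UW /WW' //].
have [x <-] := qproj_surj q => Wx.
have oW : open (@qproj X @^-1` \val W) by exact: (set_valP W).
have [U Ux UW] := clopens_cover sX oW Wx.
exact: (WW' U UW x Ux).
Qed.

(** By roundness the union of an S-ideal of clopens is saturated, and by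
    compactness the ideal contains every clopen included in its union. *)
Lemma open_ideal_surj J : exists W, open_ideal W = J.
Proof.
have [sX cE] := hX; have [cX _ _] := sX.
have [J0 Jj Jle Jr] := set_valP J.
pose V := \bigcup_(U in \val J) \val (U : clopens X).
have VE x y : V x -> eqsp_rel X (x, y) -> V y.
  move=> [U /Jr[U' [JU' UU']] Ux] xy; exists U' => //.
  by apply: UU'; exists x.
have piV : @qproj X @^-1` (@qproj X @` V) = V.
  apply/seteqP; split=> [x [y Vy /qprojP yx]|x Vx]; last by exists x.
  exact: VE Vy yx.
have oV : open (@qproj X @` V).
  by apply: open_qspace; rewrite piV; apply: bigcup_open => U _; exact: clopens_open.
exists (set_elt oV); apply/val_inj/seteqP; split=> U.
  move=> UV; have [|||||_ [W JW <-] UW] := @compact_directed X (\val (U : clopens X))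
      [set \val (W : clopens X) | W in \val J].
  - by apply: closed_compact => //; exact: clopens_closed.
  - by move=> _ [W _ <-]; exact: clopens_open.
  - by exists (\val (\bot%O : clopens X)); exists \bot%O.
  - move=> _ _ [W JW <-] [W' JW' <-]; exists (\val (W `|` W')%O) => //.
    by exists (W `|` W')%O => //; exact: Jj.
  - move=> x Ux; have : (@qproj X @^-1` (@qproj X @` V)) x by exact: UV.
    by rewrite piV => -[W JW Wx]; exists (\val W) => //; exists W.
  by apply: Jle JW; apply/clopens_leP.
by move=> JU x Ux; exists x => //; exists U.
Qed.

End QuotientOpens.

Lemma opens_quotient :
  nat_iso (functor_comp Ofun (op_functor Qfun)) (functor_comp Ifun (op_functor Clopfun)).
Proof.
exists (fun X hX => @open_ideal X hX); split=> [X hX|Y X hY hX R mR].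
  apply: frame_iso; [exact: open_ideal_le|exact: open_ideal_surj].
rewrite /= in R mR *; have [cR RE ER] := mR.
have [[sX cEX] [sY cEY]] := (hX, hY); have [cX _ _] := sX; have [cY _ _] := sY.
have mQ := fmor_mor Qfun_functor hX hY mR.
have mC := fmor_mor Clopfun_functor hX hY mR.
have [cQX _] := qspace_ob hX; have [cQY _] := qspace_ob hY.
apply/funext => W; apply/val_inj/seteqP; split=> U.
  move=> /open_idealP UW; apply/(ideal_preimageP _ _ mC).
  have oW : open (@qproj Y @^-1` \val W) by exact: (set_valP W).
  have cRU : closed (rel_image R (\val U)).
    apply: closed_rel_image => //; apply: closed_compact => //; exact: clopens_closed.
  have [|V [cV RV VW]] := @clopen_between Y _ _ sY cRU oW.
    move=> y [x /UW + xy] => /(box_valP _ _ cQY mQ); apply.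
    by exists y => //; exists x.
  by exists (set_elt cV).
move=> /(ideal_preimageP _ _ mC)[V VW UV]; apply/open_idealP => x Ux.
apply/(box_valP _ _ cQY mQ) => q [y [x' xx' x'y] yq].
rewrite -[q](yq : qproj y = q); apply: VW; apply: UV; exists x => //.
by rewrite -[X in X (x, y)]RE; exists x' => //; apply/qprojP.
Qed.

(** * Prime filters of boolean algebras *)

Section PrimeFilters.
Context {d : Order.disp_t} {B : ctbDistrLatticeType d}.
Implicit Types (a b c : B) (u F I : set B).

Record prime_filter u : Prop := PrimeFilter {
  prime_top : u \top%O;
  prime_bot : ~ u \bot%O;
  prime_meet : forall a b, u a -> u b -> u (a `&` b)%O;
  prime_up : forall a b, (a <= b)%O -> u a -> u b;
  prime_compl : forall a, u a \/ u (~` a)%O }.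

(** By Zorn's lemma there is a maximal filter that contains F and misses I.
    If it omitted both a and its complement, both enlargements would meet I,
    and so would the filter itself. *)
Lemma prime_filter_exists F I :
  F \top%O -> (forall a b, F a -> F b -> F (a `&` b)%O) ->
  (forall a b, (a <= b)%O -> F a -> F b) ->
  I \bot%O -> (forall a b, I a -> I b -> I (a `|` b)%O) ->
  (forall a b, (a <= b)%O -> I b -> I a) ->
  F `&` I `<=` set0 ->
  exists u, [/\ prime_filter u, F `<=` u & u `&` I `<=` set0].
Proof.
move=> F1 Fm Fle I0 Ij Ile FI0.
(* the last clause admits the empty set, which bounds the empty chain *)
pose P u := [/\ forall a b, u a -> u b -> u (a `&` b)%O,
  forall a b, (a <= b)%O -> u a -> u b, u `&` I `<=` set0 &
  forall a, u a -> F `<=` u].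
have [C CP Ctot|u [[um ule uI uF] umax]] := @Zorn_bigcup B P.
  split.
  - move=> a b [u Cu ua] [w Cw wb].
    have [uw|wu] := Ctot u w Cu Cw.
      by exists w => //; have [h _ _ _] := CP w Cw; apply: h => //; exact: uw.
    by exists u => //; have [h _ _ _] := CP u Cu; apply: h => //; exact: wu.
  - by move=> a b ab [u Cu ua]; exists u => //; have [_ h _ _] := CP u Cu; exact: h ab ua.
  - by move=> a [[u Cu ua] Ia]; have [_ _ h _] := CP u Cu; exact: (h a).
  - move=> a [u Cu ua] b Fb; exists u => //; have [_ _ _ h] := CP u Cu; exact: h ua b Fb.
have Fu : F `<=` u.
  move=> b Fb; apply: contrapT => nub; apply: (umax F).
    split=> [a ua|Fu]; last by apply: nub; exact: Fu.
    by exfalso; apply: nub; exact: uF ua b Fb.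
  by split=> // a _ c.
have u1 : u \top%O by exact: Fu.
have u0 : ~ u \bot%O by move=> u0; exact: (uI \bot%O).
exists u; split=> //; split=> //.
have ext a : ~ u a -> exists2 x, u x & I (x `&` a)%O.
  move=> nua; apply: contrapT => h.
  pose w := [set b | exists2 x, u x & (x `&` a <= b)%O].
  apply: (umax w).
    split=> [b ub|wu]; first by exists b => //; exact: leIl.
    by apply: nua; apply: wu; exists \top%O => //; rewrite meet1x.
  split.
  - move=> b c [x ux xb] [y uy yc]; exists (x `&` y)%O; first exact: um.
    rewrite lexI (le_trans _ xb) ?(le_trans _ yc) //.
      by rewrite leI2 // leIr.
    by rewrite leI2 // leIl.
  - by move=> b c bc [x ux xb]; exists x => //; exact: le_trans xb bc.
  - by move=> b [[x ux xb] Ib]; apply: h; exists x => //; exact: Ile xb Ib.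
  - by move=> _ _ b Fb; exists b; [exact: Fu|exact: leIl].
move=> a; apply: contrapT => /not_orP[/ext[x ux Ix] /ext[y uy Iy]].
apply: (uI (x `&` y)%O); split; first exact: um.
apply: Ile (Ij _ _ Ix Iy); rewrite -[leLHS]meetx1 -(joinxC a) meetUr.
by apply: leU2; apply: leI2 => //; [exact: leIl|exact: leIr].
Qed.

End PrimeFilters.

(** * Semantics of the terms of K(B) *)

Definition set_rep d (B : ctbDistrLatticeType d) (X : Type) (v : B -> set X) :=
  [/\ v \bot%O = set0, v \top%O = setT,
      forall a b, v (a `&` b)%O = v a `&` v b &
      forall a b, v (a `|` b)%O = v a `|` v b].

Section TermSemantics.
Context {d : Order.disp_t} {B : ctbDistrLatticeType d} {X : Type}.
Variable v : B -> set X.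
Hypothesis hv : set_rep v.
Implicit Types (F : set X) (s t : kterm B) (x y : kalg B).

(** The clauses that define the basic clopens of the Vietoris space, read for
    an arbitrary set of points. *)
Fixpoint sat F t : Prop :=
  match t with
  | TBox a => F `<=` v a
  | TDia a => F `&` v a !=set0
  | TBot => False
  | TTop => True
  | TMeet s t => sat F s /\ sat F t
  | TJoin s t => sat F s \/ sat F t
  | TCompl s => ~ sat F s
  end.

Lemma sat_keq F s t : keq s t -> (sat F s <-> sat F t).
Proof.
have [v0 v1 vI vU] := hv.
elim=> {s t} /=; try tauto.
- by move=> s; split=> //; case: (pselect (sat F s)); [left|right].
- by rewrite v1.
- by rewrite v0 setI0; split=> // -[].
- by move=> a b; rewrite vI subsetI.
- by move=> a b; rewrite vU setIUr; split=> [[x [Fa|Fb]]|[[x h]|[x h]]];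
    [left; exists x|right; exists x|exists x; left|exists x; right].
- move=> a b; rewrite vU; split=> [[]//|Fab]; split=> //.
  case: (pselect (F `&` v b !=set0)); [by right|move=> n; left=> x Fx].
  by case: (Fab x Fx) => // vb; exfalso; apply: n; exists x.
- move=> a b; rewrite vI; split=> [[]//|[Fa [x [Fx vb]]]]; split.
    by split=> //; exists x.
  by exists x; split=> //; split=> //; exact: Fa.
Qed.

Definition ksat F x : Prop := sat F (repr x).

Lemma ksat_pi F t : ksat F (kpi t) <-> sat F t.
Proof. exact: sat_keq (keq_repr t). Qed.

Lemma ksat0 F : ~ ksat F \bot%O.
Proof. by move/(ksat_pi F TBot). Qed.

Lemma ksat1 F : ksat F \top%O.
Proof. exact/(ksat_pi F TTop). Qed.

Lemma ksatI F x y : ksat F (x `&` y)%O <-> ksat F x /\ ksat F y.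
Proof. exact: (ksat_pi F (TMeet _ _)). Qed.

Lemma ksatU F x y : ksat F (x `|` y)%O <-> ksat F x \/ ksat F y.
Proof. exact: (ksat_pi F (TJoin _ _)). Qed.

Lemma ksat_box F a : ksat F (kbox a) <-> F `<=` v a.
Proof. exact: (ksat_pi F (TBox a)). Qed.

Lemma ksat_dia F a : ksat F (kdia a) <-> F `&` v a !=set0.
Proof. exact: (ksat_pi F (TDia a)). Qed.

Lemma ksat_le F x y : (x <= y)%O -> ksat F x -> ksat F y.
Proof. by rewrite leEmeet => /eqP <- /ksatI[]. Qed.

Lemma ksat_joins F (I : eqType) (s : seq I) (f : I -> kalg B) :
  ksat F (\join_(i <- s) f i)%O <-> exists2 i, i \in s & ksat F (f i).
Proof.
elim: s => [|i s IHs]; first by rewrite big_nil; split=> [/ksat0|[]].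
rewrite big_cons; split=> [/ksatU[h|/IHs[j js h]]|[j]].
- by exists i; rewrite // inE eqxx.
- by exists j; rewrite // inE js orbT.
- rewrite inE => /predU1P[->|js] h; apply/ksatU; [by left|right].
  by apply/IHs; exists j.
Qed.

Lemma ksat_meets F (I : eqType) (s : seq I) (f : I -> kalg B) :
  ksat F (\meet_(i <- s) f i)%O <-> forall i, i \in s -> ksat F (f i).
Proof.
elim: s => [|i s IHs]; first by rewrite big_nil; split=> // _; exact: ksat1.
rewrite big_cons; split=> [/ksatI[h /IHs hs] j|h].
  by rewrite inE => /predU1P[->|/hs].
apply/ksatI; split; first by apply: h; rewrite inE eqxx.
by apply/IHs => j js; apply: h; rewrite inE js orbT.
Qed.

End TermSemantics.

(** * Normal forms *)

Section NormalForms.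
Context {d : Order.disp_t} {B : ctbDistrLatticeType d}.
Implicit Types (a b : B) (x y : kalg B) (bs : seq B).

Lemma kboxT : kbox (\top : B)%O = \top%O.
Proof. by apply/kpiP; exact: keq_box1. Qed.

Lemma kdia0 : kdia (\bot : B)%O = \bot%O.
Proof. by apply/kpiP; exact: keq_dia0. Qed.

Lemma kboxI a b : kbox (a `&` b)%O = (kbox a `&` kbox b)%O.
Proof. by rewrite -[RHS]kpi_meet; apply/kpiP; exact: keq_boxI. Qed.

Lemma kdiaU a b : kdia (a `|` b)%O = (kdia a `|` kdia b)%O.
Proof. by rewrite -[RHS]kpi_join; apply/kpiP; exact: keq_diaU. Qed.

Lemma kboxU_le a b : (kbox (a `|` b) <= kbox a `|` kdia b)%O.
Proof.
rewrite leEmeet; apply/eqP.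
rewrite -[(kbox a `|` kdia b)%O]kpi_join -[LHS]kpi_meet.
by apply/kpiP; exact: keq_boxU_le.
Qed.

Lemma kdiaI_le a b : (kbox a `&` kdia b <= kdia (a `&` b))%O.
Proof.
rewrite leEmeet; apply/eqP.
rewrite -[(kbox a `&` kdia b)%O]kpi_meet -[LHS]kpi_meet.
by apply/kpiP; exact: keq_diaI_le.
Qed.

Lemma kbox_le a b : (a <= b)%O -> (kbox a <= kbox b)%O.
Proof. by rewrite !leEmeet => /eqP ab; rewrite -kboxI ab. Qed.

Lemma kdia_le a b : (a <= b)%O -> (kdia a <= kdia b)%O.
Proof. by rewrite leEjoin => /eqP <-; rewrite kdiaU leUl. Qed.

Lemma eq_compl x y : (x `&` y = \bot)%O -> (x `|` y = \top)%O -> (~` x)%O = y.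
Proof.
move=> xy0 xy1; rewrite -[LHS]meetx1 -xy1 meetUr meetCx join0x.
by rewrite -[RHS]meet1x -(joinCx x) meetUl xy0 joinx0.
Qed.

Lemma compl_kbox a : (~` kbox a)%O = kdia (~` a)%O.
Proof.
apply: eq_compl; apply/eqP.
  by rewrite -lex0 -kdia0 -(meetxC a) kdiaI_le.
by rewrite -le1x -kboxT -(joinxC a) kboxU_le.
Qed.

Lemma compl_kdia a : (~` kdia a)%O = kbox (~` a)%O.
Proof. by rewrite -[RHS]complK compl_kbox complK. Qed.

Definition has_dnf x := exists2 D : seq (B * seq B), is_dnf D & x = dnf_val D.
Definition has_cnf x := exists2 C : seq (B * seq B), is_cnf C & x = cnf_val C.

Lemma has_dnf_bot : has_dnf \bot%O.
Proof. by exists [::] => //; rewrite /dnf_val big_nil. Qed.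

Lemma has_dnfU x y : has_dnf x -> has_dnf y -> has_dnf (x `|` y)%O.
Proof.
move=> [D hD ->] [D' hD' ->]; exists (D ++ D'); last by rewrite /dnf_val big_cat.
by move=> p; rewrite mem_cat => /orP[/hD|/hD'].
Qed.

(** Relativizing the diamonds to the box enforces the constraints of a normal
    form; if some relativized diamond vanishes, so does the conjunction. *)
Lemma has_dnf_conj a bs : has_dnf (kbox a `&` \meet_(b <- bs) kdia b)%O.
Proof.
have -> : (kbox a `&` \meet_(b <- bs) kdia b =
           kbox a `&` \meet_(b <- [seq (a `&` b)%O | b <- bs]) kdia b)%O.
  elim: bs => [|b bs IHs] /=; first by rewrite !big_nil.
  rewrite !big_cons [LHS]meetCA IHs [LHS]meetCA !meetA; congr (_ `&` _)%O.
  apply/eqP; rewrite eq_le !lexI !leIl kdiaI_le /=.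
  by apply: le_trans (leIr _ _) _; exact: kdia_le (leIr _ _).
have [z|nz] := boolP (\bot%O \in [seq (a `&` b)%O | b <- bs]).
  rewrite (_ : (_ `&` _)%O = \bot%O); first exact: has_dnf_bot.
  apply/eqP; rewrite -lex0 -kdia0; apply: le_trans (leIr _ _) _.
  exact: meets_inf_seq z isT.
exists [:: (a, [seq (a `&` b)%O | b <- bs])].
  move=> p; rewrite inE => /eqP -> b /= bs'; split.
    by move=> b0; move: nz; rewrite -b0 bs'.
  by have /mapP[c _ ->] := bs'; exact: leIl.
by rewrite /dnf_val big_seq1.
Qed.

Lemma has_dnf_box a : has_dnf (kbox a).
Proof. by have := has_dnf_conj a [::]; rewrite big_nil meetx1. Qed.

Lemma has_dnf_dia b : has_dnf (kdia b).
Proof. by have := has_dnf_conj \top%O [:: b]; rewrite big_seq1 kboxT meet1x. Qed.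

Lemma has_dnf_top : has_dnf \top%O.
Proof. by rewrite -kboxT; exact: has_dnf_box. Qed.

(** Distributing the meet leaves conjunctions with a single box, because boxes
    preserve meets. *)
Lemma has_dnfI x y : has_dnf x -> has_dnf y -> has_dnf (x `&` y)%O.
Proof.
move=> [D _ ->] [D' _ ->].
elim: D => [|p D IHD].
  by rewrite {1}/dnf_val big_nil meet0x; exact: has_dnf_bot.
rewrite {1}/dnf_val big_cons -/(dnf_val D) meetUl; apply: has_dnfU IHD.
elim: D' => [|q D' IHD'].
  by rewrite /dnf_val big_nil meetx0; exact: has_dnf_bot.
rewrite /dnf_val big_cons -/(dnf_val D') meetUr; apply: has_dnfU IHD'.
by rewrite meetACA -kboxI -big_cat; exact: has_dnf_conj.
Qed.

Lemma has_dnfC x : has_dnf x -> has_dnf (~` x)%O.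
Proof.
move=> [D _ ->]; rewrite /dnf_val compl_joins.
elim: D => [|p D IHD]; first by rewrite big_nil; exact: has_dnf_top.
rewrite big_cons; apply: has_dnfI IHD.
rewrite complI compl_kbox; apply: has_dnfU; first exact: has_dnf_dia.
elim: p.2 => [|b bs IHs]; first by rewrite big_nil compl1; exact: has_dnf_bot.
by rewrite big_cons complI compl_kdia; apply: has_dnfU IHs; exact: has_dnf_box.
Qed.

Lemma has_dnfP x : has_dnf x.
Proof.
have [t ->] := kpi_surj x; elim: t => [a|a|||s hs t ht|s hs t ht|s hs].
- exact: has_dnf_box.
- exact: has_dnf_dia.
- exact: has_dnf_bot.
- exact: has_dnf_top.
- by rewrite kpi_meet; exact: has_dnfI.
- by rewrite kpi_join; exact: has_dnfU.
- by rewrite kpi_compl; exact: has_dnfC.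
Qed.

(** The complement of a disjunctive normal form of the complement of x is a
    conjunctive normal form of x. *)
Lemma has_cnfP x : has_cnf x.
Proof.
have [D hD xD] := has_dnfP (~` x)%O.
exists [seq (~` p.1, [seq ~` b | b <- p.2])%O | p <- D].
  move=> _ /mapP[p pD ->] _ /mapP[b bp ->] /=; have [b0 bp1] := hD p pD b bp.
  by split; [rewrite leC|rewrite -compl0 => /(can_inj (@complK _ _))].
rewrite -[x]complK xD /dnf_val compl_joins /cnf_val big_map.
apply: eq_bigr => p _; rewrite complI compl_kbox compl_meets big_map.
by congr (_ `|` _)%O; apply: eq_bigr => b _; exact: compl_kdia.
Qed.

End NormalForms.

(** * The subordination K(S) *)

Section BigSubordination.
Context {d d' : Order.disp_t}.
Context {A : ctbDistrLatticeType d} {B : ctbDistrLatticeType d'}.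
Variable T : set (A * B).
Hypothesis hT : subordination T.

Lemma sub_joins (I : eqType) (s : seq I) (f : I -> A) y :
  (forall i, i \in s -> T (f i, y)) -> T (\join_(i <- s) f i, y)%O.
Proof.
have [[T00 _] Tj _ Tle] := hT; elim: s => [|i s IHs] h.
  by rewrite big_nil; exact: Tle (lexx _) T00 (le0x _).
rewrite big_cons; apply: Tj; first by apply: h; rewrite inE eqxx.
by apply: IHs => j js; apply: h; rewrite inE js orbT.
Qed.

Lemma sub_meets (I : eqType) (s : seq I) x (f : I -> B) :
  (forall i, i \in s -> T (x, f i)) -> T (x, \meet_(i <- s) f i)%O.
Proof.
have [[_ T11] _ Tm Tle] := hT; elim: s => [|i s IHs] h.
  by rewrite big_nil; exact: Tle (lex1 _) T11 (lexx _).
rewrite big_cons; apply: Tm; first by apply: h; rewrite inE eqxx.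
by apply: IHs => j js; apply: h; rewrite inE js orbT.
Qed.

End BigSubordination.

Section KRelation.
Context {d d' : Order.disp_t}.
Context {A : ctbDistrLatticeType d} {B : ctbDistrLatticeType d'}.
Variable S : set (A * B).

(** A disjunct lies below its box and its diamonds and a conjunct lies above
    its diamond and its boxes, so one related pair of each suffices. *)
Lemma nf_sub (T : set (kalg A * kalg B)) (D : seq (A * seq A)) (C : seq (B * seq B)) :
  subordination T ->
  (forall a c, S (a, c) -> T (kbox a, kbox c)) ->
  (forall a c, S (a, c) -> T (kdia a, kdia c)) ->
  (forall p q, p \in D -> q \in C ->
     (exists2 e, e \in q.2 & S (p.1, e)) \/ (exists2 b, b \in p.2 & S (b, q.1))) ->
  T (dnf_val D, cnf_val C).
Proof.
move=> sT Tbox Tdia h; have [_ _ _ Tle] := sT.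
apply: sub_joins => // p pD; apply: sub_meets => // q qC.
have [[e eq pe]|[b bp bq]] := h p q pD qC.
  apply: (Tle _ _ _ _ (leIl _ _) (Tbox _ _ pe)).
  by apply: le_trans (leUr _ _); exact: (joins_sup_seq _ eq).
apply: (Tle _ _ _ _ _ (Tdia _ _ bq) (leUl _ _)).
by apply: le_trans (leIr _ _) _; exact: (meets_inf_seq _ bp).
Qed.

(** The normal forms only serve to combine related boxes and related diamonds. *)
Lemma kalg_rel_min (T : set (kalg A * kalg B)) :
  subordination T ->
  (forall a c, S (a, c) -> T (kbox a, kbox c)) ->
  (forall a c, S (a, c) -> T (kdia a, kdia c)) ->
  kalg_rel S `<=` T.
Proof.
move=> sT Tbox Tdia [x y] h; apply: h; split=> // -[{}x {}y].
move=> [[D [C [/= _ -> _ -> h]]]|[D [C [/= _ -> _ -> h]]]].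
  by apply: nf_sub => // p q pD qC; left; exact: h.
by apply: nf_sub => // p q pD qC; right; exact: h.
Qed.

(** The top element is treated apart because normal forms exclude its box. *)
Lemma kalg_rel_box a c : S (a, c) -> kalg_rel S (kbox a, kbox c).
Proof.
move=> ac; have [[_ T1] _ _ Tle] := kalg_rel_subordination S.
have [->|/eqP c1] := eqVneq c \top%O; first by rewrite kboxT; exact: Tle (lex1 _) T1 (lexx _).
move=> T [_]; apply; left; exists [:: (a, [::])], [:: (\bot%O, [:: c])]; split.
- by move=> p; rewrite inE => /eqP ->.
- by rewrite /dnf_val big_seq1 big_nil meetx1.
- move=> q; rewrite inE => /eqP -> e; rewrite inE => /eqP -> /=.
  by split=> //; exact: le0x.
- by rewrite /cnf_val !big_seq1 kdia0 join0x.
- move=> p q; rewrite !inE => /eqP -> /eqP ->; exists c => //.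
  by rewrite inE eqxx.
Qed.

Lemma kalg_rel_dia a c : S (a, c) -> kalg_rel S (kdia a, kdia c).
Proof.
move=> ac; have [[T0 _] _ _ Tle] := kalg_rel_subordination S.
have [->|/eqP a0] := eqVneq a \bot%O; first by rewrite kdia0; exact: Tle (lexx _) T0 (le0x _).
move=> T [_]; apply; right; exists [:: (\top%O, [:: a])], [:: (c, [::])]; split.
- move=> p; rewrite inE => /eqP -> b; rewrite inE => /eqP -> /=.
  by split=> //; exact: lex1.
- by rewrite /dnf_val !big_seq1 kboxT meet1x.
- by move=> q; rewrite inE => /eqP ->.
- by rewrite /cnf_val big_seq1 big_nil joinx0.
- move=> p q; rewrite !inE => /eqP -> /eqP ->; exists a => //.
  by rewrite inE eqxx.
Qed.

End KRelation.

(** * Semantics of K(S) *)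

(** The Egli-Milner lifting of a relation to arbitrary sets of points. *)
Definition egli (X Y : Type) (R : set (X * Y)) (F : set X) (G : set Y) :=
  G `<=` rel_image R F /\ F `<=` rel_image R^† G.

Lemma egli_comp (X Y Z : Type) (T : set (Y * Z)) (R : set (X * Y)) F H :
  egli (T ⊚ R) F H -> exists G, egli R F G /\ egli T G H.
Proof.
move=> [HF FH]; exists (rel_image R F `&` rel_image T^† H); split; split.
- by move=> y [].
- move=> x /[dup] Fx /FH[z Hz [y xy yz]]; exists y => //.
  by split; [exists x|exists z].
- move=> z /[dup] Hz /HF[x Fx [y xy yz]]; exists y => //.
  by split; [exists x|exists z].
- by move=> y [].
Qed.

(** Finitely many choices made at once, from a type without decidable equality. *)
Lemma finite_choice (I : eqType) (Z : Type) (s : seq I) (P : I -> Z -> Prop) :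
  (forall i, i \in s -> exists z, P i z) ->
  exists L : set Z, [/\ finite_set L,
    forall z, L z -> exists2 i, i \in s & P i z &
    forall i, i \in s -> exists2 z, L z & P i z].
Proof.
elim: s => [|i s IHs] h; first by exists set0; split.
have [|L [fL LP PL]] := IHs; first by move=> j js; apply: h; rewrite inE js orbT.
have [|z iz] := h i; first by rewrite inE eqxx.
exists (z |` L); split; first by rewrite finite_setU.
  move=> u [->|/LP[j js ju]]; first by exists i; rewrite ?inE ?eqxx.
  by exists j; rewrite // inE js orbT.
move=> j; rewrite inE => /predU1P[->|/PL[w Lw jw]]; first by exists z => //; left.
by exists w => //; right.
Qed.

Section KSemantics.
Context {d d' : Order.disp_t}.
Context {A : ctbDistrLatticeType d} {B : ctbDistrLatticeType d'}.
Context {X Y : Type} (v : A -> set X) (w : B -> set Y).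
Variables (S : set (A * B)) (R : set (X * Y)).
Hypotheses (hv : set_rep v) (hw : set_rep w).
Hypothesis SR : forall a c, S (a, c) <-> rel_image R (v a) `<=` w c.

Lemma kalg_rel_sound x y F G :
  kalg_rel S (x, y) -> egli R F G -> ksat v F x -> ksat w G y.
Proof.
move=> xy [GF FG].
apply: (kalg_rel_min (T := [set xy | ksat v F xy.1 -> ksat w G xy.2])) xy => //=.
- split=> /=.
  + by split=> [/(ksat0 hv)|_]; last exact: ksat1.
  + by move=> a b c ac bc /(ksatU hv)[/ac|/bc].
  + by move=> a b c ab ac Fa; apply/(ksatI hw); split; [exact: ab|exact: ac].
  + by move=> a b c e ab bc ce /(ksat_le hv ab)/bc; exact: ksat_le.
- move=> a c /SR ac /(ksat_box hv) Fa; apply/(ksat_box hw) => y' /GF[x' Fx xy].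
  by apply: ac; exists x' => //; exact: Fa.
- move=> a c /SR ac /(ksat_dia hv)[x' [Fx ax]]; apply/(ksat_dia hw).
  by have [y' Gy xy] := FG x' Fx; exists y'; split=> //; apply: ac; exists x'.
Qed.

(** A disjunct of x and a conjunct of y that are related by neither boxes nor
    diamonds leave room for finitely many related pairs of points that refute
    the conjunct while satisfying the disjunct. *)
Lemma kalg_rel_complete x y :
  (forall F G, finite_set F -> finite_set G ->
     egli R F G -> ksat v F x -> ksat w G y) ->
  kalg_rel S (x, y).
Proof.
have wle a b : (a <= b)%O -> w a `<=` w b.
  by have [_ _ wI _] := hw; rewrite leEmeet => /eqP <-; rewrite wI => z [].
have vle a b : (a <= b)%O -> v a `<=` v b.
  by have [_ _ vI _] := hv; rewrite leEmeet => /eqP <-; rewrite vI => z [].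
have [[D hD ->] [C hC ->]] := (has_dnfP x, has_cnfP y) => h.
apply: (@nf_sub _ _ A B S) => //; first exact: kalg_rel_subordination.
- exact: kalg_rel_box.
- exact: kalg_rel_dia.
move=> p q pD qC; apply: contrapT => /not_orP[nbox ndia].
have [e eq|L1 [fL1 LP1 PL1]] := @finite_choice _ (X * Y)%type q.2
    (fun e xy => [/\ v p.1 xy.1, R xy & ~ w e xy.2]).
  apply: contrapT => n; apply: nbox; exists e => //; apply/SR => y' [x' ax xy].
  by apply: contrapT => nw; apply: n; exists (x', y').
have [b bp|L2 [fL2 LP2 PL2]] := @finite_choice _ (X * Y)%type p.2
    (fun b xy => [/\ v b xy.1, R xy & ~ w q.1 xy.2]).
  apply: contrapT => n; apply: ndia; exists b => //; apply/SR => y' [x' ax xy].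
  by apply: contrapT => nw; apply: n; exists (x', y').
pose L := L1 `|` L2; have fL : finite_set L by rewrite finite_setU.
have LP z : L z -> [/\ v p.1 z.1, R z & ~ w q.1 z.2].
  case=> [/LP1[e eq [vp Rz ne]]|/LP2[b bp [vb Rz nq]]]; split=> //.
    by move=> wq; apply: ne; apply: wle wq; have [] := hC q qC e eq.
  by apply: vle vb; have [] := hD p pD b bp.
have LR : egli R (fst @` L) (snd @` L).
  split=> [_ [z Lz <-]|_ [z Lz <-]].
    by exists z.1; [exists z|have [_ + _] := LP z Lz; case: (z)].
  by exists z.2; [exists z|have [_ + _] := LP z Lz; case: (z)].
have Lx : ksat v (fst @` L) (dnf_val D).
  apply/(ksat_joins hv); exists p => //; apply/(ksatI hv); split.
    by apply/(ksat_box hv) => _ [z /LP[+ _ _] <-].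
  apply/(ksat_meets hv) => b bp; apply/(ksat_dia hv).
  by have [z Lz [vb _ _]] := PL2 b bp; exists z.1; split=> //; exists z => //; right.
have := h _ _ (finite_image _ fL) (finite_image _ fL) LR Lx.
move=> /(ksat_meets hw)/(_ q qC)/(ksatU hw)[/(ksat_dia hw)[_ [[z /LP[_ _ nq] <-] wq]]|].
  exact: nq wq.
move=> /(ksat_joins hw)[e eq /(ksat_box hw) Ge].
have [z Lz [_ _ ne]] := PL1 e eq; apply/ne/Ge; exists z => //; left.
exact: Lz.
Qed.


End KSemantics.

(** * Points of abstract boolean algebras *)

Definition points d (B : ctbDistrLatticeType d) := {u : set B | prime_filter u}.

Definition points_at d (B : ctbDistrLatticeType d) (b : B) : set (points B) :=
  [set u | sval u b].

Lemma points_rep d (B : ctbDistrLatticeType d) : set_rep (@points_at _ B).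
Proof.
split.
- by apply/seteqP; split=> // -[u hu] /= /(prime_bot hu).
- by apply/seteqP; split=> // -[u hu] _; exact: prime_top.
- move=> a b; apply/seteqP; split=> -[u hu] /=.
    by move=> uab; split; apply: (prime_up hu) uab; [exact: leIl|exact: leIr].
  by move=> [ua ub]; exact: prime_meet.
- move=> a b; apply/seteqP; split=> -[u hu] /=; last first.
    by move=> [] h; apply: (prime_up hu) h; [exact: leUl|exact: leUr].
  move=> uab; have [ua|uca] := prime_compl hu a; [by left|right].
  apply: (prime_up hu) (prime_meet hu uca uab).
  by rewrite meetUr meetCx join0x leIr.
Qed.

Lemma prime_notU d (B : ctbDistrLatticeType d) (u : set B) a b :
  prime_filter u -> ~ u a -> ~ u b -> ~ u (a `|` b)%O.
Proof.
move=> hu na nb uab; have [//|uca] := prime_compl hu a; apply: nb.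
apply: (prime_up hu) (prime_meet hu uca uab).
by rewrite meetUr meetCx join0x leIr.
Qed.

Section DualRelation.
Context {d1 d2 : Order.disp_t}.
Context {A : ctbDistrLatticeType d1} {B : ctbDistrLatticeType d2}.

Definition dual_rel (S : set (A * B)) : set (points A * points B) :=
  [set uw | forall a c, sval uw.1 a -> S (a, c) -> sval uw.2 c].

(** If a S c fails, there is a prime filter w containing everything to which a
    is S-related but not c, and then a prime filter u containing a and disjoint
    from the ideal of elements S-related to something outside w. *)
Lemma dual_relP (S : set (A * B)) : subordination S ->
  forall a c, S (a, c) <-> rel_image (dual_rel S) (points_at a) `<=` points_at c.
Proof.
move=> [[S00 S11] Sj Sm Sle] a c; split=> [ac w [u ua uw]|]; first exact: uw ua ac.
move=> ac; apply: contrapT => nac.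
have [|||||||w [hw Sw wc]] := @prime_filter_exists _ B
    [set e | S (a, e)] [set e | (e <= c)%O].
- exact: Sle (lex1 _) S11 (lexx _).
- by move=> x y; exact: Sm.
- by move=> x y xy ax; exact: Sle (lexx _) ax xy.
- exact: le0x.
- by move=> x y /= xc yc; rewrite leUx xc.
- by move=> x y /= xy; exact: le_trans.
- by move=> x [/= ax xc]; apply: nac; exact: Sle (lexx _) ax xc.
have nwc : ~ w c by move=> h; apply: (wc c); split=> //=.
have [|||||||u [hu au uI]] := @prime_filter_exists _ A
    [set x | (a <= x)%O] [set x | exists2 e, ~ w e & S (x, e)].
- exact: lex1.
- by move=> x y /= ax ay; rewrite lexI ax.
- by move=> x y /= xy ax; exact: le_trans ax xy.
- by exists \bot%O => //; exact: prime_bot.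
- move=> x y [e ne xe] [f nf yf]; exists (e `|` f)%O; first exact: prime_notU.
  apply: Sj; [exact: Sle (lexx _) xe (leUl _ _)|exact: Sle (lexx _) yf (leUr _ _)].
- by move=> x y xy [e ne ye]; exists e => //; exact: Sle xy ye (lexx _).
- by move=> x [/= ax [e ne xe]]; apply: ne; apply: Sw; exact: Sle ax xe (lexx _).
apply: nwc; apply: (ac (exist _ w hw)); exists (exist _ u hu); first exact: (au a (lexx a)).
move=> x e /= ux xe; apply: contrapT => ne; apply: (uI x); split=> //.
by exists e.
Qed.

End DualRelation.

Section KRelationComposition.
Context {d1 d2 d3 : Order.disp_t}.
Context {A : ctbDistrLatticeType d1} {B : ctbDistrLatticeType d2}.
Context {C : ctbDistrLatticeType d3}.

(** The middle prime filter separates the filter generated by u along S from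
    the ideal of the elements T-related to something outside w. *)
Lemma dual_rel_comp (T : set (B * C)) (S : set (A * B)) :
  subordination T -> subordination S ->
  dual_rel (T ⊚ S) `<=` dual_rel T ⊚ dual_rel S.
Proof.
move=> [[T00 T11] Tj Tm Tle] [[S00 S11] Sj Sm Sle] [[u hu] [w hw]] uw.
have [|||||||m [hm Sm' mI]] := @prime_filter_exists _ B
    [set b | exists2 a, u a & S (a, b)] [set b | exists2 c, ~ w c & T (b, c)].
- by exists \top%O => //; exact: (prime_top hu).
- move=> x y [a ua ax] [b ub bY]; exists (a `&` b)%O; first exact: (prime_meet hu).
  by apply: Sm; [exact: Sle (leIl _ _) ax (lexx _)|exact: Sle (leIr _ _) bY (lexx _)].
- by move=> x y xy [a ua ax]; exists a => //; exact: Sle (lexx _) ax xy.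
- by exists \bot%O => //; exact: (prime_bot hw).
- move=> x y [e ne xe] [f nf yf]; exists (e `|` f)%O; first exact: (prime_notU hw).
  apply: Tj; [exact: Tle (lexx _) xe (leUl _ _)|exact: Tle (lexx _) yf (leUr _ _)].
- by move=> x y xy [e ne ye]; exists e => //; exact: Tle xy ye (lexx _).
- by move=> b [[a ua ab] [c nc bc]]; apply: nc; apply: (uw a) => //; exists b.
exists (exist _ m hm) => [a b ua ab|b c mb bc] /=; first by apply: Sm'; exists a.
by apply: contrapT => nc; apply: (mI b); split=> //; exists c.
Qed.

(** One inclusion holds on boxes and diamonds.  For the other, the middle
    element y has two unrelated normal forms, one for each factor; the
    semantics does not see them, and the semantic condition composes. *)
Lemma kalg_rel_comp (T : set (B * C)) (S : set (A * B)) :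
  subordination T -> subordination S ->
  kalg_rel (T ⊚ S) = kalg_rel T ⊚ kalg_rel S.
Proof.
move=> hT hS; apply/seteqP; split.
  apply: kalg_rel_min.
  - by apply: subordination_comp; exact: kalg_rel_subordination.
  - by move=> a c [b ab bc]; exists (kbox b); exact: kalg_rel_box.
  - by move=> a c [b ab bc]; exists (kdia b); exact: kalg_rel_dia.
move=> [x z] [y xy yz].
have rA := @points_rep _ A; have rB := @points_rep _ B; have rC := @points_rep _ C.
have TS := subordination_comp hT hS.
apply: (kalg_rel_complete rA rC (dual_relP TS)) => F H _ _ [HF FH].
have [|G [FG GH]] := @egli_comp _ _ _ (dual_rel T) (dual_rel S) F H.
  split=> [w /HF[u Fu uw]|u /FH[w Hw uw]].
    by exists u => //; exact: dual_rel_comp.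
  by exists w => //; exact: dual_rel_comp.
move=> Fx; apply: (kalg_rel_sound rB rC (dual_relP hT) yz GH).
exact: (kalg_rel_sound rA rB (dual_relP hS) xy FG).
Qed.

End KRelationComposition.

(** * The functor K *)

Lemma kalg_rel_le d (B : ctbDistrLatticeType d) (S : set (B * B)) x y :
  (forall a b, S (a, b) -> (a <= b)%O) -> kalg_rel S (x, y) -> (x <= y)%O.
Proof.
move=> S5; apply: (kalg_rel_min (T := [set xy | (xy.1 <= xy.2)%O])) => //=.
- split=> /=; first by [].
  + by move=> a b c ac bc; rewrite leUx ac.
  + by move=> a b c ab ac; rewrite lexI ab.
  + by move=> a b c e ab bc ce; exact: le_trans ab (le_trans bc ce).
- by move=> a c /S5; exact: kbox_le.
- by move=> a c /S5; exact: kdia_le.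
Qed.

Lemma kalg_rel_compl d (B : ctbDistrLatticeType d) (S : set (B * B)) x y :
  (forall a b, S (a, b) -> S (~` b, ~` a)%O) ->
  kalg_rel S (x, y) -> kalg_rel S (~` y, ~` x)%O.
Proof.
move=> S6; have [[K0 K1] Kj Km Kle] := kalg_rel_subordination S.
apply: (kalg_rel_min (T := [set xy | kalg_rel S (~` xy.2, ~` xy.1)%O])) => //=.
- split=> /=; first by rewrite compl0 compl1.
  + by move=> a b c ac bc; rewrite complU; exact: Km.
  + by move=> a b c ab ac; rewrite complI; exact: Kj.
  + by move=> a b c e ab bc ce; apply: Kle bc _; rewrite leC.
- by move=> a c /S6 ac; rewrite !compl_kbox; exact: kalg_rel_dia.
- by move=> a c /S6 ac; rewrite !compl_kdia; exact: kalg_rel_box.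
Qed.

Lemma kalg_rel_S5 (B : subalg) :
  is_ob SubS5S B -> S5_subordination (kalg_rel (subalg_rel B)).
Proof.
move=> hB; have [S5 S6 S7] := hB; split.
- by move=> a b; exact: kalg_rel_le.
- by move=> a b; exact: kalg_rel_compl.
- move=> a b; rewrite -{1}(subalg_rel_idem hB).
  rewrite kalg_rel_comp; try exact: subalg_subordination.
  by move=> [c ac cb]; exists c.
Qed.

Lemma Kfun_functor : is_functor Kfun.
Proof.
split.
- by move=> B hB; exact: kalg_rel_S5.
- move=> A B T hA hB [sT TA BT].
  have [sA sB] := (@subalg_subordination A, @subalg_subordination B).
  split; first exact: kalg_rel_subordination.
    rewrite -[LHS]/(kalg_rel T ⊚ kalg_rel (subalg_rel A)) -kalg_rel_comp //.
    by congr kalg_rel.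
  rewrite -[LHS]/(kalg_rel (subalg_rel B) ⊚ kalg_rel T) -kalg_rel_comp //.
  by congr kalg_rel.
- by [].
- by move=> A B C T S _ _ _ [sT _ _] [sS _ _]; exact: kalg_rel_comp.
Qed.

(** * Clopens of the Vietoris space *)

(** A surjective homomorphism that preserves and reflects the subordinations
    is an isomorphism, although it need not be injective. *)
Lemma subalg_iso_surj (A B : subalg) (f : B -> A) :
  is_ob SubS5S A ->
  f \bot%O = \bot%O -> f \top%O = \top%O ->
  (forall x y, f (x `&` y)%O = (f x `&` f y)%O) ->
  (forall x y, f (x `|` y)%O = (f x `|` f y)%O) ->
  (forall a, exists x, f x = a) ->
  (forall x y, subalg_rel B (x, y) <-> subalg_rel A (f x, f y)) ->
  @is_iso SubS5S A B [set ax | subalg_rel A (ax.1, f ax.2)].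
Proof.
move=> hA f0 f1 fI fU fs fS.
have [[S00 S11] Sj Sm Sle] := @subalg_subordination A.
have fle x y : (x <= y)%O -> (f x <= f y)%O.
  by rewrite !leEmeet => /eqP xy; rewrite -fI xy.
have idem a b : subalg_rel A (a, b) <-> exists c, subalg_rel A (a, c) /\ subalg_rel A (c, b).
  rewrite -{1}(subalg_rel_idem hA); split=> [[c ac cb]|[c [ac cb]]]; by exists c.
apply: (subalg_iso (g := [set xa | subalg_rel A (f xa.1, xa.2)])).
- split=> /=.
  + by rewrite f0 f1.
  + by move=> a b x; exact: Sj.
  + by move=> a x y ax ay; rewrite fI; exact: Sm.
  + by move=> a b x y ab bx /fle xy; exact: Sle ab bx xy.
- split=> /=.
  + by rewrite f0 f1.
  + by move=> x y a xa ya; rewrite fU; exact: Sj.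
  + by move=> x a b; exact: Sm.
  + by move=> x y a b /fle xy ya ab; exact: Sle xy ya ab.
- apply/seteqP; split=> [[a x] [b ab bx]|[a x] /= /idem[b [ab bx]]]; last by exists b.
  by apply/idem; exists b.
- apply/seteqP; split=> [[x a] [y /fS xy ya]|[x a] /= /idem[b [xb ba]]].
    by apply/idem; exists (f y).
  by have [y yb] := fs b; exists y; [apply/fS; rewrite /= yb|rewrite /= yb].
- apply/seteqP; split=> [[a b] [x ax xb]|[a b] /= /idem[c [ac cb]]].
    by apply/idem; exists (f x).
  by have [x xc] := fs c; exists x; rewrite /= xc.
- apply/seteqP; split=> [[x y] [a xa ay]|[x y] /fS/idem[a [xa ay]]]; last by exists a.
  by apply/fS/idem; exists a.
Qed.

Lemma clopens_rep (X : topologicalType) : set_rep (fun U : clopens X => \val U).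
Proof. by split. Qed.

Section ClopenVietoris.
Variable X : topologicalType.

Definition kext (x : kalg (clopens X)) : set (closeds X) :=
  [set F | ksat (fun U : clopens X => \val U) (\val F) x].

Lemma clopen_kext x : clopen (kext x).
Proof.
have [t ->] := kpi_surj x.
have -> : kext (kpi t) = [set F | sat (fun U : clopens X => \val U) (\val F) t].
  apply/seteqP; split=> F; rewrite /kext /=.
    by move/(ksat_pi (@clopens_rep X)).
  by move=> h; apply/(ksat_pi (@clopens_rep X)).
elim: t => [U|U|||s hs t ht|s hs t ht|s hs] /=.
- exact: (clopen_vsub (set_valP U)).
- exact: (clopen_vmeet (set_valP U)).
- exact: clopen0.
- exact: clopenT.
- exact: clopenI.
- exact: clopenU.
- exact: (clopenC set0 hs).
Qed.

Definition kext_clopen x : clopens (closeds X) := set_elt (clopen_kext x).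

Lemma kextI x y : kext (x `&` y)%O = kext x `&` kext y.
Proof.
by apply/seteqP; split=> F; [move/(ksatI (@clopens_rep X))|
  move=> h; apply/(ksatI (@clopens_rep X))].
Qed.

Lemma kextU x y : kext (x `|` y)%O = kext x `|` kext y.
Proof.
by apply/seteqP; split=> F; [move/(ksatU (@clopens_rep X))|
  move=> h; apply/(ksatU (@clopens_rep X))].
Qed.

Lemma kext0 : kext \bot%O = set0.
Proof. by apply/seteqP; split=> // F /(ksat0 (@clopens_rep X)). Qed.

Lemma kext1 : kext \top%O = setT.
Proof. by apply/seteqP; split=> // F _; exact: (ksat1 (@clopens_rep X)). Qed.

Lemma kext_box U : kext (kbox U) = vsub (\val U).
Proof.
by apply/seteqP; split=> F; [move/(ksat_box (@clopens_rep X))|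
  move=> h; apply/(ksat_box (@clopens_rep X))].
Qed.

Lemma kext_dia U : kext (kdia U) = vmeet (\val U).
Proof.
by apply/seteqP; split=> F; [move/(ksat_dia (@clopens_rep X))|
  move=> h; apply/(ksat_dia (@clopens_rep X))].
Qed.

Hypothesis sX : stone_space X.

(** The sets described by elements of K(Clop X) form a base: boxes and diamonds
    of clopens refine the subbasic open sets. *)
Lemma kext_nbhs (F : closeds X) (O : set (closeds X)) :
  open O -> O F -> exists2 x, kext x F & kext x `<=` O.
Proof.
move=> oO OF; pose L := filter_from [set x | kext x F] kext.
have FL : Filter L.
  apply: filter_from_filter; first by exists \top%O; rewrite /= kext1.
  by move=> x y xF yF; exists (x `&` y)%O; rewrite /= kextI.
suff LF : L --> F.
  have [|x xF xO] := LF O; last by exists x.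
  by apply: open_nbhs_nbhs; split.
apply: vietoris_cvg => U oU.
  move=> FU; have [C [cC FC CU]] := clopen_between sX (set_valP F) oU FU.
  exists (kbox (set_elt cC : clopens X)); rewrite ?kext_box /= ?kext_box //.
  by move=> G GC y Gy; apply: CU; exact: (GC y).
move=> [y [Fy Uy]]; have [C Cy CU] := clopens_cover sX oU Uy.
exists (kdia C); rewrite ?kext_dia /= ?kext_dia; first by exists y.
by move=> G [z [Gz Cz]]; exists z; split=> //; exact: CU.
Qed.

Lemma kext_surj (O : clopens (closeds X)) : exists x, kext_clopen x = O.
Proof.
have cV : compact [set: closeds X] by apply: vietoris_compact; case: sX.
have [||||| _ [x xO <-] Ox] := @compact_directed (closeds X) (\val O)
    [set kext x | x in [set x | kext x `<=` \val O]].
- by apply: closed_compact => //; exact: clopens_closed.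
- by move=> _ [x _ <-]; have [] := clopen_kext x.
- by exists (kext \bot%O); exists \bot%O => //; rewrite /= kext0.
- move=> _ _ [x xO <-] [y yO <-]; exists (kext (x `|` y)%O); last by rewrite kextU.
  by exists (x `|` y)%O => //; rewrite /= kextU subUset.
- move=> F OF; have [x xF xO] := kext_nbhs (@clopens_open _ O) OF.
  by exists (kext x) => //; exists x.
by exists x; apply/val_inj/seteqP.
Qed.

End ClopenVietoris.

(** Finite sets are closed in a Hausdorff space, so the sets produced by the
    completeness argument are points of the Vietoris spaces. *)
Lemma kext_rel (X Y : topologicalType) (R : set (X * Y)) x y :
  hausdorff_space X -> hausdorff_space Y ->
  kalg_rel (clop_rel R) (x, y) <->
  clop_rel (vietoris_rel R) (kext_clopen x, kext_clopen y).
Proof.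
move=> /hausdorff_accessible/accessible_finite_set_closed fX.
move=> /hausdorff_accessible/accessible_finite_set_closed fY.
have [rX rY] := (@clopens_rep X, @clopens_rep Y).
split=> [xy G [F xF FG]|xy].
  by apply: (kalg_rel_sound rX rY _ xy FG xF).
apply: (kalg_rel_complete rX rY (R := R)) => // F G /fX cF /fY cG FG xF.
have : kext y (set_elt cG : closeds Y); last by [].
by apply: xy; exists (set_elt cF : closeds X).
Qed.

Lemma clopens_vietoris :
  nat_iso (functor_comp Clopfun VStoneE) (functor_comp Kfun Clopfun).
Proof.
have hV X := fob_ob VStoneE_functor (X := X).
exists (fun X _ => [set Ux | clop_rel (vietoris_rel (eqsp_rel X))
  (Ux.1, kext_clopen (Ux.2 : kalg (clopens X)))]).
split=> [X hX|X Y hX hY R mR].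
  have [sX cE] := hX; have [_ hX' _] := sX.
  apply: (@subalg_iso_surj (clop_subalg (vietoris_eqspace X))
    (kalg_subalg (clop_subalg X)) (@kext_clopen X)).
  - exact: (fob_ob Clopfun_functor (hV X hX)).
  - by apply: val_inj; exact: kext0.
  - by apply: val_inj; exact: kext1.
  - by move=> x y; apply: val_inj; exact: kextI.
  - by move=> x y; apply: val_inj; exact: kextU.
  - exact: kext_surj.
  - by move=> x y; exact: kext_rel.
have [[sX cEX] [sY cEY]] := (hX, hY); have [[_ hX' _] [_ hY' _]] := (sX, sY).
have [_ RX RY] := fmor_mor Clopfun_functor (hV X hX) (hV Y hY)
  (fmor_mor VStoneE_functor hX hY mR).
have {}RX : clop_rel (vietoris_rel R) ⊚ clop_rel (vietoris_rel (eqsp_rel X)) =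
  clop_rel (vietoris_rel R) by exact: RX.
have {}RY : clop_rel (vietoris_rel (eqsp_rel Y)) ⊚ clop_rel (vietoris_rel R) =
  clop_rel (vietoris_rel R) by exact: RY.
apply/seteqP; split=> [[U y] [W UW Wy]|[U y] [x Ux /(kext_rel _ _ _ hX' hY') xy]].
  have : clop_rel (vietoris_rel R) (U, kext_clopen y) by rewrite -RY; exists W.
  rewrite -RX => -[W' /= UW' W'y]; have [x xW'] := kext_surj sX W'.
  by exists x; [rewrite /= xW'|apply/kext_rel => //; rewrite xW'].
have : clop_rel (vietoris_rel R) (U, kext_clopen y).
  by rewrite -RX; exists (kext_clopen x).
by rewrite -RY => -[W UW Wy]; exists W.
Qed.

(** * The functor B *)

Section WellInside.
Context {d : Order.disp_t} {L : frameType d}.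
Implicit Types (a b c x : L) (D : set L).

Lemma well_inside_join a b c :
  well_inside a c -> well_inside b c -> well_inside (a `|` b)%O c.
Proof. by rewrite /well_inside pcompl_join frame_joinIl => -> ->; rewrite meetxx. Qed.

Lemma well_inside_meet a b c :
  well_inside a b -> well_inside a c -> well_inside a (b `&` c)%O.
Proof.
rewrite /well_inside => ab ac.
by rewrite joinC frame_joinIl ![(_ `|` pcompl _)%O]joinC ab ac meetxx.
Qed.

Lemma well_inside0 b : well_inside \bot%O b.
Proof. by rewrite /well_inside pcompl0 join1x. Qed.

Lemma well_inside1 a : well_inside a \top%O.
Proof. by rewrite /well_inside joinx1. Qed.

Lemma well_inside_pcompl2 a b : well_inside (pcompl (pcompl a)) b <-> well_inside a b.
Proof. by rewrite /well_inside pcompl3. Qed.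

Lemma directed_well_inside b : directed [set c | well_inside c b].
Proof.
split; first by exists \bot%O; exact: well_inside0.
move=> x y xb yb; exists (x `|` y)%O; split; [exact: well_inside_join|exact: leUl|exact: leUr].
Qed.

(** A finite subcover uses finitely many members of D, and one member lies
    above all of them. *)
Lemma compact_directed_join x D :
  compact_frame L -> directed D -> (x `|` fsup D = \top)%O ->
  exists2 c, D c & (x `|` c = \top)%O.
Proof.
move=> cL [[c0 Dc0] dD] xD; have [|s [sD s1]] := cL (x |` D).
  apply/eqP; rewrite -le1x -xD leUx; apply/andP; split; first by apply: fsup_ub; left.
  by apply: fsup_le => c Dc; apply: fsup_ub; right.
suff [c Dc sc] : exists2 c, D c & (\join_(y <- s) y <= x `|` c)%O.
  by exists c => //; apply/eqP; rewrite -le1x -s1.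
elim: s sD {s1} => [|y s IHs] sD; first by exists c0 => //; rewrite big_nil le0x.
have [|c Dc sc] := IHs; first by move=> z zs; apply: sD; rewrite inE zs orbT.
have [->|Dy] := sD y (mem_head y s).
  by exists c => //; rewrite big_cons leUx leUl.
have [e [De ye ce]] := dD y c Dy Dc; exists e => //.
rewrite big_cons leUx (le_trans ye (leUr _ _)) /=.
by apply: le_trans sc _; exact: leU2.
Qed.

End WellInside.

Lemma preframe_hom_le (L M : frame) (h : L -> M) a b :
  preframe_hom h -> (a <= b)%O -> (h a <= h b)%O.
Proof. by move=> [_ hI _]; rewrite !leEmeet => /eqP ab; rewrite -hI ab. Qed.

(** By regularity b is the directed join of the elements well inside it, and
    by compactness one of these already suffices. *)
Lemma preframe_interpolate (L M : frame) (h : L -> M) a b :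
  compact_frame M -> regular_frame L -> preframe_hom h -> well_inside a (h b) ->
  exists c : regulars L, well_inside a (h (\val c)) /\ well_inside (\val c) b.
Proof.
move=> cM rL mh; have [_ hI hs] := mh; have dW := directed_well_inside b.
rewrite /well_inside {1}(rL b) hs // => ab.
have dW' : directed [set h x | x in [set c | well_inside c b]].
  have [[c0 c0b] dD] := dW; split; first by exists (h c0); exists c0.
  move=> _ _ [x xb <-] [y yb <-]; have [z [zb xz yz]] := dD x y xb yb.
  by exists (h z); split; [exists z|exact: preframe_hom_le|exact: preframe_hom_le].
have [_ [c cb <-] ac] := compact_directed_join cM dW' ab.
exists (regularize c); split; last by apply/well_inside_pcompl2.
apply: well_insideS (lexx _) ac _; apply: preframe_hom_le => //.
exact: le_pcompl2.
Qed.

Lemma preframe_hom_id (L : frame) : @preframe_hom _ _ L L id.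
Proof. by split=> // A _; rewrite image_id. Qed.

Lemma regular_subalg_DeV (L : frame) : is_ob KRFrmP L -> is_ob DeVS (regular_subalg L).
Proof.
move=> [cL rL]; split; last split.
- split.
  + by move=> a b /= ab; rewrite regulars_leE; exact: well_inside_le.
  + move=> a b ab; change (well_inside (pcompl (\val b)) (pcompl (\val a))).
    rewrite /well_inside joinC.
    by rewrite regularK; exact: ab.
  + move=> a b ab.
    by have [c [ac cb]] := preframe_interpolate cL rL (preframe_hom_id L) ab; exists c.
- move=> A; exists (regularize (fsup [set \val a | a in A])); split=> [a Aa|b ub].
    rewrite regulars_leE; apply: le_trans (le_pcompl2 _).
    by apply: fsup_ub; exists a.
  rewrite le_regularize; apply: fsup_le => _ [a Aa <-]; rewrite -regulars_leE.
  exact: ub.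
- move=> b b0; apply: contrapT => h; apply: b0; apply: val_inj; rewrite regulars_val0.
  apply/eqP; rewrite -lex0 (rL (\val b)); apply: fsup_le => c cb.
  apply: le_trans (le_pcompl2 c) _; rewrite -regulars_val0 -[leLHS]/(\val (regularize c)).
  rewrite -regulars_leE lex0; apply/eqP; apply: contrapT => c0; apply: h.
  by exists (regularize c); split=> //; apply/well_inside_pcompl2.
Qed.

Lemma Bfun_functor : is_functor Bfun.
Proof.
split.
- exact: regular_subalg_DeV.
- move=> L M h [cL rL] [cM rM] mh; have [h1 hI hs] := mh; split.
  + split.
    * split.
        change (well_inside (\val (\bot%O : regulars M)) (h (\val (\bot%O : regulars L)))).
        by rewrite regulars_val0; exact: well_inside0.
      change (well_inside (\val (\top%O : regulars M)) (h (\val (\top%O : regulars L)))).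
      by rewrite !regulars_val1 h1; exact: well_inside1.
    * by move=> a b c ac bc; apply/well_inside_pcompl2; exact: well_inside_join.
    * move=> a b c ab ac; change (well_inside (\val a) (h (\val (b `&` c)%O))).
      by rewrite regulars_valI hI; exact: well_inside_meet.
    * move=> a b c e; rewrite !regulars_leE => ab bc ce.
      by apply: well_insideS ab bc _; exact: preframe_hom_le.
  + apply/seteqP; split=> [[a b] [c /= /well_inside_le ac cb]|[a b] /= ab].
      exact: well_insideS ac cb (lexx _).
    by have [c [ac cb]] := preframe_interpolate cM rM (preframe_hom_id M) ab; exists c.
  + apply/seteqP; split=> [[a b] [c /= ac /well_inside_le cb]|[a b] /= ab].
      by apply: well_insideS (lexx _) ac _; exact: preframe_hom_le.
    by have [c [ac cb]] := preframe_interpolate cM rL mh ab; exists c.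
- by [].
- move=> L M N g f [cL rL] [cM rM] [cN rN] mg mf.
  apply/seteqP; split=> [[a c] /= ac|[a c] [b /= ab /well_inside_le bc]].
    by have [b [ab bc]] := preframe_interpolate cN rM mg ac; exists b.
  by apply: well_insideS (lexx _) ab _; exact: preframe_hom_le.
Qed.

Lemma Jfun_functor : is_functor Jfun.
Proof.
apply: functor_comp_functor Bfun_functor.
apply: functor_comp_functor (op_is_functor (full_inclusion_functor _)).
exact: functor_comp_functor Ifun_functor (op_is_functor Kfun_functor).
Qed.

(** * S5-subordination algebras and their regular S-ideals *)

Section RegularIdeals.
Variable B : subalg.
Hypothesis hB : is_ob SubS5S B.
Implicit Types (a b c : B) (I J : regulars (S_ideals B)).
Local Notation S := (subalg_rel B).

Lemma S_interpolate a b : S (a, b) -> exists c, S (a, c) /\ S (c, b).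
Proof. by have [_ _ h] := hB; exact: h. Qed.

(** The double pseudocomplement of an ideal exceeds an upper bound of it by
    arbitrarily little. *)
Lemma pcompl2_ideal_le (J : S_ideals B) a b :
  (forall j, \val J j -> (j <= a)%O) -> S (a, b) ->
  forall j, \val (pcompl (pcompl J)) j -> (j <= b)%O.
Proof.
move=> Ja ab j /(pcompl_idealP hB)[y [/(sub_le hB) jy Jy]]; apply: le_trans jy _.
suff /Jy : \val (pcompl J) (~` b)%O by move/eqP; rewrite meetC disj_leC complK.
apply/(pcompl_idealP hB); exists (~` a)%O; split; first exact: (subC hB).
by move=> i /Ja; rewrite -{1}[a]complK -disj_leC => /eqP.
Qed.

(** For c with a S c S b, the regularization of the ideal of the elements
    S-related to c still lies below b. *)
Lemma regular_ideal_between a b : S (a, b) ->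
  exists2 I : regulars (S_ideals B), \val (\val I) a & forall i, \val (\val I) i -> (i <= b)%O.
Proof.
move=> /S_interpolate[c [ac cb]]; exists (regularize (below hB c)).
  by have /S_ideals_leP := le_pcompl2 (below hB c); apply.
by apply: pcompl2_ideal_le cb => j /(sub_le hB).
Qed.

Lemma regular_relP I J :
  regular_rel (I, J) <->
  exists2 y, \val (\val J) y & forall j, \val (\val I) j -> (j <= y)%O.
Proof. exact: well_inside_idealP. Qed.

(** The inverse of [ideal_mem].  Asking I to have an upper bound S-related to b,
    instead of b itself as a bound, makes the relation compatible. *)
Definition ideal_bounded : set (regulars (S_ideals B) * B) :=
  [set Ib | exists c, (forall i, \val (\val Ib.1) i -> (i <= c)%O) /\ S (c, Ib.2)].

Definition ideal_mem : set (B * regulars (S_ideals B)) :=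
  [set aI | \val (\val aI.2) aI.1].

(** All conditions reduce to [regular_ideal_between] and to the description of
    the well inside relation between ideals. *)
Lemma ideal_bounded_iso :
  @is_iso SubS5S (regular_subalg (PackFrame (S_ideals B : frameType _))) B ideal_bounded.
Proof.
have [[S00 S11] Sj Sm Sle] := @subalg_subordination B.
apply: (@subalg_iso (regular_subalg (PackFrame (S_ideals B : frameType _))) B
  ideal_bounded ideal_mem).
- split.
  + split; last by exists \top%O; split=> // i _; exact: lex1.
    exists \bot%O; split=> // i; rewrite regulars_val0 => /(S_ideals_bot).
    by move=> ->.
  + move=> I J b [c [Ic cb]] [e [Je eb]].
    have [m [cm mb]] := S_interpolate (Sj _ _ _ cb eb).
    exists m; split=> // j; apply: (pcompl2_ideal_le _ cm) => i.
    move=> /S_ideals_joinP[x [y [Ix Jy ixy]]]; apply: le_trans ixy _.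
    by apply: leU2; [exact: Ic|exact: Je].
  + move=> I b b' [c [Ic cb]] [e [Ie eb]]; exists (c `&` e)%O; split.
      by move=> i /= Ii; rewrite lexI Ic // Ie.
    by apply: Sm; [exact: Sle (leIl _ _) cb (lexx _)|exact: Sle (leIr _ _) eb (lexx _)].
  + move=> I J b b'; rewrite regulars_leE => /S_ideals_leP IJ [c [Jc cb]] bb.
    exists c; split; last exact: Sle (lexx _) cb bb.
    by move=> i /IJ; exact: Jc.
- split.
  + split; first by case: (set_valP (\val (\bot%O : regulars (S_ideals B)))).
    change (\val (\val (\top%O : regulars (S_ideals B))) \top%O).
    by rewrite regulars_val1; exact/S_ideals_topP.
  + by move=> a b I; have [_ Ij _ _] := set_valP (\val I); exact: Ij.
  + move=> a I J Ia Ja; change (\val (\val (I `&` J)%O) a).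
    by rewrite regulars_valI.
  + move=> a b I J ab Ib; rewrite regulars_leE => /S_ideals_leP IJ; apply: IJ.
    by have [_ _ Ile _] := set_valP (\val I); exact: Ile ab Ib.
- apply/seteqP; split=> [[I b] [J /well_inside_le/S_ideals_leP IJ [c [Jc cb]]]|[I b] [c [Ic cb]]].
    by exists c; split=> // i /IJ; exact: Jc.
  have [m [cm mb]] := S_interpolate cb.
  have [J Jc Jm] := regular_ideal_between cm.
  by exists J; [apply/regular_relP; exists c|exists m].
- apply/seteqP; split=> [[a I] [b ab Ib]|[a I] Ia]; first exact: (S_ideal_sub hB ab Ib).
  by have [_ _ _ /(_ a Ia)[b [Ib ab]]] := set_valP (\val I); exists b.
- apply/seteqP; split=> [[I J] [b [c [Ic cb]] Jb]|[I J] /regular_relP[y Jy Iy]].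
    by apply/regular_relP; exists c => //; exact: (S_ideal_sub hB cb Jb).
  have [_ _ _ /(_ y Jy)[b [Jb yb]]] := set_valP (\val J).
  by exists b => //; exists y.
- apply/seteqP; split=> [[a b] [I Ia [c [Ic cb]]]|[a b] ab].
    exact: Sle (Ic a Ia) cb (lexx _).
  have [c [ac cb]] := S_interpolate ab; have [I Ia Ic] := regular_ideal_between ac.
  by exists I => //; exists c.
Qed.

End RegularIdeals.

Definition id_functor (C : category) : functor C C :=
  @Functor C C id (fun X Y f => f).

Lemma id_functor_functor (C : category) : is_functor (id_functor C).
Proof. by split. Qed.

Lemma regular_ideals_unit :
  nat_iso (id_functor (op SubS5S))
    (functor_comp (functor_comp (op_functor Delta) Bfun) Ifun).
Proof.
exists (fun B _ => @ideal_bounded B); split=> [B hB|B A hB hA T mT].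
  exact/is_iso_op/ideal_bounded_iso.
rewrite /= in T mT *; have [[[T00 T11] Tj Tm Tle] TA BT] := mT.
apply/seteqP; split=> [[J b] [a [c [Jc ca]] ab]|[J b] [K JK [c [Kc cb]]]].
  have : (subalg_rel B ⊚ T) (c, b) by rewrite [_ ⊚ _]BT -TA; exists a.
  move=> [b1 cb1 b1b]; have [b2 [b12 b2b]] := S_interpolate hB b1b.
  have [K Kb1 Kb2] := regular_ideal_between hB b12.
  exists K; last by exists b2.
  by apply/(well_inside_idealP hA); exists c => //; apply/(ideal_preimageP _ _ mT); exists b1.
move: JK => /(well_inside_idealP hA)[y /(ideal_preimageP _ _ mT)[k Kk yk] Jy].
have : (T ⊚ subalg_rel A) (y, b).
  by rewrite [_ ⊚ _]TA -BT; exists c => //; exact: Tle (lexx _) yk (Kc _ Kk).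
by move=> [a ya ab]; exists a => //; exists y.
Qed.

(** * The space of ultrafilters on a compact Hausdorff space *)

Lemma UltraFilterP (T : Type) (F : set_system T) :
  ProperFilter F -> (forall A, F A \/ F (~` A)) -> UltraFilter F.
Proof.
move=> PF FC; split=> // G PG FG; apply/seteqP; split=> // A GA.
have [//|/FG GCA] := FC A.
by have /filter_ex[x []] : G (A `&` ~` A) by exact: filterI.
Qed.

Definition ultras (Y : Type) := set_type (@UltraFilter Y).

Section Ultras.
Variable Y : Type.

HB.instance Definition _ := Choice.on (ultras Y).

(** The Stone topology on ultrafilters has these sets as a base of clopens. *)
Definition hat (A : set Y) : set (ultras Y) := [set u | \val u A].

#[local] Instance ultras_ultra (u : ultras Y) : UltraFilter (\val u).
Proof. exact: set_valP u. Qed.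

Definition hat_open (O : set (ultras Y)) :=
  forall u, O u -> exists2 A, hat A u & hat A `<=` O.

Lemma hat_openT : hat_open setT.
Proof. by move=> u _; exists setT => //; exact: filterT. Qed.

Lemma hat_openI : setI_closed hat_open.
Proof.
move=> O P hO hP u [/hO[A uA AO] /hP[B uB BP]]; exists (A `&` B); first exact: filterI.
by move=> v vAB; split; [apply: AO|apply: BP]; apply: filterS vAB => x [].
Qed.

Lemma hat_open_bigU (I : Type) (f : I -> set (ultras Y)) :
  (forall i, hat_open (f i)) -> hat_open (\bigcup_i f i).
Proof.
move=> h u [i _ /h[A uA Af]]; exists A => // v vA.
by exists i => //; exact: Af.
Qed.

HB.instance Definition _ :=
  isOpenTopological.Build (ultras Y) hat_openT hat_openI hat_open_bigU.

Lemma open_hat (A : set Y) : open (hat A).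
Proof. by move=> u uA; exists A. Qed.

Lemma hatC (A : set Y) : hat (~` A) = ~` hat A.
Proof.
apply/seteqP; split=> u; rewrite /hat /=.
  by move=> uCA uA; have /filter_ex[x []] : \val u (A `&` ~` A) by exact: filterI.
by have [|] := in_ultra_setVsetC A (ultras_ultra u).
Qed.

Lemma clopen_hat (A : set Y) : clopen (hat A).
Proof. by split; [exact: open_hat|rewrite -openC -hatC; exact: open_hat]. Qed.

Lemma ultras_sep (u v : ultras Y) : u <> v -> exists2 A, hat A u & ~ hat A v.
Proof.
move=> uv; apply: contrapT => h; apply: uv; apply: val_inj.
apply/esym; apply: max_filter => A uA; apply: contrapT => nvA.
by apply: h; exists A.
Qed.

(** The sets A such that L-almost all ultrafilters contain A form the limit
    of L. *)
Lemma ultras_compact : compact [set: ultras Y].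
Proof.
rewrite compact_ultra => L UL _.
have UF : UltraFilter [set A | L (hat A)].
  apply: UltraFilterP.
    split.
      rewrite /= (_ : hat set0 = set0); first by case: UL => -[].
      by apply/seteqP; split=> // u /filter_ex[].
    split=> /=.
    - by apply: (filterS (F := L)) (@filterT _ L _) => u _; exact: filterT.
    - move=> A B LA LB; have : L (hat A `&` hat B) by exact: filterI.
      by apply: filterS => u [uA uB]; exact: filterI.
    - by move=> A B AB; apply: (@filterS _ L) => u; exact: filterS.
  by move=> A; rewrite /= hatC; exact: in_ultra_setVsetC.
exists (set_elt UF); split=> // O; rewrite nbhs_simpl nbhsE => -[P [oP Pu] PO].
have [A LA AP] := oP _ Pu.
have {}LA : L (hat A) by [].
by apply: filterS LA => v /AP /PO.
Qed.

Lemma ultras_stone : stone_space (ultras Y).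
Proof.
apply: zero_dimensional_stone; first exact: ultras_compact.
  apply: hausdorff_point_sep => u v /ultras_sep[A uA vA].
  exists (hat A), (hat (~` A)); rewrite !hatC; split.
  - by split=> //; exact: open_hat.
  - by split=> //; rewrite -hatC; exact: open_hat.
  - by rewrite setICr.
move=> u v /ultras_sep[A uA vA]; exists (hat A); split=> //; exact: clopen_hat.
Qed.

End Ultras.

Section Limits.
Variable Y : topologicalType.

Definition limit : set (ultras Y * Y) := [set uy | \val uy.1 --> uy.2].

Lemma closed_limit : closed limit.
Proof.
apply/closed_relP => u y nlim.
have [U [oU Uy nuU]] : exists U, [/\ open U, U y & ~ \val u U].
  apply: contrapT => h; apply: nlim => A; rewrite nbhs_simpl nbhsE => -[U [oU Uy] UA].
  have uu := set_valP u; apply: filterS UA _; apply: contrapT => nuU.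
  by apply: h; exists U.
exists (hat (~` U)), U; split=> //.
  by rewrite hatC; split=> //; rewrite -hatC; exact: open_hat.
move=> v z; rewrite hatC => nvU Uz vz; apply: nvU.
by apply: vz; exact: open_nbhs_nbhs.
Qed.

(** Stated without assumptions on Y, so as to be an equivalence relation for
    every space; when Y is compact Hausdorff it is the kernel of the limit map. *)
Definition same_limits : set (ultras Y * ultras Y) :=
  [set uv | forall y, limit (uv.1, y) <-> limit (uv.2, y)].

Lemma same_limits_refl u : same_limits (u, u).
Proof. by []. Qed.

Lemma same_limits_sym u v : same_limits (u, v) -> same_limits (v, u).
Proof. by move=> h y; split=> /h. Qed.

Lemma same_limits_trans u v w :
  same_limits (u, v) -> same_limits (v, w) -> same_limits (u, w).
Proof. by move=> h k y; split=> [/h/k|/k/h]. Qed.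

Definition ultra_eqspace : eqspace :=
  EqSpace same_limits_refl same_limits_sym same_limits_trans.

Hypothesis cY : compact [set: Y].
Hypothesis hY : hausdorff_space Y.

Lemma limit_total u : exists y, limit (u, y).
Proof.
have uu := set_valP u; move: cY; rewrite compact_ultra => /(_ _ uu) [|y [_ uy]].
  exact: filterT.
by exists y.
Qed.

Lemma limit_unique u y z : limit (u, y) -> limit (u, z) -> y = z.
Proof. by move=> uy uz; have uu := set_valP u; exact: (cvg_unique hY uy uz). Qed.

Lemma limit_surj y : exists u, limit (u, y).
Proof.
exists (set_elt (principal_filter_ultra y)) => A; rewrite nbhs_simpl => yA.
by apply/principal_filterP; exact: nbhs_singleton.
Qed.

Lemma same_limitsP u v y : limit (u, y) -> same_limits (u, v) <-> limit (v, y).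
Proof.
move=> uy; split=> [h|vy z]; first exact/h.
by split=> [/(limit_unique uy) <-|/(limit_unique vy) <-].
Qed.

Lemma limit_comp_conv : limit ⊚ limit^† = @rel_id Y.
Proof.
apply/seteqP; split=> [[y z] [u uy uz]|[y z] yz].
  exact: limit_unique uy uz.
have [u uy] := limit_surj y; exists u => //.
by rewrite -(yz : y = z).
Qed.

Lemma limit_conv_comp : limit^† ⊚ limit = same_limits.
Proof.
apply/seteqP; split=> [[u v] [y uy vy]|[u v] uv]; first exact/(same_limitsP _ uy).
by have [y uy] := limit_total u; exists y => //; exact/(same_limitsP _ uy).
Qed.

End Limits.

(** By p p^† = id for the limit relation p, conjugation with p preserves
    composition. *)
Definition ultra_cover : functor KHausR StoneER := @Functor KHausR StoneER ultra_eqspace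
  (fun Y Z (R : set (Y * Z)) => (@limit Z)^† ⊚ R ⊚ @limit Y).

Lemma ultra_cover_ob Y : is_ob KHausR Y -> is_ob StoneER (ultra_cover Y).
Proof.
move=> [cY hY]; split; first exact: ultras_stone.
rewrite /= -limit_conv_comp //.
exact: (closed_rel_comp cY (closed_rel_conv (@closed_limit Y)) (@closed_limit Y)).
Qed.

Lemma ultra_cover_functor : is_functor ultra_cover.
Proof.
split.
- exact: ultra_cover_ob.
- move=> Y Z R [cY hY] [cZ hZ] cR; split.
  + have cR' := closed_rel_comp cZ (closed_rel_conv (@closed_limit Z)) cR.
    exact: (closed_rel_comp cY cR' (@closed_limit Y)).
  + rewrite -[LHS]/((@limit Z)^† ⊚ R ⊚ @limit Y ⊚ @same_limits Y) -limit_conv_comp //.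
    by rewrite !rel_compA -(rel_compA _ _ (@limit Y)^†) limit_comp_conv // rel_comp_idr.
  + rewrite -[LHS]/(@same_limits Z ⊚ ((@limit Z)^† ⊚ R ⊚ @limit Y)) -limit_conv_comp //.
    by rewrite !rel_compA -(rel_compA _ (@limit Z)) limit_comp_conv // rel_comp_idr.
- move=> Y [cY hY]; rewrite -[LHS]/((@limit Y)^† ⊚ @rel_id Y ⊚ @limit Y).
  by rewrite rel_comp_idr limit_conv_comp.
- move=> W Y Z T R _ [cY hY] _ cT cR.
  rewrite -[LHS]/((@limit Z)^† ⊚ (T ⊚ R) ⊚ @limit W).
  rewrite -[RHS]/((@limit Z)^† ⊚ T ⊚ @limit Y ⊚ ((@limit Y)^† ⊚ R ⊚ @limit W)).
  rewrite !rel_compA -(rel_compA _ (@limit Y)) limit_comp_conv // rel_comp_idr.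
  by [].
Qed.

(** The limit relation p satisfies p p^† = id and p^† p = E, like the projection
    to the quotient by E, so p P^† and P p^† are mutually inverse. *)
Lemma quotient_ultras : nat_iso (functor_comp Qfun ultra_cover) (id_functor KHausR).
Proof.
pose P Y := graph (@qproj (ultra_eqspace Y)).
have PP Y : P Y ⊚ (P Y)^† = @rel_id (qspace (ultra_eqspace Y)) by exact: conv_comp_qproj.
have PE Y : (P Y)^† ⊚ P Y = @same_limits Y by exact: (@qproj_comp_conv (ultra_eqspace Y)).
exists (fun Y _ => @limit Y ⊚ (P Y)^†); split=> [Y hY|Y Z hY hZ R cR].
  have [cY hY'] := hY; have hG := ultra_cover_ob hY; have [[cG _ _] cE] := hG.
  have cP : closed (P Y) by exact: (closed_qproj hG).
  have cl := @closed_limit Y.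
  split; first exact: (closed_rel_comp cG cl (closed_rel_conv cP)).
  exists (P Y ⊚ (@limit Y)^†); split.
  - exact: (closed_rel_comp cG cP (closed_rel_conv cl)).
  - rewrite -[LHS]/(P Y ⊚ (@limit Y)^† ⊚ (@limit Y ⊚ (P Y)^†)).
    rewrite rel_compA -(rel_compA (P Y)) limit_conv_comp // -PE.
    by rewrite !rel_compA PP rel_comp_idl PP.
  - rewrite -[LHS]/(@limit Y ⊚ (P Y)^† ⊚ (P Y ⊚ (@limit Y)^†)).
    rewrite rel_compA -(rel_compA (@limit Y)) PE -limit_conv_comp //.
    by rewrite !rel_compA limit_comp_conv // rel_comp_idl limit_comp_conv.
have [[cY hY'] [cZ hZ']] := (hY, hZ).
rewrite -[LHS]/(@limit Z ⊚ (P Z)^† ⊚ (P Z ⊚ ((@limit Z)^† ⊚ R ⊚ @limit Y ⊚ (P Y)^†))).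
rewrite -[RHS]/(R ⊚ (@limit Y ⊚ (P Y)^†)).
rewrite rel_compA -(rel_compA (@limit Z)) PE -limit_conv_comp // !rel_compA.
rewrite limit_comp_conv // rel_comp_idl.
by rewrite limit_comp_conv // rel_comp_idl.
Qed.

(** * Regular opens are dual to the ultrafilter cover *)

Lemma closure_pcompl2 (Y : topologicalType) (U : opens Y) :
  closure (\val (pcompl (pcompl U))) `<=` closure (\val U).
Proof.
have cU : closed (closure (\val U)) by exact: closed_closure.
rewrite [X in _ `<=` X](closure_id _).1 //; apply: closureS => y cy.
apply: contrapT => nUy; have oc : open (~` closure (\val U)) by rewrite openC.
have /opens_leP le : ((set_elt oc : opens Y) <= pcompl U)%O.
  rewrite le_pcompl; apply/eqP/val_inj/seteqP; split=> // x [Ux]; apply.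
  exact: subset_closure.
have : \val (pcompl U `&` pcompl (pcompl U))%O y by split=> //; exact: le.
by rewrite pcompl_meet.
Qed.

(** Regularizing an open set does not enlarge its closure. *)
Lemma regular_open_between (Y : topologicalType) (K O : set Y) :
  compact [set: Y] -> hausdorff_space Y -> closed K -> open O -> K `<=` O ->
  exists W : regulars (opens Y),
    K `<=` \val (\val W) /\ closure (\val (\val W)) `<=` O.
Proof.
move=> cY hY cK oO KO.
have cO : closed (~` O) by rewrite closedC.
have [|U [V [oU oV KU OV UV]]] := compact_hausdorff_sep cY hY cK cO.
  by move=> x [/KO].
exists (regularize (set_elt oU : opens Y)); split.
  move=> x /KU Ux; have /opens_leP le := le_pcompl2 (set_elt oU : opens Y).
  exact: le.
move=> x /closure_pcompl2 cx; apply: contrapT => /OV Vx.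
have [|z [Uz Vz]] := cx V; first by apply: open_nbhs_nbhs.
exact: (UV z).
Qed.

Section RegularOpens.
Variable Y : topologicalType.
Hypothesis hY : is_ob KHausR Y.
Local Notation p := (@limit Y).
Local Notation OY := (PackFrame (opens Y : frameType _)).

(** With p the limit relation: the inverse image of the closure of W lies in U.
    The closure makes this relation inverse to [limits_in], as a clopen fits
    between the inverse images of closed and open sets. *)
Definition closure_below : set (regulars (opens Y) * clopens (ultras Y)) :=
  [set WU | rel_image p^† (closure (\val (\val WU.1))) `<=` \val WU.2].

Definition limits_in : set (clopens (ultras Y) * regulars (opens Y)) :=
  [set UW | rel_image p (\val UW.1) `<=` \val (\val UW.2)].

Lemma closed_preimage_limit (K : set Y) : closed K -> closed (rel_image p^† K).
Proof.
have [cY _] := hY => cK; apply: closed_rel_image; first exact: closed_compact.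
exact: (closed_rel_conv (@closed_limit Y)).
Qed.

Lemma open_limits_in (W : set Y) : open W -> open (~` rel_image p^† (~` W)).
Proof. by move=> oW; rewrite openC; apply: closed_preimage_limit; rewrite closedC. Qed.

Lemma open_limits_of (U : clopens (ultras Y)) : open (~` rel_image p (~` \val U)).
Proof.
rewrite openC; apply: closed_rel_image; last exact: closed_limit.
apply: closed_compact; first by case: (@ultras_stone Y).
by rewrite closedC; exact: clopens_open.
Qed.

Lemma clopen_preimage_between (K W : set Y) : closed K -> open W -> K `<=` W ->
  exists U : clopens (ultras Y),
    rel_image p^† K `<=` \val U /\ rel_image p (\val U) `<=` W.
Proof.
have [cY hY'] := hY => cK oW KW.
have [||U [cU KU UW]] := @clopen_between _ (rel_image p^† K) _ (@ultras_stone Y) _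
    (open_limits_in oW).
- exact: closed_preimage_limit.
- by move=> u [y /KW Wy uy] [z nWz uz]; apply: nWz; have /= <- := limit_unique hY' uy uz.
exists (set_elt cU); split=> // y [u /UW nu uy].
by apply: contrapT => nWy; apply: nu; exists y.
Qed.

(** Composites are evaluated by interpolation: a regular open between a closed
    set and an open neighbourhood in Y, or a clopen between their inverse images. *)
Lemma closure_below_iso :
  @is_iso SubS5S (regular_subalg OY) (clop_subalg (ultra_eqspace Y)) closure_below.
Proof.
have [cY hY'] := hY.
apply: (@subalg_iso (regular_subalg OY) (clop_subalg (ultra_eqspace Y))
  closure_below limits_in).
- split.
  + split=> //; change (rel_image p^† (closure (\val (\val (\bot%O : regulars (opens Y))))) `<=` set0).
    by rewrite regulars_val0 opens_val0 closure0 => u [].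
  + move=> W W' U WU WU' u [y cy uy].
    have : closure (\val (\val W) `|` \val (\val W')) y.
      exact: (@closure_pcompl2 _ (\val W `|` \val W')%O _ cy).
    by rewrite closureU => -[cW|cW]; [apply: WU|apply: WU']; exists y.
  + by move=> W U V WU WV u h; split; [exact: WU|exact: WV].
  + move=> W W' U V; rewrite regulars_leE => /opens_leP WW W'U /clopens_leP UV u [y cy uy].
    by apply: UV; apply: W'U; exists y => //; exact: closureS WW _ cy.
- split.
  + split; first by move=> y [u []].
    change (rel_image p setT `<=` \val (\val (\top%O : regulars (opens Y)))).
    by rewrite regulars_val1.
  + by move=> U V W UW VW y [u [Uu|Vu] uy]; [apply: UW|apply: VW]; exists u.
  + move=> U W W' UW UW'; change (rel_image p (\val U) `<=` \val (\val (W `&` W')%O)).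
    by rewrite regulars_valI opens_valI => y h; split; [exact: UW|exact: UW'].
  + move=> U V W W' /clopens_leP UV VW; rewrite regulars_leE => /opens_leP WW y [u Uu uy].
    by apply: WW; apply: VW; exists u => //; exact: UV.
- apply/seteqP; split=> [[W U] [W' /opens_well_insideP WW' W'U]|[W U] WU].
    by move=> u [y /WW' cy uy]; apply: W'U; exists y => //; exact: subset_closure.
  have [|W' [WW' W'U]] := regular_open_between cY hY'
      (@closed_closure _ (\val (\val W))) (open_limits_of U).
    by move=> y cy [u nUu uy]; apply: nUu; apply: WU; exists y.
  exists W'; first exact/opens_well_insideP.
  by move=> u [y /W'U ny uy]; apply: contrapT => nUu; apply: ny; exists u.
- apply/seteqP; split=> [[U W] [V UV VW]|[U W] UW].
    by move=> y [u Uu uy]; apply: VW; exists u => //; apply: UV; exists u.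
  have sat : rel_image (@same_limits Y) (\val U) `<=` ~` rel_image p^† (~` \val (\val W)).
    by move=> v [u Uu uv] [y nWy vy]; apply: nWy; apply: UW; exists u => //; exact/uv.
  have [|V [cV UV VW]] := clopen_between (@ultras_stone Y) _
      (open_limits_in (set_valP (\val W))) sat.
    have [[cG _ _] cE] := ultra_cover_ob hY.
    by apply: closed_rel_image => //; apply: closed_compact => //; exact: clopens_closed.
  exists (set_elt cV) => // y [u /VW nu uy].
  by apply: contrapT => nWy; apply: nu; exists y.
- apply/seteqP; split=> [[W W'] [U WU UW']|[W W'] /opens_well_insideP WW'].
    apply/opens_well_insideP => y cy; have [u uy] := limit_surj y.
    by apply: UW'; exists u => //; apply: WU; exists y.
  have [U [WU UW]] := clopen_preimage_between (@closed_closure _ (\val (\val W)))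
      (set_valP (\val W')) WW'.
  by exists U.
- apply/seteqP; split=> [[U V] [W UW WV]|[U V] UV].
    move=> v [u Uu uv]; have [y uy] := limit_total cY u.
    apply: WV; exists y; last exact/uv.
    by apply: subset_closure; apply: UW; exists u.
  have [||W [UW WV]] := @regular_open_between Y (rel_image p (\val U)) _ cY hY' _
      (open_limits_of V).
  + apply: closed_rel_image; last exact: closed_limit.
    by apply: closed_compact; [case: (@ultras_stone Y)|exact: clopens_closed].
  + move=> y [u Uu uy] [v nVv vy]; apply: nVv; apply: UV; exists u => //.
    exact/(same_limitsP hY' _ uy).
  + exists W => // u [y /WV ny uy]; apply: contrapT => nVu; apply: ny.
    by exists u.
Qed.

End RegularOpens.

Lemma regular_opens_clopens :
  nat_iso (functor_comp (op_functor Clopfun) (op_functor ultra_cover))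
    (functor_comp (functor_comp (op_functor Delta) Bfun) Ofun).
Proof.
exists (fun Y _ => @closure_below Y); split=> [Y hY|Z Y hZ hY R cR].
  exact/is_iso_op/closure_below_iso.
rewrite /= in R cR *; have [[cY hY'] [cZ hZ']] := (hY, hZ).
have cl (W : regulars (opens Y)) := @closed_closure _ (\val (\val W)).
have hR := fmor_mor ultra_cover_functor hY hZ cR; have [cGR _ _] := hR.
apply/seteqP; split=> [[W V] [U WU UV]|[W V] [W' /opens_well_insideP WW' W'V]].
  have [||W' [RW' W'V]] := @regular_open_between Z (rel_image R (closure (\val (\val W))))
      _ cZ hZ' _ (open_limits_of V).
  - by apply: closed_rel_image => //; exact: closed_compact.
  - move=> z [y cy yz] [v nVv vz]; apply: nVv; apply: UV.
    have [u uy] := limit_surj y; exists u; first by apply: WU; exists y.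
    by exists y => //; exists z.
  exists W'; last first.
    by move=> v [z /W'V nz vz]; apply: contrapT => nVv; apply: nz; exists v.
  apply/opens_well_insideP => y cy; apply/(box_valP _ _ cZ cR) => z yz.
  by apply: RW'; exists y.
have cK := closed_preimage_limit hY (cl W).
have oV : open (~` rel_image ((@limit Z)^† ⊚ R ⊚ @limit Y)^† (~` \val V)).
  rewrite openC; apply: closed_rel_image; last exact: closed_rel_conv.
  apply: closed_compact; first by case: (@ultras_stone Z).
  by rewrite closedC; exact: clopens_open.
have [|U [cU KU UV]] := clopen_between (@ultras_stone Y) cK oV.
  move=> u [y /WW' + uy] [v nVv [y' uy' [z y'z vz]]].
  have /= -> := limit_unique hY' uy uy'; move=> /(box_valP _ _ cZ cR)/(_ z y'z) W'z.
  by apply: nVv; apply: W'V; exists z => //; exact: subset_closure.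
exists (set_elt cU) => // v [u /UV nu uv].
by apply: contrapT => nVv; apply: nu; exists v.
Qed.

(** * The natural isomorphisms *)

(** Both functors are I K, applied to isomorphic algebras. *)
Lemma ideals_kalg : nat_iso (functor_comp Ifun (op_functor Kfun)) (functor_comp Jfun Ifun).
Proof.
pose IK := functor_comp Ifun (op_functor Kfun).
have hIK : is_functor IK by exact: functor_comp_functor Ifun_functor (op_is_functor Kfun_functor).
apply: (nat_iso_whiskerl (H := IK) (id_functor_functor (op SubS5S)) _ hIK regular_ideals_unit).
apply: functor_comp_functor Ifun_functor.
exact: functor_comp_functor (op_is_functor (full_inclusion_functor _)) Bfun_functor.
Qed.

(** The chain runs through the ultrafilter cover because the other isomorphisms
    only speak of spaces that are presented as quotients of Stone spaces. *)
Lemma opens_vietoris : nat_iso (functor_comp Ofun (op_functor VKHaus)) (functor_comp Jfun Ofun).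
Proof.
have hG := ultra_cover_functor; have hV := VKHaus_functor; have hVS := VStoneE_functor.
have hQ := Qfun_functor; have hC := Clopfun_functor; have hK := Kfun_functor.
have hO := Ofun_functor; have hI := Ifun_functor; have hJ := Jfun_functor.
have oG := op_is_functor hG; have oV := op_is_functor hV; have oVS := op_is_functor hVS.
have oQ := op_is_functor hQ; have oC := op_is_functor hC; have oK := op_is_functor hK.
have hDB : is_functor (functor_comp (functor_comp (op_functor Delta) Bfun) Ofun).
  apply: functor_comp_functor hO.
  exact: functor_comp_functor (op_is_functor (full_inclusion_functor _)) Bfun_functor.
pose OV := functor_comp Ofun (op_functor VKHaus).
pose IK := functor_comp Ifun (op_functor Kfun).
have hOV : is_functor OV by exact: functor_comp_functor.
have hIK : is_functor IK by exact: functor_comp_functor.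
have hQG := functor_comp_functor hQ hG.
have hVQ := functor_comp_functor hV hQ; have hQV := functor_comp_functor hQ hVS.
have hCV := functor_comp_functor hC hVS; have hKC := functor_comp_functor hK hC.
have hVG := functor_comp_functor oVS oG.
pose F1 := functor_comp OV (op_functor (functor_comp Qfun ultra_cover)).
pose F2 := functor_comp (functor_comp Ofun (op_functor (functor_comp Qfun VStoneE)))
  (op_functor ultra_cover).
pose F3 := functor_comp (functor_comp Ifun (op_functor (functor_comp Clopfun VStoneE)))
  (op_functor ultra_cover).
pose F4 := functor_comp (functor_comp Ifun (op_functor (functor_comp Kfun Clopfun)))
  (op_functor ultra_cover).
have hF1 : is_functor F1 by exact: functor_comp_functor hOV (op_is_functor hQG).
have hF2 : is_functor F2.
  exact: functor_comp_functor (functor_comp_functor hO (op_is_functor hQV)) oG.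
have hF3 : is_functor F3.
  exact: functor_comp_functor (functor_comp_functor hI (op_is_functor hCV)) oG.
have hF4 : is_functor F4.
  exact: functor_comp_functor (functor_comp_functor hI (op_is_functor hKC)) oG.
have hJO := functor_comp_functor hJ hO.
have KR := KRFrmP_category.
have s1 : nat_iso OV F1.
  apply: (nat_iso_sym KR hF1 hOV).
  have := nat_iso_op KHausR_category hQG (id_functor_functor KHausR) quotient_ultras.
  exact: (nat_iso_whiskerl (op_is_functor hQG) (op_is_functor (id_functor_functor KHausR)) hOV).
have s2 : nat_iso F1 F2.
  have := nat_iso_op KHausR_category hVQ hQV vietoris_quotient.
  move/(nat_iso_whiskerl (op_is_functor hVQ) (op_is_functor hQV) hO).
  exact: (nat_iso_whiskerr oG).
have s3 : nat_iso F2 F3.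
  exact: (nat_iso_whiskerr hVG opens_quotient).
have s4 : nat_iso F3 F4.
  have := nat_iso_op SubS5S_category hCV hKC clopens_vietoris.
  move/(nat_iso_whiskerl (op_is_functor hCV) (op_is_functor hKC) hI).
  exact: (nat_iso_whiskerr oG).
have s5 : nat_iso F4 (functor_comp Jfun Ofun).
  exact: (nat_iso_whiskerl (functor_comp_functor oC oG) hDB hIK regular_opens_clopens).
apply: (nat_iso_trans KR hOV hF1 hJO s1).
apply: (nat_iso_trans KR hF1 hF2 hJO s2).
apply: (nat_iso_trans KR hF2 hF3 hJO s3).
exact: (nat_iso_trans KR hF3 hF4 hJO s4 s5).
Qed.

Theorem theorem8p14 :
  [/\ is_category KHausR, is_category StoneER, is_category SubS5S,
      is_category DeVS & is_category KRFrmP] /\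
  [/\ is_functor Qfun, is_functor Clopfun, is_functor Ofun & is_functor Ifun] /\
  [/\ is_functor VKHaus, is_functor VStoneE, is_functor Kfun,
      is_functor Bfun & is_functor Jfun] /\
  [/\ VKHaus ∘ Qfun ≃ Qfun ∘ VStoneE,
      Clopfun ∘ VStoneE ≃ Kfun ∘ Clopfun,
      Ifun ∘ op_functor Kfun ≃ Jfun ∘ Ifun,
      Ofun ∘ op_functor Qfun ≃ Ifun ∘ op_functor Clopfun &
      Ofun ∘ op_functor VKHaus ≃ Jfun ∘ Ofun].
Proof.
split; first by split; [exact: KHausR_category|exact: StoneER_category|
  exact: SubS5S_category|exact: DeVS_category|exact: KRFrmP_category].
split; first by split; [exact: Qfun_functor|exact: Clopfun_functor|
  exact: Ofun_functor|exact: Ifun_functor].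
split; first by split; [exact: VKHaus_functor|exact: VStoneE_functor|
  exact: Kfun_functor|exact: Bfun_functor|exact: Jfun_functor].
split; [exact: vietoris_quotient|exact: clopens_vietoris|exact: ideals_kalg|
  exact: opens_quotient|exact: opens_vietoris].
Qed.
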